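(* Let $m\ge 1$, $M=\{1,\ldots,m\}$, let $\mathcal{M}$ be an upward closed collection of nonempty subsets of $M$ (possibly empty), and let $\mu$ be a finite measure on $I^m=[0,1]^m$. Consider the extremal problem $$\|\Omega\|^2_{\mathbf{H}^m}\to\min\quad\text{over all }\Omega\in\mathbf{H}^m\text{ such that }\int_{I^m}\Omega(\mathbf{x})\,d\mu(\mathbf{x})=1\ \text{ and }\ \Omega(\mathbf{x})|_{\mathbf{x}_U=\mathbf{1}}=0\ \text{ for all }U\in\mathcal{M},$$ and assume its constraint set is nonempty. Then the solution of this problem is given by $$\Omega(\mathbf{x})=\lambda^{-1}\int_{I^m}\mathcal{G}_{\mathcal{M}}(\mathbf{x},\boldsymbol{\xi})\,d\mu(\boldsymbol{\xi}),\qquad \mathbf{x}\in I^m,$$ where $\mathcal{G}_{\mathcal{M}}$ is the Green function of the boundary-value problem described in the context and equals $$\mathcal{G}_{\mathcal{M}}(\mathbf{x},\boldsymbol{\xi})=K_M(\mathbf{x},\boldsymbol{\xi})-\sum_{U\in\mathcal{M}}a_U\,K_{U^c}(\mathbf{x},\boldsymbol{\xi})\,k_U(\mathbf{x},\boldsymbol{\xi}),$$ with the coefficients $a_U$, $U\in\mathcal{M}$, defined recurrently by $$\sum_{V\subset U,\ V\in\mathcal{M}}a_V=1\qquad\text{for all }U\in\mathcal{M},$$ and the constant $\lambda$ is given by $$\lambda=\iint_{I^m\times I^m}\mathcal{G}_{\mathcal{M}}(\mathbf{x},\boldsymbol{\xi})\,d\mu(\mathbf{x})\,d\mu(\bolds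ymbol{\xi}).$$
   Context: The space $\mathbf{H}^m$. Let $\mathbf{C}_0^m=\{\Omega\in C^m(I^m):\Omega(\mathbf{x})|_{x_j=0}=0,\ j=1,\ldots,m\}$, where $C^m(I^m)$ consists of the functions that are $m$ times continuously differentiable with respect to each variable, with scalar product $(\Omega_1,\Omega_2)=\int_{I^m}\omega_1(\mathbf{x})\omega_2(\mathbf{x})\,d\mathbf{x}$, $\omega_i=\dfrac{\partial^m\Omega_i}{\partial x_1\cdots\partial x_m}$. $\mathbf{H}^m$ is the closure (completion) of $\mathbf{C}_0^m$ under the norm induced by this scalar product. It is a Hilbert space embedded compactly in $C(I^m)$, so its elements are continuous functions on $I^m$ vanishing whenever some $x_j=0$; pointwise boundary conditions make sense for them. Notation. For $U\subset M$, $\mathbf{x}_U=(x_i:i\in U)$, $U^c=M\setminus U$, and $\mathbf{1}$ is a vector of ones; the condition $\Omega|_{\mathbf{x}_U=\mathbf{1}}=0$ means $\Omega(\mathbf{x})=0$ whenever $x_i=1$ for all $i\in U$. ''Upward closed'' means: if $U\subset V\subset M$ and $U\in\mathcal{M}$ then $V\in\mathcal{M}$. For $\mathbf{x},\boldsymbol{\xi}\in I^m$ put $K_j(\mathbf{x},\boldsymbol{\xi})=\min(x_j,\xi_j)$, $k_j(\mathbf{x},\boldsymbol{\xi})=x_j\xi_j$, and $K_U=\prod_{j\in U}K_j$, $k_U=\prod_{j\in U}k_j$ (empty products equal $1$). Boundary-value problem. The Euler–Lagrange equation of the extremal problem, with Lagrange multiplier $\lambda$, is $(-1)^m\lambda\,\dfrac{\partial^{2m}\Omega}{\partial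 x_1^2\cdots\partial x_m^2}=\mu$ (in the sense of distributions), together with the conditions $\Omega\in\mathbf{H}^m$, $\Omega|_{\mathbf{x}_U=\mathbf{1}}=0$ for all $U\in\mathcal{M}$, and the natural boundary conditions $$\frac{\partial^{\,l+2k}\Omega(\mathbf{x})}{\partial\mathbf{x}_V\,\partial\mathbf{x}_{V^c}^2}\Big|_{\mathbf{x}_V=\mathbf{1}}=0\quad\text{for every }V\subset M,\ V\notin\mathcal{M},\ V\ne\emptyset,$$ where $l=|V|$, $k=m-l$, and $\partial\mathbf{x}_V\partial\mathbf{x}^2_{V^c}$ means differentiating once in each $x_i$, $i\in V$, and twice in each $x_j$, $j\in V^c$. The Green function $\mathcal{G}_{\mathcal{M}}(\mathbf{x},\boldsymbol{\xi})$ is the function which, as a function of $\mathbf{x}$, satisfies these boundary conditions and the equation $(-1)^m\dfrac{\partial^{2m}\mathcal{G}_{\mathcal{M}}(\mathbf{x},\boldsymbol{\xi})}{\partial x_1^2\cdots\partial x_m^2}=\delta(\mathbf{x}-\boldsymbol{\xi})$, $\delta$ being the Dirac function. *)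

(* Defs.v *)
From HB Require Import structures.
From mathcomp Require Export all_boot all_order all_algebra.
From mathcomp Require Export all_classical all_reals all_analysis.
Set Implicit Arguments.
Unset Strict Implicit.
Unset Printing Implicit Defensive.
Export Order.TTheory GRing.Theory Num.Theory.
Export numFieldNormedType.Exports.

#[export] Set Implicit Arguments.
#[export] Unset Strict Implicit.
#[export] Unset Printing Implicit Defensive.

Local Open Scope classical_set_scope.
Local Open Scope ring_scope.

(* R^m with its Borel sigma-algebra; its carrier is 'rV[R]_m. *)
Definition borelRn (R : realType) (m : nat) :=
  g_sigma_algebraType (@open 'rV[R]_m).

Definition allI (m : nat) : {set 'I_m} := finset.setT.

Section Cube.
Context {R : realType} {m : nat}.
Implicit Types (x y xi : 'rV[R]_m) (f g : 'rV[R]_m -> R) (U V W : {set 'I_m}).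

Definition cube : set 'rV[R]_m := [set x | forall i, 0 <= x 0 i <= 1].

Definition open_cube : set 'rV[R]_m := [set x | forall i, 0 < x 0 i < 1].

(* The part of the cube lying near the face x_V = 1. *)
Definition near_face V (e : R) : set 'rV[R]_m :=
  [set x | cube x /\ forall i, i \in V -> 1 - e <= x 0 i].

Definition zero_on_face f U :=
  forall x, cube x -> (forall i, i \in U -> x 0 i = 1) -> f x = 0.

(* Partial derivatives of functions on a closed box D: the increment is
   required to stay in D, so the derivative is one-sided on the faces of D.
   Values taken outside D are never used. *)
Definition pd_quotient (D : set 'rV[R]_m) (i : 'I_m) f x : set_system R :=
  (fun h : R => h^-1 * (f (x + h *: delta_mx 0 i) - f x))
    @ within [set h | D (x + h *: delta_mx 0 i)] 0^'.

Definition pderivable D i f x : Prop := cvg (pd_quotient D i f x).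

Definition pd D i f x : R := lim (pd_quotient D i f x).

Fixpoint Ck (D : set 'rV[R]_m) (k : nat) f : Prop :=
  {within D, continuous f} /\
  match k with
  | 0%N => True
  | k'.+1 => forall i, (forall x, D x -> pderivable D i f x) /\
                       Ck D k' (pd D i f)
  end.

Definition pdU D U f : 'rV[R]_m -> R := foldr (pd D) f (enum U).

(* Integration of one coordinate over [0, 1], the others being fixed. *)
Definition set_coord (i : 'I_m) (t : R) x : 'rV[R]_m :=
  \row_j (if j == i then t else x 0 j).

Definition int1 (i : 'I_m) f x : R :=
  \int[@lebesgue_measure R]_(t in `[0, 1]) f (set_coord i t x).

(* Iterated integral over the coordinates in U, as a function of the remaining
   ones. It is only applied to functions that are continuous on the cube, for
   which it agrees with the integral with respect to Lebesgue measure. *)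
Definition intU U f : 'rV[R]_m -> R := foldr int1 f (enum U).

(* The base point 0 is irrelevant: every coordinate is integrated. *)
Definition int_cube f : R := intU (allI m) f 0.

Definition C0m f : Prop :=
  Ck cube m f /\ forall x, cube x -> forall j, x 0 j = 0 -> f x = 0.

Definition dotC f g : R :=
  int_cube (fun x => pdU cube (allI m) f x * pdU cube (allI m) g x).

Definition normC2 f : R := dotC f f.

(* Elements of the completion of C0m are realised as functions: f stands for
   the class of a Cauchy sequence u when u converges uniformly to f. This is
   legitimate because Cauchy sequences converge uniformly, and the uniform limit
   determines the class. *)
Definition Hm_approx (u : nat -> 'rV[R]_m -> R) f : Prop :=
  [/\ forall n, C0m (u n),
      forall e : R, 0 < e -> exists N : nat, forall p q : nat,
        (N <= p)%N -> (N <= q)%N -> normC2 (fun x => u p x - u q x) < e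
    & {uniform cube, u @ \oo --> f}].

Definition Hm f : Prop := exists u, Hm_approx u f.

(* The squared norm of H^m, extended from C0m by continuity. *)
Definition normH2 f : R :=
  xget 0 [set r | exists u, Hm_approx u f /\ (normC2 (u n) @[n --> \oo] --> r)].

Definition admissible (MM : {set {set 'I_m}})
    (mu : {finite_measure set (borelRn R m) -> \bar R}) f : Prop :=
  [/\ Hm f,
      \int[mu]_(x in (cube : set (borelRn R m))) f x = 1
    & forall U, U \in MM -> zero_on_face f U].

Definition extremal_solution (MM : {set {set 'I_m}})
    (mu : {finite_measure set (borelRn R m) -> \bar R}) f : Prop :=
  admissible MM mu f /\
  forall g, admissible MM mu g -> normH2 f <= normH2 g.

(* Test functions in the variables x_W, i.e. elements of C_c^oo((0,1)^W), seen
   as functions on the cube that do not depend on the other variables. *)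
Definition test_fun W f : Prop :=
  [/\ forall k, Ck cube k f,
      forall x y, cube x -> cube y ->
        (forall i, i \in W -> x 0 i = y 0 i) -> f x = f y
    & exists2 e : R, 0 < e & forall x, cube x ->
        (exists2 i, i \in W & x 0 i < e \/ 1 - e < x 0 i) -> f x = 0].

(* Action on a test function phi of x_W of the distribution (in x_W)
   obtained by differentiating f twice in each x_j, j \in W; the result is a
   function of the variables x_{W^c}. *)
Definition dist_pd2 W f phi : 'rV[R]_m -> R :=
  intU W (fun y => f y * pdU cube W (pdU cube W phi) y).

(* (-1)^m d^{2m} f / dx_1^2 ... dx_m^2 = T in the sense of distributions. *)
Definition dist_equation (T : ('rV[R]_m -> R) -> R) f : Prop :=
  forall phi, test_fun (allI m) phi ->
    (-1) ^+ m * dist_pd2 (allI m) f phi 0 = T phi.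

(* d^{l+2k} f / dx_V dx_{V^c}^2 = 0 at x_V = 1: the second derivatives in
   x_{V^c} are distributional; paired with any test function of x_{V^c} they
   give a function of x_V, which is of class C^l up to x_V = 1 and whose
   mixed derivative in x_V vanishes there. *)
Definition natural_bc V f : Prop :=
  exists2 e : R, 0 < e & forall phi, test_fun (~: V) phi ->
    Ck (near_face V e) #|V| (dist_pd2 (~: V) f phi) /\
    zero_on_face (pdU (near_face V e) V (dist_pd2 (~: V) f phi)) V.

Definition bvp_solution (MM : {set {set 'I_m}}) (T : ('rV[R]_m -> R) -> R) f :=
  [/\ Hm f,
      forall U, U \in MM -> zero_on_face f U,
      forall V, V \notin MM -> V != finset.set0 -> natural_bc V f
    & dist_equation T f].

(* The equation with right-hand side delta(x - xi) makes sense for xi in the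
   open cube; on the boundary the Green function is determined by continuity. *)
Definition is_green (MM : {set {set 'I_m}}) (G : 'rV[R]_m -> 'rV[R]_m -> R) :=
  {within cube `*` cube, continuous (fun z => G z.1 z.2)} /\
  forall xi, open_cube xi ->
    bvp_solution MM (fun phi => phi xi) (fun x => G x xi).

Definition Kmin U x xi : R := \prod_(j in U) Num.min (x 0 j) (xi 0 j).

Definition kprod U x xi : R := \prod_(j in U) (x 0 j * xi 0 j).

Definition green_kernel (MM : {set {set 'I_m}}) (a : {set 'I_m} -> R) x xi : R :=
  Kmin (allI m) x xi -
  \sum_(U in MM) a U * (Kmin (~: U) x xi * kprod U x xi).

(* Only the values a U with U \in MM are relevant. *)
Definition green_coefs (MM : {set {set 'I_m}}) (a : {set 'I_m} -> R) : Prop :=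
  forall U, U \in MM -> \sum_(V in MM | V \subset U) a V = 1.

Definition upward_closed (MM : {set {set 'I_m}}) : Prop :=
  forall U V, U \subset V -> U \in MM -> V \in MM.

Lemma green_coefs_exist (MM : {set {set 'I_m}}) : exists a, green_coefs MM a.
Proof.
have [b bS] : exists b : nat -> {set 'I_m} -> R, forall n U,
    b n.+1 U = 1 - \sum_(V in MM | V \proper U) b n V.
  by exists (fix b n U := if n is n'.+1 then
    1 - \sum_(V in MM | V \proper U) b n' V else 0).
have bE n n' U : (#|U| < n)%N -> (#|U| < n')%N -> b n U = b n' U.
  elim: n n' U => // n IH [|n'] U //= Un Un'; rewrite !bS; congr (1 - _).
  by apply: eq_bigr => V /andP[_ /proper_card VU]; apply: IH;
    exact: leq_trans VU _.
exists (fun U => b #|U|.+1 U) => U UMM.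
rewrite (bigD1 U) ?UMM ?subxx//= bS.
rewrite [X in _ + X](_ : _ = \sum_(V in MM | V \proper U) b #|U| V) ?subrK//.
apply: eq_big => [V|V /andP[/andP[VM VU] nVU]].
  by rewrite finset.properEneq -andbA [(V != U) && _]andbC.
by apply: bE => //; rewrite proper_card// finset.properEneq nVU VU.
Qed.

Lemma green_coefs_uniq (MM : {set {set 'I_m}}) a b :
  green_coefs MM a -> green_coefs MM b -> {in MM, a =1 b}.
Proof.
move=> ha hb U; have [n] := ubnP #|U|; elim: n U => // n IH U /ltnSE Un UMM.
have := ha _ UMM; rewrite -(hb _ UMM) (bigD1 U) /= ?UMM ?subxx//.
rewrite [X in _ = X -> _](bigD1 U) /= ?UMM ?subxx//.
rewrite (eq_bigr b) => [/addIr //|V /andP[/andP[VM VU] nVU]].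
apply: IH => //; apply: leq_trans Un.
by rewrite proper_card// finset.properEneq nVU VU.
Qed.

End Cube.

(* Main.v *)
Require Import Defs.
From mathcomp Require Import measurable_realfun ring lra.

(** The theorem joins two facts about the kernel G of the statement: it is the reproducing
kernel of the subspace of H^m cut out by the boundary conditions on the faces x_U = 1, and it
is the only solution of the boundary-value problem.

Reproducing kernel. For f in H^m, the scalar product of f with K_{U^c} k_U(., xi) is the value
of f at the point with coordinates 1 in U and xi_j elsewhere, times the product of the xi_j
over U: in each variable the derivative of the kernel is the indicator function of [0, xi_j] or
the constant xi_j, so this is the fundamental theorem of calculus ([dotH_kfac]). If f vanishes
on the faces of MM, only the term K_M contributes to the product with G(., xi), and it gives
f(xi) ([green_reproducing]). The relations defining the coefficients make G(., xi) vanish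
on these faces ([green_zero_on_face]). As H^m is defined by smooth Cauchy sequences and
their uniform limits, this first needs closability of the norm ([int_mixed_cvg0]), that is, the
fact that a limit function determines its norm, and then completeness ([Hm_complete]).

Extremal problem. A minimiser exists by the parallelogram identity ([extremal_exists]). By the
first variation it is orthogonal to the admissible directions, and testing this with G(., x)
gives Omega(x) = |Omega|^2 int G(x, .) dmu ([extremal_rep]). Integrating against mu yields
1 = |Omega|^2 lambda, which determines the constant and shows that lambda is not 0.

The kernel solves the boundary-value problem. Two integrations by parts in each variable of W
show that the second derivative of min(x_j, xi_j) is minus a Dirac mass, and that linear factors
are annihilated ([dist_pd2_kfac]). If V is not in MM, no set of MM is contained in V, so every
correction term has a linear factor outside V and disappears when one differentiates in the
variables outside V ([dist_pd2_green]). For V empty this is the equation; otherwise, close to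
the face x_V = 1, the remaining function of x_V is constant, whence the natural boundary
conditions.

Uniqueness. Let w be the difference of two solutions. A function that vanishes when one of its
variables is 0 is 0 as soon as it is killed by all products of evaluations at 1 and second
derivatives, one for each variable ([zero_test]). For w such a product means: restrict w to a
face x_V = 1 and differentiate twice in the other variables. That this vanishes is shown by
induction on V ([bvp_unique]). If V is in MM, w is 0 on the face. If not, the induction
hypothesis shows that, after differentiation in the variables outside V, w is a constant times
the product of the x_i, i in V; the mixed derivative at x_V = 1 is this constant, so the natural
boundary condition, or the equation if V is empty, makes it 0.

Distributional derivatives, norms and boundary values are all handled as tensor products of
bounded functionals of one variable ([tensor]). These commute ([opiC]) and satisfy a formula of
integration by parts ([tensor_pdl]), so that every computation takes place in one variable. *)

Local Open Scope classical_set_scope.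
Local Open Scope ring_scope.

(** * Uniform continuity on compact sets *)

Section UniformContinuity.
Context {R : realType} {T : pseudoMetricType R}.
Implicit Types (A : set T) (f g : T -> R).

Definition ucont A f := forall e : R, 0 < e ->
  exists2 d : R, 0 < d & forall x y, A x -> A y -> ball x d y -> `|f x - f y| < e.

(** Heine's theorem. Continuity on compact sets is always used in this uniform form, so that
the limits below reduce to estimates. *)
Lemma ucontP A f : compact A -> {within A, continuous f} <-> ucont A f.
Proof.
move=> cA; split.
  move=> /subspace_continuousP cf e e0.
  pose P d x := A x -> forall y, A y -> ball x d y -> `|f x - f y| < e.
  have cov : forall x, A x -> \forall x' \near x & d \near 0^'+, P d x'.
    move=> x Ax; have e20 : 0 < e / 2 by rewrite divr_gt0.
    have /cvgrPdist_lt/(_ _ e20) := cf x Ax.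
    rewrite near_withinE => /nbhs_ballP[r /= r0 Hr].
    exists (ball x (r / 2), [set d | 0 < d < r / 2]) => /=.
      split; first by apply: nbhsx_ballx; rewrite divr_gt0.
      by near=> d; apply/andP; split => //; near: d; apply: nbhs_right_lt;
        rewrite divr_gt0.
    move=> [x' d] /= [xx' /andP[d0 dr]] Ax' y Ay x'y.
    have h1 : `|f x - f x'| < e / 2.
      by apply: Hr => //; apply: le_ball xx'; rewrite ler_pdivrMr// ler_peMr ?ltW// ltr1n.
    have h2 : `|f x - f y| < e / 2.
      apply: Hr => //; rewrite (splitr r); apply: ball_triangle xx' _.
      by apply: le_ball x'y; exact: ltW.
    rewrite (_ : f x' - f y = (f x' - f x) + (f x - f y)); last by ring.
    by rewrite (le_lt_trans (ler_normD _ _))// distrC (splitr e) ltrD.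
  have {cov} H := (compact_near_coveringP A).1 cA _ _ P _ cov.
  have [d [d0 Hd]] : exists d, 0 < d /\ forall x, A x -> P d x.
    near (0 : R)^'+ => d; exists d; split => //.
    by near: d; apply: H.
  by exists d => // x y Ax Ay; exact: Hd.
move=> uf; apply/subspace_continuousP => x Ax; apply/cvgrPdist_lt => e e0.
have [d d0 Hd] := uf _ e0.
rewrite near_withinE; apply/nbhs_ballP; exists d => // y xy Ay.
exact: Hd.
Unshelve. all: by end_near. Qed.

Lemma eq_ucont A f g : (forall x, A x -> f x = g x) -> ucont A f -> ucont A g.
Proof.
move=> fg uf e /uf[d d0 Hd]; exists d => // x y Ax Ay xy.
by rewrite -!fg//; exact: Hd.
Qed.

Lemma ucont_cst A (c : R) : ucont A (fun=> c).
Proof. by move=> e e0; exists 1 => // x y; rewrite subrr normr0. Qed.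

Lemma ucontD A f g : ucont A f -> ucont A g -> ucont A (fun x => f x + g x).
Proof.
move=> uf ug e e0; have e20 : 0 < e / 2 by rewrite divr_gt0.
have [d d0 Hd] := uf _ e20; have [d' d'0 Hd'] := ug _ e20.
exists (Num.min d d'); first by rewrite lt_min d0.
move=> x y Ax Ay xy; have xd : ball x d y by apply: le_ball xy; rewrite ge_min lexx.
have xd' : ball x d' y by apply: le_ball xy; rewrite ge_min lexx orbT.
rewrite (_ : _ - _ = (f x - f y) + (g x - g y)); last by ring.
by rewrite (le_lt_trans (ler_normD _ _))// (splitr e) ltrD// ?Hd ?Hd'.
Qed.

Definition bounded_by A (K : R) f := forall x, A x -> `|f x| <= K.

Lemma ucont_bounded A f : compact A -> ucont A f -> exists2 K : R, 0 < K & bounded_by A K f.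
Proof.
move=> cA /(ucontP _ cA) cf; have := continuous_compact cf cA.
move=> /compact_bounded[M [_ HM]].
exists (Num.max 1 (M + 1)); first by rewrite lt_max ltr01.
move=> x Ax; apply: HM; last by exists x.
by rewrite lt_max ltrDl ltr01 orbT.
Qed.

Lemma ucontM A f g : compact A -> ucont A f -> ucont A g ->
  ucont A (fun x => f x * g x).
Proof.
move=> cA uf ug e e0.
have [K K0 HK] := ucont_bounded cA uf; have [L L0 HL] := ucont_bounded cA ug.
have eL : 0 < e / (L + K) by rewrite divr_gt0// addr_gt0.
have [d d0 Hd] := uf _ eL; have [d' d'0 Hd'] := ug _ eL.
exists (Num.min d d'); first by rewrite lt_min d0.
move=> x y Ax Ay xy; have xd : ball x d y by apply: le_ball xy; rewrite ge_min lexx.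
have xd' : ball x d' y by apply: le_ball xy; rewrite ge_min lexx orbT.
rewrite (_ : _ - _ = (f x - f y) * g x + f y * (g x - g y)); last by ring.
rewrite (le_lt_trans (ler_normD _ _))// !normrM.
rewrite (_ : e = e / (L + K) * L + K * (e / (L + K))); last first.
  by field; rewrite gt_eqF// addr_gt0.
rewrite ltr_leD//.
  have [->|gx] := eqVneq `|g x| 0; first by rewrite mulr0 mulr_gt0.
  rewrite (@lt_le_trans _ _ (e / (L + K) * `|g x|))//.
    by rewrite ltr_pM2r ?Hd// lt_neqAle eq_sym gx normr_ge0.
  by rewrite ler_wpM2l ?HL// ltW.
by rewrite ler_pM// ?HK// ltW// Hd'.
Qed.

Lemma ucontZ A (c : R) f : ucont A f -> ucont A (fun x => c * f x).
Proof.
move=> uf e e0; have c0 : 0 < `|c| + 1 by rewrite ltr_wpDl.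
have [d d0 Hd] := uf _ (divr_gt0 e0 c0); exists d => // x y Ax Ay xy.
rewrite -mulrBr normrM; have := Hd x y Ax Ay xy; rewrite ltr_pdivlMr// => /(le_lt_trans _).
by apply; rewrite mulrC ler_wpM2l// lerDl.
Qed.

Lemma ucontB A f g : ucont A f -> ucont A g -> ucont A (fun x => f x - g x).
Proof.
move=> uf ug; apply: (@eq_ucont _ (fun x => f x + -1 * g x)) => [x _|].
  by rewrite mulN1r.
exact/ucontD/ucontZ.
Qed.

Lemma ucont_sum A (I : Type) (r : seq I) (P : pred I) (F : I -> T -> R) :
  (forall i, P i -> ucont A (F i)) -> ucont A (fun x => \sum_(i <- r | P i) F i x).
Proof.
move=> uF; elim: r => [|i r IH].
  by apply: eq_ucont (@ucont_cst A 0) => x _; rewrite big_nil.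
apply: eq_ucont (_ : ucont A (fun x => (if P i then F i x else 0) +
    \sum_(i <- r | P i) F i x)) => [x _|].
  by rewrite big_cons; case: ifP => _ //; rewrite add0r.
by apply: ucontD => //; case Pi: (P i); [exact: uF|exact: ucont_cst].
Qed.

Lemma ucont_prod A (I : Type) (r : seq I) (P : pred I) (F : I -> T -> R) : compact A ->
  (forall i, P i -> ucont A (F i)) -> ucont A (fun x => \prod_(i <- r | P i) F i x).
Proof.
move=> cA uF; elim: r => [|i r IH].
  by apply: eq_ucont (@ucont_cst A 1) => x _; rewrite big_nil.
apply: eq_ucont (_ : ucont A (fun x => (if P i then F i x else 1) *
    \prod_(i <- r | P i) F i x)) => [x _|].
  by rewrite big_cons; case: ifP => _ //; rewrite mul1r.
by apply: ucontM => //; case Pi: (P i); [exact: uF|exact: ucont_cst].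
Qed.

Lemma ucont_lim A (u : nat -> T -> R) f : (forall n, ucont A (u n)) ->
  (forall e : R, 0 < e -> exists n, forall x, A x -> `|f x - u n x| < e) -> ucont A f.
Proof.
move=> uu uf e e0; have e30 : 0 < e / 3 by rewrite divr_gt0.
have [n Hn] := uf _ e30; have [d d0 Hd] := uu n _ e30.
exists d => // x y Ax Ay xy.
rewrite (_ : f x - f y = (f x - u n x) + (u n x - u n y) - (f y - u n y)); last by ring.
have h1 := Hn x Ax; have h2 := Hn y Ay; have h3 := Hd x y Ax Ay xy.
rewrite (le_lt_trans (ler_normB _ _))//; move: (ler_normD (f x - u n x) (u n x - u n y)).
lra.
Qed.

End UniformContinuity.

(** * Integration on subintervals of [0, 1] *)

Section OneDim.
Context {R : realType}.
Implicit Types (f g h : R -> R) (a b c t : R).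

Definition cI : set R := `[0, 1].

Lemma cIE t : cI t = (0 <= t <= 1) :> Prop.
Proof. by rewrite /cI /= in_itv. Qed.

Lemma cI_compact : compact cI. Proof. exact: segment_compact. Qed.

Lemma cI0 : cI 0. Proof. by rewrite cIE lexx ler01. Qed.

Lemma cI1 : cI 1. Proof. by rewrite cIE lexx ler01. Qed.

Definition itg a b g := \int[@lebesgue_measure R]_(t in `[a, b]) g t.

Lemma sub_cI a b : 0 <= a -> b <= 1 -> `[a, b] `<=` cI.
Proof.
by move=> a0 b1 t /=; rewrite cIE in_itv/= => /andP[at_ tb]; apply/andP; split;
  [exact: le_trans at_|exact: le_trans b1].
Qed.

Lemma ucont_within a b g : 0 <= a -> b <= 1 -> ucont cI g ->
  {within `[a, b], continuous g}.
Proof.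
by move=> a0 b1 /(ucontP _ cI_compact); exact: continuous_subspaceW (sub_cI _ _).
Qed.

Lemma ucont_integrable a b g : 0 <= a -> b <= 1 -> ucont cI g ->
  (@lebesgue_measure R).-integrable `[a, b] (EFin \o g).
Proof.
by move=> a0 b1 ug; apply: continuous_compact_integrable;
  [exact: segment_compact|exact: ucont_within].
Qed.

Lemma eq_itg a b f g : (forall t, a <= t <= b -> f t = g t) -> itg a b f = itg a b g.
Proof.
by move=> fg; apply: eq_Rintegral => t; rewrite inE/= in_itv/=; exact: fg.
Qed.

Lemma itg_lin a b c f g : 0 <= a -> b <= 1 -> ucont cI f -> ucont cI g ->
  itg a b (fun t => c * f t + g t) = c * itg a b f + itg a b g.
Proof.
move=> a0 b1 uf ug; rewrite /itg RintegralD//; last 2 first.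
- exact: (@ucont_integrable a b (fun t => c * f t) a0 b1 (ucontZ c uf)).
- exact: ucont_integrable.
by rewrite RintegralZl//; exact: ucont_integrable.
Qed.

Lemma itg_ge0 a b g : (forall t, a <= t <= b -> 0 <= g t) -> 0 <= itg a b g.
Proof. by move=> g0; apply: Rintegral_ge0 => t /=; rewrite in_itv/=; exact: g0. Qed.

Lemma itg_bound a b K g : 0 <= a -> a <= b -> b <= 1 -> ucont cI g ->
  (forall t, a <= t <= b -> `|g t| <= K) -> `|itg a b g| <= K * (b - a).
Proof.
move=> a0 ab b1 ug gK; apply: le_trans (le_normr_Rintegral _ _) _ => //.
  exact: ucont_integrable.
have -> : K * (b - a) = itg a b (fun=> K).
  rewrite /itg Rintegral_cst//= lebesgue_measure_itv/= lte_fin.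
  case: ltP => [_ //|ba]; have -> : b = a by apply/eqP; rewrite eq_le ba ab.
  by rewrite subrr.
apply: le_Rintegral => //=.
- apply: (@ucont_integrable a b (fun t => `|g t|)) => // e /ug[d d0 Hd].
  exists d => // x y Ax Ay xy; apply: le_lt_trans (Hd _ _ Ax Ay xy).
  exact: ler_dist_dist.
- exact: (@ucont_integrable a b (fun=> K) a0 b1 (@ucont_cst _ _ _ _)).
Qed.

Lemma itg_split a c b g : 0 <= a -> a <= c -> c <= b -> b <= 1 -> ucont cI g ->
  itg a b g = itg a c g + itg c b g.
Proof.
move=> a0 ac cb b1 ug.
have := @Rintegral_itvB R g (BLeft a) (BRight b) c (ucont_integrable a0 b1 ug).
rewrite !bnd_simp => /(_ ac cb); rewrite Rintegral_itv_obnd_cbnd => [H|].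
  by rewrite /itg -H addrC subrK.
apply: integrableS (ucont_integrable (le_trans a0 ac) b1 ug) => //.
by move=> t /=; rewrite !in_itv/= => /andP[/ltW -> ->].
Qed.

(** The derivative is an argument, so that the fundamental theorem of calculus applies to
products and slices without computing [derive1]; the end points are left out because a slice of a
function on the cube is only one-sidedly differentiable there. *)
Definition c1 g g' := [/\ ucont cI g, ucont cI g' &
  forall t, 0 < t < 1 -> is_derive t 1 g (g' t)].

Lemma FTC a b g g' : 0 <= a -> a <= b -> b <= 1 -> c1 g g' ->
  itg a b g' = g b - g a.
Proof.
move=> a0; rewrite le_eqVlt => /predU1P[<- _ _|ab b1 [ug ug' dg]].
  by rewrite subrr /itg set_itv1 Rintegral_set1.
have [c0 ca cb] := (continuous_within_itvP _ ab).1 (ucont_within a0 b1 ug).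
have dgi : {in `]a, b[, forall t, is_derive t 1 g (g' t)}.
  move=> t; rewrite in_itv/= => /andP[at_ tb]; apply: dg.
  by rewrite (le_lt_trans a0 at_) (lt_le_trans tb b1).
have := continuous_FTC2 ab (ucont_within a0 b1 ug') (F := g) _ _.
rewrite /itg /Rintegral => -> //.
  by split => // t /dgi H; exact: ex_derive.
by move=> t /dgi H; rewrite derive1E; exact: derive_val.
Qed.

Lemma c1M f f' g g' : c1 f f' -> c1 g g' ->
  c1 (fun t => f t * g t) (fun t => f t * g' t + g t * f' t).
Proof.
move=> [uf uf' df] [ug ug' dg]; split.
- exact: ucontM cI_compact _ _.
- by apply: ucontD; apply: ucontM cI_compact _ _.
move=> t t01; have ? := df t t01; have ? := dg t t01.
exact: (@is_deriveM _ _ f g).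
Qed.

Lemma by_parts f f' g g' : c1 f f' -> c1 g g' ->
  itg 0 1 (fun t => f t * g' t) =
  f 1 * g 1 - f 0 * g 0 - itg 0 1 (fun t => f' t * g t).
Proof.
move=> cf cg; have := FTC (lexx 0) ler01 (lexx 1) (c1M cf cg).
case: cf cg => uf uf' _ [ug ug' _] <-.
have := @itg_lin 0 1 1 (fun t => f t * g' t) (fun t => f' t * g t) (lexx 0) (lexx 1)
  (ucontM cI_compact uf ug') (ucontM cI_compact uf' ug).
rewrite mul1r => H; apply/eqP; rewrite eq_sym subr_eq -H; apply/eqP.
by apply: eq_itg => t _; rewrite mul1r (mulrC (f' t)).
Qed.

Lemma itg_zero a b g : 0 <= a -> a <= b -> b <= 1 -> ucont cI g ->
  (forall t, a <= t <= b -> g t = 0) -> itg a b g = 0.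
Proof.
move=> a0 ab b1 ug g0; apply/eqP; rewrite -normr_le0 -(mul0r (b - a)).
by apply: itg_bound => // t /g0 ->; rewrite normr0.
Qed.

Lemma itg_tail s b K g : 0 <= s -> s <= 1 -> s <= b -> 0 <= K -> ucont cI g ->
  (forall t, s <= t <= 1 -> `|g t| <= K) -> (forall t, b <= t <= 1 -> g t = 0) ->
  `|itg s 1 g| <= K * (b - s).
Proof.
move=> s0 s1 sb K0 ug gK g0; have [b1|b1] := leP 1 b.
  apply: le_trans (itg_bound s0 s1 (lexx 1) ug gK) _.
  by rewrite ler_wpM2l// lerB.
rewrite (itg_split s0 sb (ltW b1) (lexx 1) ug).
rewrite (itg_zero (le_trans s0 sb) (ltW b1) (lexx 1) ug g0) addr0.
apply: itg_bound (ltW b1) ug _ => // t /andP[st tb]; apply: gK.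
by rewrite st (le_trans tb)// ltW.
Qed.

(** Applied to Dirac sequences, K is of order 1 / (b - a). *)
Lemma itg_supp a b K g : 0 <= a -> a <= 1 -> a <= b -> 0 <= K -> ucont cI g ->
  (forall t, 0 <= t <= 1 -> `|g t| <= K) ->
  (forall t, 0 <= t <= 1 -> (t <= a) || (b <= t) -> g t = 0) ->
  `|itg 0 1 g| <= K * (b - a).
Proof.
move=> a0 a1 ab K0 ug gK g0.
rewrite (itg_split (lexx 0) a0 a1 (lexx 1) ug).
rewrite (itg_zero (lexx 0) a0 a1 ug) ?add0r; last first.
  by move=> t /andP[t0 ta]; rewrite g0 ?ta// t0 (le_trans ta).
apply: itg_tail => // t /andP[ta t1].
  by apply: gK; rewrite t1 (le_trans a0).
by apply: g0; rewrite ?ta ?orbT// t1 (le_trans a0)// (le_trans ab).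
Qed.

End OneDim.

(** * Smooth functions of one variable *)

Section Smooth.
Context {R : realType}.
Implicit Types (f g p q : R -> R) (a b c t : R).

Fixpoint Ck1 (k : nat) q : Prop :=
  match k with
  | 0%N => continuous q
  | k'.+1 => (forall t, derivable q t 1) /\ Ck1 k' (derive1 q)
  end.

Definition smooth q := forall k, Ck1 k q.

Lemma is_derive_derive1 q q' t : is_derive t 1 q (q' t) -> (derive1 q) t = q' t.
Proof. by move=> H; rewrite derive1E; exact: derive_val. Qed.

Lemma Ck1S k q q' : (forall t, is_derive t 1 q (q' t)) -> Ck1 k q' -> Ck1 k.+1 q.
Proof.
move=> dq cq'; split; first by move=> t; have H := dq t; exact: ex_derive.
suff -> : (derive1 q) = q' by [].
by apply/funext => t; exact: is_derive_derive1.
Qed.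

Lemma Ck1S_derive k q t : Ck1 k.+1 q -> is_derive t 1 q ((derive1 q) t).
Proof. by case=> dq _; rewrite derive1E; exact/derivableP/dq. Qed.

Lemma Ck1_cont k q : Ck1 k q -> continuous q.
Proof.
case: k => [//|k [dq _]] t.
by apply/differentiable_continuous/derivable1_diffP; exact: dq.
Qed.

Lemma Ck1W k q : Ck1 k.+1 q -> Ck1 k q.
Proof.
elim: k q => [|k IH] q cq; first exact: Ck1_cont cq.
by case: cq => dq /IH.
Qed.

Lemma Ck1_cst k c : Ck1 k (fun=> c).
Proof.
elim: k c => [|k IH] c; first by move=> t; exact: cvg_cst.
by apply: Ck1S (IH 0) => t; exact: is_derive_cst.
Qed.

Lemma Ck1_id k : Ck1 k (fun t => t).
Proof.
case: k => [|k]; first by move=> t.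
by apply: Ck1S (Ck1_cst k 1) => t; exact: is_derive_id.
Qed.

Lemma Ck1D k f g : Ck1 k f -> Ck1 k g -> Ck1 k (fun t => f t + g t).
Proof.
elim: k f g => [|k IH] f g cf cg; first by move=> t; apply: cvgD; [exact: cf|exact: cg].
apply: (@Ck1S _ _ (fun t => (derive1 f) t + (derive1 g) t)) => [t|].
  have ? := Ck1S_derive t cf; have ? := Ck1S_derive t cg.
  exact: (@is_deriveD _ _ _ f g).
by apply: IH; [case: cf|case: cg].
Qed.

Lemma Ck1M k f g : Ck1 k f -> Ck1 k g -> Ck1 k (fun t => f t * g t).
Proof.
elim: k f g => [|k IH] f g cf cg; first by move=> t; apply: cvgM; [exact: cf|exact: cg].
apply: (@Ck1S _ _ (fun t => f t * (derive1 g) t + g t * (derive1 f) t)) => [t|].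
  have ? := Ck1S_derive t cf; have ? := Ck1S_derive t cg.
  exact: (@is_deriveM _ _ f g).
by apply: Ck1D; apply: IH; do ?[exact: Ck1W]; [case: cg|case: cf].
Qed.

Lemma Ck1Z k c f : Ck1 k f -> Ck1 k (fun t => c * f t).
Proof. by move=> cf; exact: (Ck1M (Ck1_cst k c)). Qed.

Lemma Ck1B k f g : Ck1 k f -> Ck1 k g -> Ck1 k (fun t => f t - g t).
Proof.
move=> cf cg; rewrite (_ : (fun t => _) = fun t => f t + (-1) * g t).
  exact/Ck1D/Ck1Z.
by apply/funext => t; rewrite mulN1r.
Qed.

Lemma Ck1V k f : (forall t, f t != 0) -> Ck1 k f -> Ck1 k (fun t => (f t)^-1).
Proof.
move=> f0; elim: k f f0 => [|k IH] f f0 cf.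
  by move=> t; apply: cvgV; [exact: f0|exact: cf].
apply: (@Ck1S _ _ (fun t => (-1) * ((f t)^-1 * (f t)^-1 * (derive1 f) t))) => [t|].
  apply: is_derive_eq (is_deriveV (f0 t) (Ck1S_derive t cf)) _.
  by rewrite /GRing.scale/= -exprVn; ring.
by apply/Ck1Z/Ck1M; [apply: Ck1M; apply: IH => //; exact: Ck1W|case: cf].
Qed.

Lemma is_derive_aff a b t : is_derive t 1 (fun t => a * t + b) a.
Proof.
have := is_deriveD (is_deriveZ a (is_derive_id t (1 : R))) (is_derive_cst b t (1 : R)).
by rewrite /GRing.scale/= mulr1 addr0.
Qed.

Lemma Ck1_aff k a b f : Ck1 k f -> Ck1 k (fun t => f (a * t + b)).
Proof.
elim: k f => [|k IH] f cf.
  move=> t; apply: (@continuous_comp _ _ _ (fun t => a * t + b) f); last exact: cf.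
  by apply: cvgD; [apply: cvgM; [exact: cvg_cst|exact: cvg_id]|exact: cvg_cst].
apply: (@Ck1S _ _ (fun t => a * (derive1 f) (a * t + b))) => [t|].
  have H := Ck1S_derive (a * t + b) cf.
  have Ha := is_derive_aff a b t.
  apply: is_derive_eq (@is_derive1_comp _ f (fun t => a * t + b) _ _ _ H Ha) _.
  by rewrite mulrC.
by apply/Ck1Z/IH; case: cf.
Qed.

Lemma smooth_deriv q : smooth q -> smooth (derive1 q).
Proof. by move=> sq k; case: (sq k.+1). Qed.

Lemma smooth_is_derive q t : smooth q -> is_derive t 1 q ((derive1 q) t).
Proof. by move=> /(_ 1%N) /Ck1S_derive. Qed.

Lemma smooth_c1 q : smooth q -> c1 q (derive1 q).
Proof.
have uc p : smooth p -> ucont cI p.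
  move=> /(_ 0%N) cp; apply/(ucontP _ cI_compact).
  exact: continuous_subspaceT.
by move=> sq; split; [exact: uc|exact/uc/smooth_deriv|move=> t _; exact: smooth_is_derive].
Qed.

Lemma continuous_left q a c : continuous q -> (forall t, t < a -> q t = c) -> q a = c.
Proof.
move=> cq qc; apply/eqP; rewrite eq_sym -subr_eq0 -normr_le0; apply/ler_addgt0Pl => /= e e0.
rewrite addr0; have /cvgrPdist_lt/(_ _ e0) := cq a; move=> /nbhs_ballP[d /= d0 Hd].
have := Hd (a - d / 2); rewrite (qc (a - d / 2)); last by rewrite ltrBlDr ltrDl divr_gt0//.
rewrite distrC => H; apply/ltW/H; rewrite /ball/= opprB addrC subrK ger0_norm ?divr_ge0// ?ltW//.
by rewrite ltr_pdivrMr// ltr_pMr// ltr1n.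
Qed.

Lemma continuous_right q a c : continuous q -> (forall t, a < t -> q t = c) -> q a = c.
Proof.
move=> cq qc; have := @continuous_left (fun t => q (- t)) (- a) c.
rewrite opprK; apply => [t|t].
  apply: (@continuous_comp _ _ _ (fun t => - t) q); last exact: cq.
  exact: opp_continuous.
by rewrite ltrNr => /qc.
Qed.

Lemma derive_near_affine q a b t (d : R) : 0 < d ->
  (forall s, `|t - s| < d -> q s = a * s + b) -> (derive1 q) t = a.
Proof.
move=> d0 H; have -> : (derive1 q) t = derive1 (fun s => a * s + b) t.
  rewrite !derive1E; apply: near_eq_derive.
  by apply/nbhs_ballP; exists d.
by apply: (@is_derive_derive1 _ (fun=> a)); exact: is_derive_aff.
Qed.

Lemma deriv_le q a b c t : smooth q -> (forall s, s <= c -> q s = a * s + b) ->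
  t <= c -> (derive1 q) t = a.
Proof.
move=> sq H; have lt s : s < c -> (derive1 q) s = a.
  move=> sc; apply: (@derive_near_affine _ _ b _ (c - s)); first by rewrite subr_gt0.
  move=> u; rewrite distrC ltr_norml => /andP[_]; rewrite ltrD2r => /ltW; exact: H.
rewrite le_eqVlt => /predU1P[->|]; last exact: lt.
by apply: continuous_left lt; exact: (smooth_deriv sq 0%N).
Qed.

Lemma deriv_ge q a b c t : smooth q -> (forall s, c <= s -> q s = a * s + b) ->
  c <= t -> (derive1 q) t = a.
Proof.
move=> sq H; have lt s : c < s -> (derive1 q) s = a.
  move=> sc; apply: (@derive_near_affine _ _ b _ (s - c)); first by rewrite subr_gt0.
  move=> u; rewrite ltr_norml => /andP[_]; rewrite ltrD2l ltrN2 => /ltW; exact: H.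
rewrite le_eqVlt => /predU1P[<-|]; last exact: lt.
by apply: continuous_right lt; exact: (smooth_deriv sq 0%N).
Qed.

Lemma is_derive_eps q t (l : R) : is_derive t 1 q l <-> forall e : R, 0 < e ->
  exists2 d : R, 0 < d & forall h, h != 0 -> `|h| < d ->
    `|l - h^-1 * (q (t + h) - q t)| < e.
Proof.
have E : (fun h => h^-1 *: ((q \o shift t) (h *: (1 : R)) - q t)) =
    (fun h => h^-1 * (q (t + h) - q t)).
  by apply/funext => h; rewrite /GRing.scale/= mulr1 (addrC t).
split=> [H e e0|H].
  have := @ex_derive _ _ _ _ _ _ _ H; have := @derive_val _ _ _ _ _ _ _ H.
  rewrite /derive /derivable E => <- /cvgrPdist_lt/(_ _ e0).
  rewrite near_withinE => /nbhs_ballP[d /= d0 Hd]; exists d => // h h0 hd.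
  by apply: Hd => //=; rewrite /ball/= sub0r normrN.
have cv : h^-1 * (q (t + h) - q t) @[h --> 0^'] --> l.
  apply/cvgrPdist_lt => e /H[d d0 Hd]; rewrite near_withinE; apply/nbhs_ballP.
  by exists d => // h; rewrite /ball/= sub0r normrN => hd h0; exact: Hd.
apply: DeriveDef; rewrite /derive /derivable E; first by apply/cvg_ex; exists l.
exact: cvg_lim.
Qed.

(** ** A smooth step *)

(** The linear combinations of the functions t^-n exp(-1/t), extended by 0 to t <= 0, are
stable under differentiation; hence these functions are smooth. *)
Definition flat (n : nat) t : R := if 0 < t then t ^- n * expR (- t^-1) else 0.

(** The exponential beats every power; this quadratic bound yields the derivative 0 at 0. *)
Lemma flat_bound n t : 0 < t -> flat n t <= (n.+2%:R ^+ n.+2) * t ^+ 2.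
Proof.
move=> t0; rewrite /flat t0 expRN ler_pdivrMr ?expR_gt0//.
have y0 : 0 < t^-1 by rewrite invr_gt0.
suff H : t^-1 ^+ n.+2 <= n.+2%:R ^+ n.+2 * expR t^-1.
  have -> : t ^- n = t^-1 ^+ n.+2 * t ^+ 2.
    by rewrite -exprVn -addn2 exprD -mulrA -exprMn mulVf ?gt_eqF// expr1n mulr1.
  by rewrite [leRHS]mulrAC ler_wpM2r// exprn_ge0// ltW.
have -> : expR t^-1 = expR (t^-1 / n.+2%:R) ^+ n.+2.
  by rewrite -expRM_natl mulrC divfK.
rewrite -exprMn; apply: lerXn2r; rewrite ?nnegrE ?(ltW y0) ?mulr_ge0 ?expR_ge0//.
apply: (@le_trans _ _ ( n.+2%:R * (1 + t^-1 / n.+2%:R))); last first.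
  by rewrite ler_wpM2l// expR_ge1Dx.
by rewrite mulrDr mulr1 mulrCA divff// mulr1 lerDr.
Qed.

Lemma flat_ge0 n t : 0 <= flat n t.
Proof.
rewrite /flat; case: ifP => // t0.
by rewrite mulr_ge0 ?expR_ge0// invr_ge0 exprn_ge0// ltW.
Qed.

Lemma flat_derive n t : is_derive t 1 (flat n) (flat n.+2 t - n%:R * flat n.+1 t).
Proof.
have [t0|t0|->] := ltgtP t 0.
- rewrite /flat !(lt_gtF t0) mulr0 subr0.
  apply: (@near_eq_is_derive _ _ _ (fun=> 0)) => //.
    near=> s; suff s0 : s < 0 by rewrite (lt_gtF s0).
    by near: s; exact: lt_nbhsl.
- apply: (@near_eq_is_derive _ _ _ (fun s : R => s^-1 ^+ n * expR (- s^-1))).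
    near=> s; rewrite /flat (_ : 0 < s) ?exprVn//.
    by near: s; exact: lt_nbhsr.
  have t1 : t != 0 by rewrite gt_eqF.
  have iV : is_derive t 1 (fun s : R => s^-1) (- t ^- 2).
    by have := is_deriveV t1 (is_derive_id t (1 : R)); rewrite /GRing.scale/= mulr1.
  have iE : is_derive t 1 (expR \o (fun s : R => - s^-1)) (expR (- t^-1) * t ^- 2).
    apply: is_derive1_comp; rewrite -[X in is_derive _ _ _ X]opprK.
    exact: (@is_deriveN _ _ _ (fun s : R => s^-1)).
  have iX := @is_deriveX _ _ (fun s : R => s^-1) n _ _ _ iV.
  have := @is_deriveM _ _ _ _ _ _ _ _ iX iE.
  have -> : (fun s : R => s^-1) ^+ n * (expR \o (fun s : R => - s^-1)) =
      fun s : R => s^-1 ^+ n * expR (- s^-1).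
    by apply/funext => s; rewrite mulrfctE exprfctE.
  rewrite exprfctE /flat t0 /GRing.scale/= => H; apply: is_derive_eq H _.
  rewrite -!exprVn; case: n {iX} => [|n]; first by ring.
  by rewrite /= (exprS _ n.+2) (exprS _ n.+1) (exprS _ n); ring.
- rewrite /flat ltxx mulr0 subr0; apply/is_derive_eps => e e0.
  pose C : R := n.+2%:R ^+ n.+2.
  have C0 : 0 < C by rewrite exprn_gt0// ltr0n.
  exists (e / C); first by rewrite divr_gt0.
  move=> h h0 he; rewrite sub0r normrN add0r ltxx subr0.
  have [hp|hp|hE] := ltgtP h 0; last by rewrite hE eqxx in h0.
    by rewrite mulr0 normr0.
  have -> : h ^- n * expR (- h^-1) = flat n h by rewrite /flat hp.
  rewrite normrM [X in _ * X]ger0_norm ?flat_ge0// normfV.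
  rewrite gtr0_norm// in he *; rewrite mulrC ltr_pdivrMr//.
  have := flat_bound n hp; rewrite /flat hp => /le_lt_trans; apply.
  by rewrite -/C expr2 mulrA ltr_pM2r// mulrC -ltr_pdivlMr.
Unshelve. all: by end_near. Qed.

Lemma flat_Ck1 k n : Ck1 k (flat n).
Proof.
elim: k n => [|k IH] n; last first.
  by apply: (Ck1S (flat_derive n)); apply: Ck1B; [|apply: Ck1Z]; exact: IH.
move=> t; apply/differentiable_continuous/derivable1_diffP.
by have H := flat_derive n t; exact: ex_derive.
Qed.

Lemma flat_homo s t : s <= t -> flat 0 s <= flat 0 t.
Proof.
move=> st; have [s0|s0] := ltP 0 s; last first.
  by rewrite {1}/flat ltNge s0/= flat_ge0.
rewrite /flat s0 (lt_le_trans s0 st) !expr0 invr1 !mul1r ler_expR lerN2.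
by rewrite lef_pV2// posrE// (lt_le_trans s0 st).
Qed.

Lemma flat_gt0 t : 0 < t -> 0 < flat 0 t.
Proof. by move=> t0; rewrite /flat t0 expr0 invr1 mul1r expR_gt0. Qed.

Lemma flat_le0 n t : t <= 0 -> flat n t = 0.
Proof. by move=> t0; rewrite /flat ltNge t0. Qed.

Definition step t : R := flat 0 t / (flat 0 t + flat 0 (1 - t)).

Lemma step_den t : 0 < flat 0 t + flat 0 (1 - t).
Proof.
have [t0|t0] := ltP 0 t; first by rewrite ltr_pwDl ?flat_ge0 ?flat_gt0.
by rewrite ltr_wpDl ?flat_ge0 ?flat_gt0// subr_gt0 (le_lt_trans t0).
Qed.

Lemma step_smooth : smooth step.
Proof.
move=> k; apply: Ck1M; first exact: flat_Ck1.
apply: Ck1V => [t|]; first by rewrite gt_eqF// step_den.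
apply: Ck1D; first exact: flat_Ck1.
rewrite (_ : (fun t => _) = fun t => flat 0 (-1 * t + 1)).
  exact/Ck1_aff/flat_Ck1.
by apply/funext => t; rewrite mulN1r addrC.
Qed.

Lemma step_le0 t : t <= 0 -> step t = 0.
Proof. by move=> t0; rewrite /step flat_le0// mul0r. Qed.

Lemma step_ge1 t : 1 <= t -> step t = 1.
Proof.
move=> t1; rewrite /step (@flat_le0 _ (1 - t)) ?subr_le0// addr0 divff//.
by rewrite gt_eqF// flat_gt0// (lt_le_trans ltr01).
Qed.

Lemma step01 t : 0 <= step t <= 1.
Proof.
rewrite /step divr_ge0 ?flat_ge0 ?(ltW (step_den t))//=.
by rewrite ler_pdivrMr ?step_den// mul1r lerDl flat_ge0.
Qed.

Lemma step_homo s t : s <= t -> step s <= step t.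
Proof.
move=> st; rewrite /step ler_pdivrMr ?step_den// mulrAC ler_pdivlMr ?step_den//.
rewrite !mulrDr (mulrC (flat 0 t)) lerD2l.
by rewrite ler_pM ?flat_ge0// flat_homo// lerB.
Qed.

(** The function e * ramp (t / e) is a smooth approximation of the positive part of t, which
differs from it only on [0, e]. *)
Definition ramp t : R := t * step t.

Lemma ramp_smooth : smooth ramp.
Proof. by move=> k; apply: Ck1M; [exact: Ck1_id|exact: step_smooth]. Qed.

Lemma ramp_le0 t : t <= 0 -> ramp t = 0.
Proof. by move=> t0; rewrite /ramp step_le0// mulr0. Qed.

Lemma ramp_ge1 t : 1 <= t -> ramp t = t.
Proof. by move=> t0; rewrite /ramp step_ge1// mulr1. Qed.

Lemma dramp_le0 t : t <= 0 -> (derive1 ramp) t = 0.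
Proof.
apply: (@deriv_le _ 0 0); first exact: ramp_smooth.
by move=> s s0; rewrite ramp_le0// mul0r addr0.
Qed.

Lemma dramp_ge1 t : 1 <= t -> (derive1 ramp) t = 1.
Proof.
apply: (@deriv_ge _ 1 0); first exact: ramp_smooth.
by move=> s s0; rewrite ramp_ge1// mul1r addr0.
Qed.

Lemma ddramp_le0 t : t <= 0 -> (derive1 (derive1 ramp)) t = 0.
Proof.
apply: (@deriv_le _ 0 0); first exact: smooth_deriv ramp_smooth.
by move=> s s0; rewrite dramp_le0// mul0r addr0.
Qed.

Lemma ddramp_ge1 t : 1 <= t -> (derive1 (derive1 ramp)) t = 0.
Proof.
apply: (@deriv_ge _ 0 1); first exact: smooth_deriv ramp_smooth.
by move=> s s0; rewrite dramp_ge1// mul0r add0r.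
Qed.

Lemma ramp_bounds : exists2 K : R, 1 <= K &
  forall t, `|(derive1 ramp) t| <= K /\ `|(derive1 (derive1 ramp)) t| <= K.
Proof.
have s1 := smooth_deriv ramp_smooth; have [u1 u2 _] := smooth_c1 s1.
have [K K0 HK] := ucont_bounded cI_compact u1.
have [L L0 HL] := ucont_bounded cI_compact u2.
exists (1 + K + L); first by rewrite -addrA lerDl addr_ge0 ?ltW.
move=> t; have [t0|t0] := leP t 0.
  by rewrite dramp_le0// ddramp_le0// !normr0; split; lra.
have [t1|t1] := leP 1 t.
  by rewrite dramp_ge1// ddramp_ge1// normr0 normr1; split; lra.
have It : cI t by rewrite cIE !ltW.
by have := HK t It; have := HL t It; split; lra.
Qed.

End Smooth.

(** * Functionals acting on one coordinate of a function on the cube *)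

Section PartitionOfUnity.
Context {R : realType}.
Implicit Types (t : R) (N k : nat).

(** The differences of shifted steps telescope, which gives a smooth partition of unity on
[0, 1] whose k-th member lives near k / N. *)
Definition bump N k t : R := step (N%:R * t - k%:R + 1) - step (N%:R * t - k%:R).

Lemma bump_smooth N k : smooth (bump N k).
Proof.
move=> n; apply: Ck1B.
  rewrite (_ : (fun t => _) = fun t => step (N%:R * t + (1 - k%:R))).
    exact/Ck1_aff/step_smooth.
  by apply/funext => t; congr step; ring.
by have := Ck1_aff N%:R (- k%:R) (step_smooth n).
Qed.

Lemma bump_ge0 N k t : 0 <= bump N k t.
Proof. by rewrite subr_ge0; apply: step_homo; rewrite lerDl. Qed.

Lemma bump_sum N t : cI t -> \sum_(k < N.+1) bump N k t = 1.
Proof.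
rewrite cIE => /andP[t0 t1]; pose u (k : nat) := - step (N%:R * t - k%:R + 1).
have -> : \sum_(k < N.+1) bump N k t = \sum_(0 <= k < N.+1) (u k.+1 - u k).
  rewrite big_mkord; apply: eq_bigr => k _; rewrite /u opprK addrC; congr (_ - step _).
  by rewrite -natr1; ring.
rewrite telescope_sumr// /u subr0 opprK step_le0 ?step_ge1 ?oppr0 ?add0r//.
  by rewrite lerDr mulr_ge0.
rewrite -natr1 opprD addrA subrK subr_le0.
by rewrite -[leRHS]mulr1 ler_wpM2l.
Qed.

Lemma bump_supp N k t : (0 < N)%N -> bump N k t != 0 -> `|t - k%:R / N%:R| < N%:R^-1.
Proof.
move=> N0 b0; have N0' : 0 < N%:R :> R by rewrite ltr0n.
rewrite -(ltr_pM2l N0') divff ?gt_eqF// -[X in X * _]gtr0_norm// -normrM mulrBr mulrCA.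
rewrite divff ?gt_eqF// mulr1 ltNge; apply: contra b0.
rewrite ler_normr => /orP[h|h]; rewrite /bump.
  by rewrite !step_ge1 ?subrr// (le_trans h)// lerDl.
by rewrite !step_le0 ?subrr//; lra.
Qed.

End PartitionOfUnity.

Section BoundedFunctionals.
Context {R : realType}.
Implicit Types (g h : R -> R) (l : (R -> R) -> R) (t : R).

(** The constant C bounds the norm of l as a functional on C[0, 1]; on other functions l is
unconstrained. *)
Definition bfun (C : R) l := [/\ 0 <= C,
  forall a g h, ucont cI g -> ucont cI h -> l (fun t => a * g t + h t) = a * l g + l h &
  forall K g, ucont cI g -> bounded_by cI K g -> `|l g| <= C * K].

Variables (C : R) (l : (R -> R) -> R).
Hypothesis bl : bfun C l.

Lemma bfun0 : l (fun=> 0) = 0.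
Proof.
have [C0 _ H] := bl; apply/eqP; rewrite -normr_le0.
apply: le_trans (H 0 _ _ _) _; rewrite ?mulr0//; first exact: ucont_cst.
by move=> t _; rewrite normr0.
Qed.

Lemma bfunZ (a : R) g : ucont cI g -> l (fun t => a * g t) = a * l g.
Proof.
move=> ug; have [_ H _] := bl; have := H a g (fun=> 0) ug (@ucont_cst _ _ _ 0).
by rewrite bfun0 addr0 => <-; congr l; apply/funext => t; rewrite addr0.
Qed.

Lemma bfunB g h : ucont cI g -> ucont cI h -> l (fun t => g t - h t) = l g - l h.
Proof.
move=> ug uh; have [_ H _] := bl; have := H (-1) h g uh ug.
by rewrite mulN1r addrC => <-; congr l; apply/funext => t; rewrite mulN1r addrC.
Qed.

Lemma bfun_eq g h : ucont cI g -> ucont cI h -> (forall t, cI t -> g t = h t) -> l g = l h.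
Proof.
move=> ug uh gh; apply/eqP; rewrite -subr_eq0 -bfunB// -normr_le0.
have [C0 _ H] := bl; rewrite -(mulr0 C); apply: H; first exact: ucontB.
by move=> t /gh ->; rewrite subrr normr0.
Qed.

Lemma bfun_sum (n : nat) (c : 'I_n -> R) (g : 'I_n -> R -> R) :
  (forall k, ucont cI (g k)) ->
  l (fun t => \sum_(k < n) c k * g k t) = \sum_(k < n) c k * l (g k).
Proof.
elim: n c g => [|n IH] c g ug.
  rewrite big_ord0 (_ : (fun t => _) = fun=> 0) ?bfun0//.
  by apply/funext => t; rewrite big_ord0.
have [_ H _] := bl; rewrite big_ord_recl -IH// -H//; last first.
  by apply: ucont_sum => k _; exact: ucontZ.
by congr l; apply/funext => t; rewrite big_ord_recl.
Qed.

End BoundedFunctionals.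

Section Coordinates.
Context {R : realType} {m : nat}.
Implicit Types (x y : 'rV[R]_m) (f g : 'rV[R]_m -> R) (i j : 'I_m) (s : seq 'I_m).
Implicit Types (l : (R -> R) -> R) (t : R).

Lemma rv_ballP x (d : R) y : 0 < d -> (ball x d y <-> forall i, `|x 0 i - y 0 i| < d).
Proof.
move=> d0; split=> [[_ H] i|H]; first exact: H.
by split=> // a i; rewrite (ord1 a); exact: H.
Qed.

Lemma cube_compact : compact (@cube R m).
Proof.
have := @rV_compact R m (fun=> cI) (fun=> cI_compact).
by congr compact; apply/seteqP; split => x /= H i; have := H i; rewrite cIE.
Qed.

Lemma cubeP x : cube x <-> forall i, cI (x 0 i).
Proof. by split=> H i; have := H i; rewrite cIE. Qed.

Lemma cube_cI x i : cube x -> cI (x 0 i).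
Proof. by move/cubeP. Qed.

Lemma set_coordE i t x j : set_coord i t x 0 j = if j == i then t else x 0 j.
Proof. by rewrite mxE. Qed.

Lemma set_coord_cube i t x : cube x -> cI t -> cube (set_coord i t x).
Proof.
by move=> cx It j; rewrite set_coordE; case: eqP => _; [rewrite -cIE|exact: cx].
Qed.

Lemma set_coord_id i x : set_coord i (x 0 i) x = x.
Proof. by apply/rowP => j; rewrite set_coordE; case: eqP => [->|]. Qed.

Lemma set_coord_set i t u x : set_coord i t (set_coord i u x) = set_coord i t x.
Proof. by apply/rowP => j; rewrite !set_coordE; case: eqP. Qed.

Lemma set_coordC i j t u x : i != j ->
  set_coord i t (set_coord j u x) = set_coord j u (set_coord i t x).
Proof.
move=> ij; apply/rowP => k; rewrite !set_coordE.
by case: (eqVneq k i) => [->|//]; rewrite (negPf ij).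
Qed.

Lemma set_coord_ball i t u x y (d : R) : 0 < d -> ball x d y -> `|t - u| < d ->
  ball (set_coord i t x) d (set_coord i u y).
Proof.
move=> d0 /(rv_ballP _ _ d0) xy tu; apply/(rv_ballP _ _ d0) => j.
by rewrite !set_coordE; case: eqP => _ //; exact: xy.
Qed.

Lemma ucont_slice f i x : ucont cube f -> cube x ->
  ucont cI (fun t => f (set_coord i t x)).
Proof.
move=> uf cx e /uf[d d0 Hd]; exists d => // t u It Iu tu.
apply: Hd; do ?exact: set_coord_cube.
by apply: set_coord_ball => //; exact: ballxx.
Qed.

Lemma ucont_freeze f i t : ucont cube f -> cI t ->
  ucont cube (fun x => f (set_coord i t x)).
Proof.
move=> uf It e /uf[d d0 Hd]; exists d => // x y cx cy xy.
apply: Hd; do ?exact: set_coord_cube.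
by apply: set_coord_ball => //; rewrite subrr normr0.
Qed.

Lemma ucont_coord (g : R -> R) i : ucont cI g -> ucont cube (fun x => g (x 0 i)).
Proof.
move=> ug e /ug[d d0 Hd]; exists d => // x y /cubeP cx /cubeP cy /(rv_ballP _ _ d0) xy.
by apply: Hd => //; exact: xy.
Qed.

Definition opi i l f x : R := l (fun t => f (set_coord i t x)).

Section Operator.
Variables (C : R) (l : (R -> R) -> R) (i : 'I_m).
Hypothesis bl : bfun C l.

Lemma opi_bound K f : ucont cube f -> bounded_by cube K f ->
  bounded_by cube (C * K) (opi i l f).
Proof.
move=> uf fK x cx; have [_ _ H] := bl; apply: H; first exact: ucont_slice.
by move=> t It; exact/fK/set_coord_cube.
Qed.

Lemma opi_lin (a : R) f g x : ucont cube f -> ucont cube g -> cube x ->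
  opi i l (fun y => a * f y + g y) x = a * opi i l f x + opi i l g x.
Proof.
by move=> uf ug cx; have [_ H _] := bl; rewrite /opi H//; exact: ucont_slice.
Qed.

Lemma opi_eq f g : ucont cube f -> (forall x, cube x -> f x = g x) ->
  forall x, cube x -> opi i l f x = opi i l g x.
Proof.
move=> uf fg x cx; apply: (bfun_eq bl); first exact: ucont_slice.
  by apply: ucont_slice => //; exact: eq_ucont uf.
by move=> t It; exact/fg/set_coord_cube.
Qed.

Lemma opi_dist (e : R) f g : ucont cube f -> ucont cube g ->
  (forall x, cube x -> `|f x - g x| <= e) ->
  forall x, cube x -> `|opi i l f x - opi i l g x| <= C * e.
Proof.
move=> uf ug fg x cx; rewrite /opi -(bfunB bl); do ?exact: ucont_slice.
have [_ _ H] := bl; apply: H; first by apply: ucontB; exact: ucont_slice.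
by move=> t It; exact/fg/set_coord_cube.
Qed.

Lemma ucont_opi f : ucont cube f -> ucont cube (opi i l f).
Proof.
move=> uf e e0; have [C0 _ H] := bl.
have C1 : 0 < C + 1 by rewrite ltr_wpDl.
have [d d0 Hd] := uf _ (divr_gt0 e0 C1).
exists d => // x y cx cy xy; rewrite /opi -(bfunB bl); do ?exact: ucont_slice.
apply: le_lt_trans (H (e / (C + 1)) _ _ _) _.
- by apply: ucontB; exact: ucont_slice.
- move=> t It; apply/ltW/Hd; do ?exact: set_coord_cube.
  by apply: set_coord_ball => //; rewrite subrr normr0.
- by rewrite mulrCA gtr_pMr// ltr_pdivrMr// mul1r ltrDl.
Qed.

End Operator.

(** Interpolation in the variable x_i by the partition of unity; every term is the product of
a function of x_i and a function of the other variables. *)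
Definition separate N i f x : R :=
  \sum_(k < N.+1) bump N k (x 0 i) * f (set_coord i (k%:R / N%:R) x).

Lemma grid_cI (N : nat) (k : 'I_N.+1) : cI (k%:R / N%:R : R).
Proof.
rewrite cIE divr_ge0//=; case: N k => [|N] k; first by rewrite invr0 mulr0.
by rewrite ler_pdivrMr ?ltr0n// mul1r ler_nat -ltnS.
Qed.

Lemma ucont_bump (N k : nat) : ucont cI (bump N k : R -> R).
Proof. by have [] := smooth_c1 (@bump_smooth R N k). Qed.

Lemma ucont_separate N i f : ucont cube f -> ucont cube (separate N i f).
Proof.
move=> uf; apply: ucont_sum => k _; apply: ucontM cube_compact _ _.
  exact: ucont_coord (ucont_bump _ _).
exact/ucont_freeze/grid_cI.
Qed.

Lemma separate_approx i f (e : R) : ucont cube f -> 0 < e ->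
  exists N, forall x, cube x -> `|separate N i f x - f x| <= e.
Proof.
move=> uf e0; have [d d0 Hd] := uf _ e0.
have [N N0 HN] : exists2 N : nat, (0 < N)%N & N%:R^-1 < d.
  exists (Num.truncn d^-1).+1 => //.
  by rewrite invf_plt ?posrE// truncnS_gt// invr_ge0 ltW.
exists N => x cx; have /cubeP/(_ i) Ix := cx.
rewrite -[f x]mul1r -(bump_sum N Ix) mulr_suml -sumrB.
apply: le_trans (ler_norm_sum _ _ _) _.
have -> : e = \sum_(k < N.+1) bump N k (x 0 i) * e by rewrite -mulr_suml bump_sum// mul1r.
apply: ler_sum => k _; rewrite -mulrBr normrM ger0_norm ?bump_ge0//.
have [->|bk] := eqVneq (bump N k (x 0 i)) 0; first by rewrite !mul0r.
rewrite ler_wpM2l ?bump_ge0//; apply/ltW/Hd => //.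
  exact/set_coord_cube/grid_cI.
rewrite -[X in ball _ _ X](set_coord_id i x); apply: set_coord_ball => //.
  exact: ballxx.
by rewrite distrC (lt_trans (bump_supp N0 bk)).
Qed.

Lemma opi_separate C l N i f x : bfun C l ->
  opi i l (separate N i f) x = \sum_(k < N.+1) f (set_coord i (k%:R / N%:R) x) * l (bump N k).
Proof.
move=> bl; rewrite -(bfun_sum bl); last by move=> k; exact: ucont_bump.
congr l; apply/funext => t; apply: eq_bigr => k _.
by rewrite set_coordE eqxx set_coord_set mulrC.
Qed.

(** Functionals acting on different coordinates commute: this is clear for functions with
separated dependence on x_i, and these are dense. In particular the order of iterated
integrals is irrelevant. *)
Lemma opiC C C' l l' i j f x : bfun C l -> bfun C' l' -> i != j -> ucont cube f ->
  cube x -> opi i l (opi j l' f) x = opi j l' (opi i l f) x.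
Proof.
move=> bl bl' ij uf cx; have [C0 _ _] := bl; have [C'0 _ _] := bl'.
apply/eqP; rewrite -subr_eq0 -normr_le0; apply/ler_addgt0Pl => /= e e0; rewrite addr0.
pose K := 2 * (C * C') + 1; have K0 : 0 < K by rewrite ltr_wpDl// !mulr_ge0.
have eK : 0 < e / K by rewrite divr_gt0.
have [N HN] := separate_approx i uf eK.
set g := separate N i f in HN; have ug : ucont cube g by exact: ucont_separate.
have sep : opi i l (opi j l' g) x = opi j l' (opi i l g) x.
  transitivity (opi i l (separate N i (opi j l' f)) x).
    apply: (opi_eq _ bl) cx; first exact: (ucont_opi j bl' ug).
    move=> y cy; rewrite /opi /separate.
    rewrite -[RHS](bfun_sum bl'); last first.
      by move=> k; apply: ucont_slice => //; exact/set_coord_cube/grid_cI.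
    congr l'; apply/funext => t; apply: eq_bigr => k _.
    by rewrite set_coordE (negPf ij) set_coordC.
  rewrite (opi_separate _ _ _ _ bl); under eq_bigr do rewrite mulrC.
  rewrite -(bfun_sum bl'); last first.
    by move=> k; apply: ucont_slice => //; exact/set_coord_cube/grid_cI.
  congr l'; apply/funext => t; rewrite (opi_separate _ _ _ _ bl).
  by apply: eq_bigr => k _; rewrite mulrC (set_coordC _ _ _ ij).
have D1 := opi_dist i bl (ucont_opi j bl' ug) (ucont_opi j bl' uf)
  (opi_dist j bl' ug uf HN) cx.
have D2 := opi_dist j bl' (ucont_opi i bl ug) (ucont_opi i bl uf)
  (opi_dist i bl ug uf HN) cx.
rewrite -[_ - _](subrKA (opi i l (opi j l' g) x)) {2}sep.
rewrite (le_trans (ler_normD _ _))// distrC (le_trans (lerD D1 D2))//.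
rewrite -[leRHS](@divfK _ K) ?gt_eqF//; set q := e / K in eK *.
by rewrite /K; nra.
Qed.

End Coordinates.

(** * Tensor products of functionals *)

Section BasicFunctionals.
Context {R : realType}.
Implicit Types (g h c : R -> R) (l : (R -> R) -> R) (t a b C : R).

Definition dlt a g : R := g a.

Definition wint c g : R := itg 0 1 (fun t => c t * g t).

Lemma bfunW C C' l : C <= C' -> bfun C l -> bfun C' l.
Proof.
move=> CC' [C0 lin H]; split=> // [|K g ug gK]; first exact: le_trans C0 CC'.
apply: le_trans (H K g ug gK) _; apply: ler_wpM2r CC'.
by apply: le_trans (gK 0 cI0).
Qed.

Lemma bfun_dlt a : cI a -> bfun 1 (dlt a).
Proof. by move=> Ia; split=> // K g _ gK; rewrite mul1r; exact: gK. Qed.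

Lemma bfun_itg a b : 0 <= a -> a <= b -> b <= 1 -> bfun 1 (itg a b).
Proof.
move=> a0 ab b1; split=> // [c g h ug uh|K g ug gK]; first exact: itg_lin.
have K0 : 0 <= K by apply: le_trans (gK 0 cI0).
apply: le_trans (itg_bound (K := K) a0 ab b1 ug _) _; last by rewrite mul1r ler_piMr//; lra.
by move=> t /andP[at_ tb]; apply: gK; rewrite cIE; apply/andP; split; lra.
Qed.

Lemma bfun_wint K c : 0 <= K -> ucont cI c -> bounded_by cI K c -> bfun K (wint c).
Proof.
move=> K0 uc cK; split=> // [b g h ug uh|L g ug gL].
  rewrite /wint -itg_lin//; do ?exact: ucontM cI_compact _ _.
  by apply: eq_itg => t _; ring.
have [_ _ H] := bfun_itg (lexx 0) ler01 (lexx 1); rewrite /wint -[leRHS]mul1r.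
apply: H; first exact: ucontM cI_compact _ _.
by move=> t It; rewrite normrM ler_pM ?cK ?gL.
Qed.

Lemma bfunZl C l b : bfun C l -> bfun (`|b| * C) (fun g => b * l g).
Proof.
move=> [C0 lin H]; split=> [|a g h ug uh|K g ug gK]; first exact: mulr_ge0.
  by rewrite lin//; ring.
by rewrite normrM -mulrA ler_wpM2l// H.
Qed.

Lemma bfunDl C C' l l' : bfun C l -> bfun C' l' -> bfun (C + C') (fun g => l g + l' g).
Proof.
move=> [C0 lin H] [C'0 lin' H']; split=> [|a g h ug uh|K g ug gK]; first exact: addr_ge0.
  by rewrite lin// lin'//; ring.
by rewrite mulrDl (le_trans (ler_normD _ _))// lerD ?H ?H'.
Qed.

End BasicFunctionals.

Section Tensor.
Context {R : realType} {m : nat}.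
Implicit Types (x y : 'rV[R]_m) (f g : 'rV[R]_m -> R) (i j : 'I_m) (s : seq 'I_m).
Implicit Types (L : 'I_m -> (R -> R) -> R) (t : R) (C : R).

(** Iterated integrals, restrictions to faces of the cube, evaluations at a point and mixtures
of these are all tensor products of functionals of one variable. *)
Definition tensor L s f := foldr (fun i g => opi i (L i) g) f s.

Section Basics.
Variables (C : R) (L : 'I_m -> (R -> R) -> R).
Hypothesis bL : forall i, bfun C (L i).

Lemma ucont_tensor s f : ucont cube f -> ucont cube (tensor L s f).
Proof. by move=> uf; elim: s => //= i s IH; exact: (ucont_opi i (bL i) IH). Qed.

Lemma tensor_bound s K f : ucont cube f -> bounded_by cube K f ->
  bounded_by cube (C ^+ size s * K) (tensor L s f).
Proof.
move=> uf fK; elim: s => [|i s IH] /=; first by rewrite mul1r.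
rewrite exprS -mulrA; apply: (opi_bound i (bL i)) IH; exact: ucont_tensor.
Qed.

Lemma tensor_lin s (a : R) f g x : ucont cube f -> ucont cube g -> cube x ->
  tensor L s (fun y => a * f y + g y) x = a * tensor L s f x + tensor L s g x.
Proof.
move=> uf ug; elim: s x => [//|i s IH] x cx /=.
rewrite -(opi_lin i (bL i))//; try exact: ucont_tensor.
apply: (opi_eq i (bL i)) cx => //; apply: ucont_tensor.
by apply: ucontD => //; exact: ucontZ.
Qed.

Lemma tensor_eq s f g : ucont cube f -> (forall x, cube x -> f x = g x) ->
  forall x, cube x -> tensor L s f x = tensor L s g x.
Proof.
move=> uf fg; elim: s => [//|i s IH] x cx /=.
by apply: (opi_eq i (bL i)) cx => //; exact: ucont_tensor.
Qed.

Lemma tensorZ s (a : R) f x : ucont cube f -> cube x ->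
  tensor L s (fun y => a * f y) x = a * tensor L s f x.
Proof.
move=> uf; elim: s x => [//|i s IH] x cx /=.
rewrite -[RHS](bfunZ (bL i)); last exact: ucont_slice (ucont_tensor _ uf) cx.
have uaf := ucont_tensor s (ucontZ a uf); have uTf := ucont_tensor s uf.
apply: (bfun_eq (bL i)); [exact: ucont_slice|exact/ucontZ/ucont_slice|].
by move=> t It; apply: IH; exact: set_coord_cube.
Qed.

Lemma tensorB s f g x : ucont cube f -> ucont cube g -> cube x ->
  tensor L s (fun y => f y - g y) x = tensor L s f x - tensor L s g x.
Proof.
move=> uf ug cx; rewrite addrC -mulN1r -tensor_lin//.
apply: tensor_eq => // [|y _]; first exact: ucontB.
by rewrite mulN1r addrC.
Qed.

Lemma tensor0 s : tensor L s (fun=> 0) = fun=> 0.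
Proof.
elim: s => //= i s ->; apply/funext => x; exact: (bfun0 (bL i)).
Qed.

Lemma tensor_sum s (I : Type) (r : seq I) (P : pred I) (F : I -> 'rV[R]_m -> R) x :
  (forall k, ucont cube (F k)) -> cube x ->
  tensor L s (fun y => \sum_(k <- r | P k) F k y) x = \sum_(k <- r | P k) tensor L s (F k) x.
Proof.
move=> uF cx; elim: r => [|k r IH].
  rewrite big_nil (_ : (fun y => _) = fun=> 0) ?tensor0//.
  by apply/funext => y; rewrite big_nil.
rewrite big_cons; case: ifPn => Pi.
  rewrite -IH -[tensor L s (F k) x]mul1r -tensor_lin//; last exact: ucont_sum.
  by congr (tensor _ _ _ x); apply/funext => y; rewrite big_cons Pi mul1r.
by rewrite -IH; congr (tensor _ _ _ x); apply/funext => y; rewrite big_cons (negPf Pi).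
Qed.

Lemma opi_tensor C' l i s f x : bfun C' l -> i \notin s -> ucont cube f -> cube x ->
  opi i l (tensor L s f) x = tensor L s (opi i l f) x.
Proof.
move=> bl; elim: s x => [//|j s IH] x; rewrite inE negb_or => /andP[ij is_] uf cx /=.
rewrite (opiC bl (bL j) ij)//; last exact: ucont_tensor.
apply: (opi_eq j (bL j)) cx => [|y cy]; last exact: IH.
exact: (ucont_opi i bl (ucont_tensor _ uf)).
Qed.

Lemma tensor_cat s s' f : tensor L (s ++ s') f = tensor L s (tensor L s' f).
Proof. exact: foldr_cat. Qed.

Lemma tensor_perm s s' f x : uniq s -> perm_eq s s' -> ucont cube f -> cube x ->
  tensor L s f x = tensor L s' f x.
Proof.
move=> + + uf; elim: s s' x => [|i s IH] s' x.
  by move=> _; rewrite perm_sym => /perm_nilP ->.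
move=> /= /andP[is_ us] ps cx.
have is' : i \in s' by rewrite -(perm_mem ps) mem_head.
case/splitPr: is' ps => a b; rewrite perm_sym -[_ :: b]cat1s perm_catCA/= perm_cons perm_sym => ps.
rewrite tensor_cat/=.
have ia : i \notin a.
  by apply: contra is_ => ia; rewrite (perm_mem ps) mem_cat ia.
rewrite -(opi_tensor (bL i) ia)//; last exact: ucont_tensor.
apply: (opi_eq i (bL i)) cx => [|y cy]; first exact: ucont_tensor.
by rewrite -tensor_cat; exact: IH.
Qed.

End Basics.

Definition indep i f := forall x t, cube x -> cI t -> f (set_coord i t x) = f x.

Lemma indep_eq s f x y : (forall i, i \in s -> indep i f) -> cube x -> cube y ->
  (forall i, i \notin s -> x 0 i = y 0 i) -> f x = f y.
Proof.
elim: s x => [|i s IH] x fs cx cy xy.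
  by congr f; apply/rowP => i; exact: xy.
have Iy : cI (y 0 i) by exact: cube_cI.
rewrite -(fs i (mem_head _ _) x (y 0 i) cx Iy); apply: IH => //.
- by move=> j js; apply: fs; rewrite inE js orbT.
- exact: set_coord_cube.
- move=> j js; rewrite set_coordE; case: eqP => [->//|/eqP ji].
  by apply: xy; rewrite inE negb_or ji.
Qed.

Lemma indep_opi C l i j f : bfun C l -> ucont cube f -> indep i f -> indep i (opi j l f).
Proof.
move=> bl uf fi x t cx It; have [->|ij] := eqVneq i j.
  by congr l; apply/funext => u; rewrite set_coord_set.
apply: (bfun_eq bl); do ?[exact: ucont_slice|exact/ucont_slice/set_coord_cube].
by move=> u Iu; rewrite -set_coordC// fi//; exact: set_coord_cube.
Qed.

Lemma indep_opi_self i l f : indep i (opi i l f).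
Proof. by move=> x t _ _; congr l; apply/funext => u; rewrite set_coord_set. Qed.

Lemma indep_tensor C L s i f : (forall i, bfun C (L i)) -> ucont cube f ->
  (i \in s) \/ indep i f -> indep i (tensor L s f).
Proof.
move=> bL uf; elim: s => [|j s IH] /=; first by case.
rewrite inE => H; have [ij|ij] := eqVneq i j.
  by rewrite -ij; exact: indep_opi_self.
apply: indep_opi (bL j) (ucont_tensor bL _ uf) _.
by apply: IH; move: H; rewrite (negPf ij).
Qed.

Lemma tensor_pull C L s (c : 'rV[R]_m -> R) f x : (forall i, bfun C (L i)) ->
  (forall i, i \in s -> indep i c) -> ucont cube c -> ucont cube f -> cube x ->
  tensor L s (fun y => c y * f y) x = c x * tensor L s f x.
Proof.
move=> bL + uc uf; elim: s x => [//|i s IH] x cs cx /=.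
have uT := ucont_tensor bL s uf.
rewrite /opi -(bfunZ (bL i)); last exact: ucont_slice.
have uTc : ucont cube (tensor L s (fun y => c y * f y)).
  by apply: (ucont_tensor bL); exact: ucontM cube_compact _ _.
apply: (bfun_eq (bL i)); [exact: ucont_slice|by apply: ucontZ; exact: ucont_slice|].
move=> t It; rewrite IH ?cs ?mem_head//; last exact: set_coord_cube.
by move=> j js; apply: cs; rewrite inE js orbT.
Qed.

Lemma indep_coord i j (c : R -> R) : i != j -> indep i (fun x : 'rV[R]_m => c (x 0 j)).
Proof. by move=> ij x t _ _; rewrite set_coordE eq_sym (negPf ij). Qed.

Lemma indep_prod i s (c : 'I_m -> R -> R) : i \notin s ->
  indep i (fun x => \prod_(j <- s) c j (x 0 j)).
Proof.
move=> is_ x t cx It; apply: eq_big_seq => j js; rewrite indep_coord//.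
by apply: contraNneq is_ => ->.
Qed.

Lemma ucont_coord_prod s (c : 'I_m -> R -> R) : (forall j, ucont cI (c j)) ->
  ucont cube (fun x : 'rV[R]_m => \prod_(j <- s) c j (x 0 j)).
Proof. by move=> uc; apply: ucont_prod cube_compact _ => j _; exact: ucont_coord. Qed.

Lemma tensor_weight C L s (c : 'I_m -> R -> R) f x : (forall i, bfun C (L i)) ->
  (forall j, ucont cI (c j)) -> uniq s -> ucont cube f -> cube x ->
  tensor L s (fun y => f y * \prod_(j <- s) c j (y 0 j)) x =
  tensor (fun j (g : R -> R) => L j (fun t => c j t * g t)) s f x.
Proof.
move=> bL uc + uf; elim: s x => [|i s IH] x; first by rewrite /= big_nil mulr1.
rewrite [uniq _]/= => /andP[is_ us] cx /=.
have uci := ucont_coord i (uc i).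
have ups := ucont_coord_prod s uc.
have ufp : ucont cube (fun y => f y * \prod_(j <- s) c j (y 0 j)).
  exact: ucontM cube_compact _ _.
transitivity (opi i (L i) (fun y => c i (y 0 i) *
    tensor (fun j (g : R -> R) => L j (fun t => c j t * g t)) s f y) x); last first.
  by congr (L i); apply/funext => t; rewrite set_coordE eqxx.
apply: (opi_eq i (bL i)) cx => [|y cy].
  apply: (ucont_tensor bL); apply: ucontM cube_compact uf _.
  exact: ucont_coord_prod.
rewrite -IH// -(tensor_pull bL _ uci ufp cy).
  congr (tensor _ _ _ y); apply/funext => z; rewrite big_cons; ring.
by move=> j js; apply: indep_coord; apply: contraNneq is_ => <-.
Qed.

(** This is how the boundary terms of an integration by parts are dropped: when f vanishes on
the hyperplanes x_i = t for t in E, a factor only acts on functions that vanish on E. *)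
Lemma tensor_congr C C' (E : set R) L L' s f :
  (forall i, bfun C (L i)) -> (forall i, bfun C' (L' i)) -> ucont cube f ->
  (forall i x, i \in s -> cube x -> E (x 0 i) -> f x = 0) ->
  (forall i (g : R -> R), i \in s -> ucont cI g -> (forall t, cI t -> E t -> g t = 0) -> L i g = L' i g) ->
  uniq s -> forall x, cube x -> tensor L s f x = tensor L' s f x.
Proof.
move=> bL bL' uf; elim: s => [//|i s IH] f0 LL' /= /andP[is_ us] x cx.
have van y : cube y -> E (y 0 i) -> tensor L s f y = 0.
  move=> cy Ey; have [Ci [Ci0 _ _]] := (bL i, bL i).
  have : opi i (dlt (y 0 i)) (tensor L s f) y = 0.
    have Iy : cI (y 0 i) by exact: cube_cI.
    rewrite (opi_tensor bL (bfun_dlt Iy) is_ uf cy).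
    rewrite (@tensor_eq _ _ bL s _ (fun=> 0))//.
    - by rewrite (tensor0 bL).
    - exact: (ucont_opi i (bfun_dlt Iy) uf).
    - move=> z cz; apply: (f0 i); rewrite ?mem_head ?set_coordE ?eqxx//.
      exact: set_coord_cube.
  by rewrite /opi /dlt set_coord_id.
transitivity (opi i (L' i) (tensor L s f) x).
  apply: LL'; rewrite ?mem_head//; first exact: ucont_slice (ucont_tensor bL _ uf) cx.
  move=> t It Et; apply: van; first exact: set_coord_cube.
  by rewrite set_coordE eqxx.
apply: (opi_eq i (bL' i)) cx => [|y cy]; first exact: (ucont_tensor bL s uf).
by apply: IH => // [j z js|j g js]; [apply: f0|apply: LL']; rewrite inE js orbT.
Qed.

(** The factors are replaced one at a time, each replacement being amplified by at most the
norms of the other factors. *)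
Lemma tensor_dist C (e : R) L L' s f K : 1 <= C -> 0 <= e ->
  (forall i, bfun C (L i)) -> (forall i, bfun C (L' i)) ->
  (forall i K (g : R -> R), ucont cI g -> bounded_by cI K g -> `|L i g - L' i g| <= e * K) ->
  ucont cube f -> bounded_by cube K f -> forall x, cube x ->
  `|tensor L s f x - tensor L' s f x| <= (size s)%:R * e * C ^+ size s * K.
Proof.
move=> C1 e0 bL bL' LL' uf fK; have C0 : 0 <= C by apply: le_trans C1.
elim: s => [|i s IH] x cx /=; first by rewrite subrr normr0 !mul0r.
have K0 : 0 <= K by apply: le_trans (fK x cx).
rewrite -(subrKA (opi i (L' i) (tensor L s f) x)).
apply: le_trans (ler_normD _ _) _.
have D1 : `|opi i (L i) (tensor L s f) x - opi i (L' i) (tensor L s f) x| <=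
    e * (C ^+ size s * K).
  apply: LL'; first exact: ucont_slice (ucont_tensor bL _ uf) cx.
  move=> t It; apply: (tensor_bound bL s uf fK).
  exact: set_coord_cube.
have D2 := opi_dist i (bL' i) (ucont_tensor bL _ uf) (ucont_tensor bL' _ uf) IH cx.
apply: le_trans (lerD D1 D2) _.
have -> : C * ((size s)%:R * e * C ^+ size s * K) = (size s)%:R * e * C ^+ (size s).+1 * K.
  by rewrite exprS; ring.
rewrite -[(size s).+1%:R]natr1 !mulrDl mul1r addrC lerD2l.
rewrite -mulrA ler_wpM2l// ler_wpM2r// exprS.
by rewrite ler_peMl// exprn_ge0.
Qed.

Definition set_coords s (a : 'I_m -> R) x : 'rV[R]_m :=
  \row_j (if j \in s then a j else x 0 j).

Lemma set_coords_cube s (a : 'I_m -> R) x : cube x -> (forall i, cI (a i)) ->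
  cube (set_coords s a x).
Proof.
by move=> cx ca; apply/cubeP => i; rewrite mxE; case: ifP => // _; exact: cube_cI.
Qed.

Lemma tensor_eval s (c a : 'I_m -> R) f x : uniq s ->
  tensor (fun i (g : R -> R) => c i * g (a i)) s f x = \prod_(i <- s) c i * f (set_coords s a x).
Proof.
elim: s x => [|i s IH] x.
  move=> _; rewrite big_nil mul1r; congr f.
  by apply/rowP => j; rewrite mxE.
move=> /= /andP[is_ us]; rewrite /opi IH// big_cons mulrA; congr (_ * f _).
apply/rowP => j; rewrite !mxE inE; case: (eqVneq j i) => [->|//].
by rewrite (negPf is_).
Qed.

End Tensor.

(** * Partial derivatives on boxes *)

Section Partial.
Context {R : realType} {m : nat}.
Implicit Types (x y : 'rV[R]_m) (f g : 'rV[R]_m -> R) (i j : 'I_m) (s : seq 'I_m).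
Implicit Types (D O : set 'rV[R]_m) (t e d h l a : R) (q : 'I_m -> R -> R).

Lemma shift_coord i x h : x + h *: delta_mx 0 i = set_coord i (x 0 i + h) x.
Proof.
apply/rowP => j; rewrite !mxE eqxx /=; case: (eqVneq j i) => [->|_].
  by rewrite mulr1.
by rewrite mulr0 addr0.
Qed.

(** Thickness makes the filter of admissible increments proper, so that the limits of
difference quotients are unique. *)
Definition thick D := forall x i d, D x -> 0 < d ->
  exists h, [/\ h != 0, `|h| < d & D (x + h *: delta_mx 0 i)].

Lemma thick_itv (t d : R) (lo : R) : lo < 1 -> lo <= t <= 1 -> 0 < d ->
  exists h, [/\ h != 0, `|h| < d & lo <= t + h <= 1].
Proof.
move=> lo1 /andP[lt t1] d0; have [tm|tm] := leP t ((lo + 1) / 2).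
  exists (Num.min (d / 2) ((1 - lo) / 4)).
  have h0 : 0 < Num.min (d / 2) ((1 - lo) / 4) by rewrite lt_min; apply/andP; split; lra.
  rewrite gt_eqF// gtr0_norm// gt_min; split=> //; first by apply/orP; left; lra.
  have : Num.min (d / 2) ((1 - lo) / 4) <= (1 - lo) / 4 by rewrite ge_min lexx orbT.
  by move=> ?; apply/andP; split; lra.
exists (- Num.min (d / 2) ((1 - lo) / 4)).
have h0 : 0 < Num.min (d / 2) ((1 - lo) / 4) by rewrite lt_min; apply/andP; split; lra.
rewrite oppr_eq0 gt_eqF// normrN gtr0_norm// gt_min; split=> //; first by apply/orP; left; lra.
have : Num.min (d / 2) ((1 - lo) / 4) <= (1 - lo) / 4 by rewrite ge_min lexx orbT.
by move=> ?; apply/andP; split; lra.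
Qed.

Lemma thick_cube : thick (@cube R m).
Proof.
move=> x i d cx d0; have [h [h0 hd hI]] := thick_itv ltr01 (cx i) d0.
by exists h; split=> //; rewrite shift_coord; apply: set_coord_cube => //; rewrite cIE.
Qed.

Lemma thick_near_face (V : {set 'I_m}) e : 0 < e -> thick (near_face V e : set 'rV[R]_m).
Proof.
move=> e0 x i d [cx xV] d0.
have [lo [lo0 lo1 lox ll]] : exists lo : R,
    [/\ 0 <= lo, lo < 1, lo <= x 0 i <= 1 & i \in V -> 1 - e <= lo].
  case iV : (i \in V); last by exists 0; rewrite ltr01; split=> //; exact: cx.
  exists (Num.max 0 (1 - e)); rewrite le_max lexx/= gt_max ltr01/= ge_max xV//.
  by have /andP[-> ->] := cx i; split; rewrite // ?le_max ?lexx ?orbT//; lra.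
have [h [h0 hd /andP[hI hI']]] := thick_itv lo1 lox d0.
exists h; split=> //; rewrite shift_coord; split.
  by apply: set_coord_cube => //; rewrite cIE hI' (le_trans lo0).
move=> j jV; rewrite set_coordE; case: eqP => [ji|_]; last exact: xV.
by apply: le_trans hI; apply: ll; rewrite -ji.
Qed.

Definition pdcvg D i f x l := forall e, 0 < e -> exists2 d, 0 < d &
  forall h, h != 0 -> `|h| < d -> D (x + h *: delta_mx 0 i) ->
    `|l - h^-1 * (f (x + h *: delta_mx 0 i) - f x)| < e.

Lemma pdcvgP D i f x l : pd_quotient D i f x --> l <-> pdcvg D i f x l.
Proof.
split=> [/cvgrPdist_lt H e /H|H].
  rewrite near_withinE near_withinE => /nbhs_ballP[d /= d0 Hd]; exists d => // h h0 hd Dh.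
  by apply: Hd => //; rewrite /ball/= sub0r normrN.
apply/cvgrPdist_lt => e /H[d d0 Hd].
rewrite near_withinE near_withinE; apply/nbhs_ballP; exists d => // h.
by rewrite /ball/= sub0r normrN => hd h0 Dh; exact: Hd.
Qed.

Lemma pderivable_pdcvg D i f x : pderivable D i f x -> pdcvg D i f x (pd D i f x).
Proof. by move=> H; exact/pdcvgP. Qed.

Lemma pdcvg_pd D i f x l : thick D -> D x -> pdcvg D i f x l ->
  pderivable D i f x /\ pd D i f x = l.
Proof.
move=> tD Dx /pdcvgP H.
have P : ProperFilter (within [set h | D (x + h *: delta_mx 0 i)] (0 : R)^').
  apply: Build_ProperFilter_ex => A HA.
  have {HA} : nbhs (0 : R) (fun h => h != 0 -> D (x + h *: delta_mx 0 i) -> A h) := HA.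
  move=> /nbhs_ballP[d /= d0 Hd].
  have [h [h0 hd Dh]] := tD x i d Dx d0; exists h; apply: Hd => //.
  by rewrite /ball/= sub0r normrN.
split; first by apply/cvg_ex; exists l.
by rewrite /pd /pd_quotient; exact: cvg_lim.
Qed.

Lemma pd_quotient_local D O i f g x : D x -> O x ->
  (exists2 d : R, 0 < d & forall h, `|h| < d -> D (x + h *: delta_mx 0 i) ->
    O (x + h *: delta_mx 0 i)) ->
  (forall y, D y -> O y -> f y = g y) -> pd_quotient D i f x = pd_quotient D i g x.
Proof.
move=> Dx Ox [d d0 Hd] fg.
have E f' g' : (forall y, D y -> O y -> f' y = g' y) ->
    pd_quotient D i f' x `<=` pd_quotient D i g' x.
  move=> fg' A HA.
  have {HA} : nbhs (0 : R) (fun h => h != 0 -> D (x + h *: delta_mx 0 i) ->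
    A (h^-1 * (f' (x + h *: delta_mx 0 i) - f' x))) := HA.
  move=> /nbhs_ballP[r /= r0 Hr].
  change (nbhs (0 : R) (fun h => h != 0 -> D (x + h *: delta_mx 0 i) ->
    A (h^-1 * (g' (x + h *: delta_mx 0 i) - g' x)))).
  apply/nbhs_ballP; exists (Num.min d r) => /=; first by rewrite lt_min d0.
  move=> h; rewrite /ball/= sub0r normrN lt_min => /andP[hd hr] h0 Dh.
  have := Hr h; rewrite /ball/= sub0r normrN => /(_ hr h0 Dh).
  by rewrite !fg'//; exact: Hd.
by apply/seteqP; split; apply: E => // y Dy Oy; rewrite fg.
Qed.

Lemma pd_ext D i f g x : D x -> (forall y, D y -> f y = g y) ->
  pd D i f x = pd D i g x.
Proof.
move=> Dx fg; rewrite /pd (@pd_quotient_local D setT i f g)//.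
- by exists 1.
- by move=> y Dy _; exact: fg.
Qed.

Lemma pderivable_ext D i f g x : D x -> (forall y, D y -> f y = g y) ->
  pderivable D i f x -> pderivable D i g x.
Proof.
move=> Dx fg; rewrite /pderivable (@pd_quotient_local D setT i f g)//.
- by exists 1.
- by move=> y Dy _; exact: fg.
Qed.

Definition pdl D s f := foldr (pd D) f s.

Lemma pdl_ext D s f g x : D x -> (forall y, D y -> f y = g y) ->
  pdl D s f x = pdl D s g x.
Proof. by move=> + fg; elim: s x => [|i s IH] x Dx /=; [exact: fg|exact: pd_ext]. Qed.

Lemma Ck_ext D k f g : (forall y, D y -> f y = g y) -> Ck D k f -> Ck D k g.
Proof.
elim: k f g => [|k IH] f g fg [cf Hf]; split.
- by apply: subspace_eq_continuous cf => y; rewrite inE; exact: fg.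
- by [].
- by apply: subspace_eq_continuous cf => y; rewrite inE; exact: fg.
- move=> i; have [df cdf] := Hf i; split.
    by move=> x Dx; apply: pderivable_ext Dx fg (df x Dx).
  by apply: IH cdf => y Dy; exact: pd_ext.
Qed.

Lemma CkW D k f : Ck D k.+1 f -> Ck D k f.
Proof.
elim: k f => [|k IH] f [cf Hf]; first by split.
by split=> // i; have [df cdf] := Hf i; split=> //; exact: IH.
Qed.

Lemma Ck_pdl D k s f : Ck D (size s + k) f -> Ck D k (pdl D s f).
Proof.
elim: s k => [//|i s IH] k; rewrite [size _]/= addSnnS => /IH [_ /(_ i)[_ H]].
exact: H.
Qed.

Lemma Ck_ucont k f : Ck cube k f -> ucont cube f.
Proof. by case: k => [|k] [cf _]; apply/(ucontP _ cube_compact). Qed.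

Lemma pdcvg_lin D i a f g x l l' : pdcvg D i f x l -> pdcvg D i g x l' ->
  pdcvg D i (fun y => a * f y + g y) x (a * l + l').
Proof.
move=> /pdcvgP Hf /pdcvgP Hg; apply/pdcvgP; rewrite /pd_quotient.
rewrite (_ : (fun h => _) = fun h => a * (h^-1 * (f (x + h *: delta_mx 0 i) - f x)) +
    h^-1 * (g (x + h *: delta_mx 0 i) - g x)); last by apply/funext => h; ring.
by apply: cvgD => //; apply: cvgM => //; exact: cvg_cst.
Qed.

Lemma pd_lin D i a f g x : thick D -> D x -> pderivable D i f x -> pderivable D i g x ->
  pderivable D i (fun y => a * f y + g y) x /\
  pd D i (fun y => a * f y + g y) x = a * pd D i f x + pd D i g x.
Proof.
by move=> tD Dx /pderivable_pdcvg Hf /pderivable_pdcvg Hg;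
  apply: pdcvg_pd => //; exact: pdcvg_lin.
Qed.

Lemma Ck_lin D k a f g : thick D -> Ck D k f -> Ck D k g ->
  Ck D k (fun y => a * f y + g y).
Proof.
move=> tD; elim: k f g => [|k IH] f g [cf Hf] [cg Hg]; split=> //.
- by move=> x; apply: cvgD; [apply: cvgM; [exact: cvg_cst|exact: cf]|exact: cg].
- by move=> x; apply: cvgD; [apply: cvgM; [exact: cvg_cst|exact: cf]|exact: cg].
move=> i; have [df cdf] := Hf i; have [dg cdg] := Hg i; split.
  by move=> x Dx; apply: (pd_lin a tD Dx (df x Dx) (dg x Dx)).1.
apply: Ck_ext (IH _ _ cdf cdg) => x Dx.
by rewrite (pd_lin a tD Dx (df x Dx) (dg x Dx)).2.
Qed.

Lemma pdl_lin D s a f g x : thick D -> Ck D (size s) f -> Ck D (size s) g -> D x ->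
  pdl D s (fun y => a * f y + g y) x = a * pdl D s f x + pdl D s g x.
Proof.
move=> tD; elim: s x => [//|i s IH] x cf cg Dx /=.
have := @Ck_pdl D 1 s f; rewrite addn1 => /(_ cf)[_ /(_ i)[df _]].
have := @Ck_pdl D 1 s g; rewrite addn1 => /(_ cg)[_ /(_ i)[dg _]].
rewrite -(pd_lin a tD Dx (df x Dx) (dg x Dx)).2; apply: pd_ext => // y Dy.
by apply: IH => //; exact: CkW.
Qed.

(** ** Functions of product form *)

(** Kernels, their approximations and the test functions in use are combinations of such
products. *)
Definition tens q x : R := \prod_j q j (x 0 j).

Definition upd q i (r : R -> R) : 'I_m -> R -> R := fun j => if j == i then r else q j.

Lemma tens_upd q i (r : R -> R) x :
  tens (upd q i r) x = r (x 0 i) * \prod_(j | j != i) q j (x 0 j).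
Proof.
rewrite /tens (bigD1 i)//= /upd eqxx; congr (_ * _).
by apply: eq_bigr => j /negPf ->.
Qed.

Lemma pdcvg_tens D q i x l : is_derive (x 0 i) 1 (q i) l ->
  pdcvg D i (tens q) x (l * \prod_(j | j != i) q j (x 0 j)).
Proof.
move=> /is_derive_eps H; apply/pdcvgP; rewrite /pd_quotient.
set P := \prod_(j | _) _.
rewrite (_ : (fun h => _) = fun h => (h^-1 * (q i (x 0 i + h) - q i (x 0 i))) * P).
  apply: cvgM; last exact: cvg_cst.
  apply/cvgrPdist_lt => e /H[d d0 Hd]; rewrite near_withinE near_withinE.
  apply/nbhs_ballP; exists d => // h; rewrite /ball/= sub0r normrN => hd h0 _.
  exact: Hd.
apply/funext => h; rewrite -mulrA mulrBl; congr (_ * (_ - _)).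
  rewrite shift_coord /tens (bigD1 i)//= set_coordE eqxx; congr (_ * _).
  by apply: eq_bigr => j /negPf ji; rewrite set_coordE ji.
by rewrite /tens (bigD1 i).
Qed.

Lemma pd_tens D q i x : thick D -> D x -> derivable (q i) (x 0 i) 1 ->
  pderivable D i (tens q) x /\ pd D i (tens q) x = tens (upd q i (derive1 (q i))) x.
Proof.
move=> tD Dx dq; rewrite tens_upd; apply: pdcvg_pd => //.
by apply: pdcvg_tens; rewrite derive1E; exact/derivableP.
Qed.

Lemma continuous_tens q : (forall j, continuous (q j)) -> continuous (tens q).
Proof.
move=> cq; apply: (continuous_big (@mul_continuous R)) => j _ x.
by apply: (continuous_comp (@coord_continuous _ _ _ 0 j x)); exact: cq.
Qed.

Lemma Ck_tens D k q : thick D -> (forall j, Ck1 k (q j)) -> Ck D k (tens q).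
Proof.
move=> tD; elim: k q => [|k IH] q cq.
  by split=> //; exact/continuous_subspaceT/continuous_tens.
split; first by apply/continuous_subspaceT/continuous_tens => j; exact: Ck1_cont (cq j).
move=> i; split=> [x Dx|].
  by apply: (pd_tens tD Dx _).1; case: (cq i).
apply: Ck_ext (IH (upd q i (derive1 (q i))) _) => [x Dx|j].
  by rewrite (pd_tens tD Dx _).2//; case: (cq i).
by rewrite /upd; case: eqP => _; [case: (cq i)|exact/Ck1W/cq].
Qed.

Lemma pdl_tens D s q x : thick D -> uniq s -> (forall j t, derivable (q j) t 1) -> D x ->
  pdl D s (tens q) x = tens (fun j => if j \in s then derive1 (q j) else q j) x.
Proof.
move=> tD + dq; elim: s x => [//|i s IH] x /= /andP[is_ us] Dx.
have E y : D y -> pdl D s (tens q) y = tens (fun j => if j \in s then derive1 (q j) else q j) y.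
  exact: IH.
rewrite (pd_ext _ Dx E) (pd_tens tD Dx _).2 (negPf is_)//.
apply: eq_bigr => j _; rewrite /upd inE.
by case: (eqVneq j i) => [->|].
Qed.

(** ** Integration by parts *)

Lemma Ck_slice_c1 f i x : Ck cube 1 f -> cube x ->
  c1 (fun t => f (set_coord i t x)) (fun t => pd cube i f (set_coord i t x)).
Proof.
move=> cf cx; have uf := Ck_ucont cf; have [_ /(_ i)[df cdf]] := cf.
split; [exact: ucont_slice|exact: ucont_slice (@Ck_ucont 0 _ cdf) cx|].
move=> t /andP[t0 t1]; have It : cI t by rewrite cIE !ltW.
have cxt := set_coord_cube i cx It.
apply/is_derive_eps => e e0; have [d d0 Hd] := pderivable_pdcvg (df _ cxt) e0.
exists (Num.min d (Num.min t (1 - t))); first by rewrite !lt_min d0 t0 subr_gt0.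
move=> h h0; rewrite !lt_min => /and3P[hd ht h1].
have := Hd h h0 hd; rewrite !shift_coord !set_coordE eqxx !set_coord_set; apply.
apply: set_coord_cube => //; rewrite cIE; move: ht h1; rewrite !ltr_norml.
by move=> /andP[? ?] /andP[? ?]; apply/andP; split; lra.
Qed.

(** Integration by parts in several variables: the factor L i absorbs one derivative in the
variable x_i and becomes L' i. *)
Lemma tensor_pdl C C' (L L' : 'I_m -> (R -> R) -> R) s f x :
  (forall i, bfun C (L i)) -> (forall i, bfun C' (L' i)) ->
  (forall i, i \in s -> forall u v, c1 u v -> L i v = L' i u) ->
  uniq s -> Ck cube (size s) f -> cube x ->
  tensor L s (pdl cube s f) x = tensor L' s f x.
Proof.
move=> bL bL'; elim: s x f => [//|i s IH] x f LL' /= /andP[is_ us] cf cx.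
have c1f : Ck cube 1 (pdl cube s f) by apply: Ck_pdl; rewrite addn1.
have u1 := Ck_ucont c1f.
have u2 : ucont cube (pd cube i (pdl cube s f)).
  by have [_ /(_ i)[_ H]] := c1f; exact: (@Ck_ucont 0 _ H).
rewrite (opi_tensor bL (bL i) is_ u2 cx).
have E y : cube y -> opi i (L i) (pd cube i (pdl cube s f)) y =
    opi i (L' i) (pdl cube s f) y.
  by move=> cy; apply: LL'; [exact: mem_head|exact: Ck_slice_c1].
rewrite (tensor_eq bL s (ucont_opi i (bL i) u2) E)//.
rewrite -(opi_tensor bL (bL' i) is_ u1 cx).
apply: (opi_eq i (bL' i)) cx => [|y cy]; first exact: (ucont_tensor bL s u1).
by apply: IH => //; [move=> j js; apply: LL'; rewrite inE js orbT|exact: CkW].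
Qed.

End Partial.

(** * The one-dimensional kernel min(t, a) *)

Section Kernel1.
Context {R : realType}.
Implicit Types (g u v : R -> R) (t a e : R).

Lemma c1_id : c1 (fun t : R => t) (fun=> 1).
Proof.
have := smooth_c1 (@Ck1_id R); rewrite (_ : derive1 (fun t : R => t) = fun=> 1)//.
by apply/funext => t; exact: (@is_derive_derive1 _ _ (fun=> 1)).
Qed.

Lemma ucont_id : ucont cI (fun t : R => t).
Proof. by case: c1_id. Qed.

Lemma ucont_min a : ucont cI (fun t : R => Num.min t a).
Proof.
move=> e e0; exists e => // s t _ _; rewrite /ball/=; apply: le_lt_trans.
rewrite /Num.min; case: (ltP s a) => sa; case: (ltP t a) => ta //.
- by rewrite ltr0_norm ?ler_normr; [apply/orP; right; lra|lra].
- by rewrite gtr0_norm ?ler_normr; [apply/orP; left; lra|lra].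
- by rewrite subrr normr0.
Qed.

(** For u = p', with p and p' vanishing at both ends, this says that -(min(t, a))'' is the
Dirac mass at a. *)
Lemma by_parts_min a u v : 0 <= a <= 1 -> c1 u v ->
  itg 0 1 (fun t => Num.min t a * v t) = a * u 1 - itg 0 a u.
Proof.
move=> /andP[a0 a1] cuv; have [uu uv _] := cuv.
rewrite (itg_split (lexx 0) a0 a1 (lexx 1)); last exact: ucontM cI_compact (ucont_min a) uv.
rewrite (@eq_itg _ 0 a (fun t => Num.min t a * v t) (fun t => t * v t)); last first.
  by move=> t /andP[_ ta]; rewrite min_l.
rewrite (@eq_itg _ a 1 (fun t => Num.min t a * v t) (fun t => a * v t)); last first.
  by move=> t /andP[ta _]; rewrite min_r.
have u0 : ucont cI (fun=> 0 : R) by exact: ucont_cst.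
have -> : itg a 1 (fun t => a * v t) = a * (u 1 - u a).
  rewrite -(FTC a0 a1 (lexx 1) cuv); have := itg_lin a a0 (lexx 1) uv u0.
  rewrite (@itg_zero _ a 1 (fun=> 0))// addr0 => <-.
  by apply: eq_itg => t _; rewrite addr0.
have := FTC (lexx 0) a0 a1 (c1M c1_id cuv); rewrite mul0r subr0.
have := itg_lin 1 (lexx 0) a1 (ucontM cI_compact ucont_id uv) uu.
rewrite (@eq_itg _ 0 a (fun t => 1 * (t * v t) + u t) (fun t => t * v t + u t * 1)); last first.
  by move=> t _; rewrite mul1r mulr1.
by move=> -> /eqP; rewrite -subr_eq0 => /eqP ?; apply/eqP; rewrite -subr_eq0; apply/eqP; lra.
Qed.

Lemma by_parts_id u v : c1 u v -> itg 0 1 (fun t => t * v t) = u 1 - itg 0 1 u.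
Proof.
move=> cuv; rewrite (by_parts c1_id cuv) mul1r mul0r subr0; congr (_ - _).
by apply: eq_itg => t _; rewrite mul1r.
Qed.

(** One has min(t, a) = t - (t - a)^+; the positive part is smoothed at the scale e. *)
Definition smin e a t : R := t - e * ramp (e^-1 * t - e^-1 * a).

Definition dsmin e a t : R := 1 - derive1 ramp (e^-1 * t - e^-1 * a).

Lemma smooth_smin e a : smooth (smin e a).
Proof.
move=> k; apply: Ck1B; first exact: Ck1_id.
exact: (Ck1Z e (Ck1_aff e^-1 (- (e^-1 * a)) (ramp_smooth k))).
Qed.

Lemma derive1_smin e a : 0 < e -> derive1 (smin e a) = dsmin e a.
Proof.
move=> e0; apply/funext => t; apply: is_derive_derive1.
have H1 := smooth_is_derive (e^-1 * t + - (e^-1 * a)) (@ramp_smooth R).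
have H2 := is_derive_aff e^-1 (- (e^-1 * a)) t.
have H3 := @is_derive1_comp _ ramp (fun t => e^-1 * t - e^-1 * a) _ _ _ H1 H2.
have H4 := is_deriveB (is_derive_id t (1 : R)) (is_deriveZ e H3).
apply: is_derive_eq H4 _; rewrite /dsmin /GRing.scale/=.
by rewrite mulrCA divff ?gt_eqF// mulr1.
Qed.

Lemma scale_le0 e a t : 0 < e -> t <= a -> e^-1 * t - e^-1 * a <= 0.
Proof. by move=> e0 ta; rewrite -mulrBr pmulr_rle0 ?invr_gt0// subr_le0. Qed.

Lemma scale_ge1 e a t : 0 < e -> a + e <= t -> 1 <= e^-1 * t - e^-1 * a.
Proof. by move=> e0 ta; rewrite -mulrBr mulrC ler_pdivlMr// mul1r; lra. Qed.

Lemma smin0 e a : 0 < e -> 0 <= a -> smin e a 0 = 0.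
Proof. by move=> e0 a0; rewrite /smin ramp_le0 ?mulr0 ?subr0//; have := scale_le0 e0 a0; rewrite mulr0. Qed.

Lemma smin_bounds e a t : 0 < e -> Num.min t a <= smin e a t <= t.
Proof.
move=> e0; rewrite /smin /ramp; set y := e^-1 * t - e^-1 * a.
have /andP[s0 s1] := step01 y; have [ta|ta] := leP t a.
  by rewrite step_le0 ?scale_le0// !mulr0 subr0 !lexx.
have yE : e * y = t - a by rewrite /y -mulrBr mulrA divff ?gt_eqF// mul1r.
by rewrite mulrA yE; apply/andP; split; nra.
Qed.

Lemma smin_approx e a t : 0 < e -> `|Num.min t a - smin e a t| <= e.
Proof.
move=> e0; have /andP[h1 h2] := smin_bounds a t e0.
rewrite ler0_norm; last lra.
move: h1; have [ta|ta] := leP t a => h1; first lra.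
have [tb|tb] := leP (a + e) t.
  rewrite /smin ramp_ge1 ?scale_ge1//.
  by rewrite -mulrBr mulrA divff ?gt_eqF// mul1r; lra.
lra.
Qed.

Lemma dsmin_le e a t : 0 < e -> t <= a -> dsmin e a t = 1.
Proof. by move=> e0 ta; rewrite /dsmin dramp_le0 ?subr0// scale_le0. Qed.

Lemma dsmin_ge e a t : 0 < e -> a + e <= t -> dsmin e a t = 0.
Proof. by move=> e0 ta; rewrite /dsmin dramp_ge1 ?subrr// scale_ge1. Qed.

Lemma dsmin_bound : exists2 K : R, 1 <= K & forall e a t, `|dsmin e a t| <= K.
Proof.
have [K K1 HK] := @ramp_bounds R; exists (1 + K); first by lra.
move=> e a t; have [h _] := HK (e^-1 * t - e^-1 * a).
by rewrite /dsmin (le_trans (ler_normB _ _))// normr1 lerD2l.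
Qed.

Lemma ucont_dsmin e a : 0 < e -> ucont cI (dsmin e a).
Proof. by move=> e0; have [_ + _] := smooth_c1 (smooth_smin e a); rewrite derive1_smin. Qed.

Lemma wint_dsmin K e a M g : 0 < e -> 0 <= a <= 1 ->
  (forall t, `|dsmin e a t| <= K) -> ucont cI g -> bounded_by cI M g ->
  `|wint (dsmin e a) g - itg 0 a g| <= K * e * M.
Proof.
move=> e0 /andP[a0 a1] dK ug gM; have ud := ucont_dsmin a e0.
have M0 : 0 <= M by apply: le_trans (gM 0 cI0).
have K0 : 0 <= K by apply: le_trans (dK 0).
have udg : ucont cI (fun t => dsmin e a t * g t) by exact: ucontM cI_compact _ _.
rewrite /wint (itg_split (lexx 0) a0 a1 (lexx 1) udg).
rewrite (@eq_itg _ 0 a _ g) ?[_ + itg a 1 _]addrC ?addrK; last first.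
  by move=> t /andP[_ ta]; rewrite dsmin_le// mul1r.
have -> : K * e * M = (K * M) * ((a + e) - a) by ring.
apply: itg_tail => //; [lra|exact: mulr_ge0| |].
  move=> t /andP[at_ t1]; rewrite normrM ler_pM//.
  by apply: gM; rewrite cIE t1 (le_trans a0).
by move=> t /andP[ta _]; rewrite dsmin_ge// mul0r.
Qed.

End Kernel1.

(** * The scalar product on smooth functions *)

Section Energy.
Context {R : realType} {m : nat}.
Implicit Types (x xi : 'rV[R]_m) (f g : 'rV[R]_m -> R) (U V W : {set 'I_m}).

Lemma pdUE D U f : pdU D U f = pdl D (enum U) f.
Proof. by []. Qed.

Lemma size_allI : size (enum (allI m)) = m.
Proof. by rewrite -cardE cardsT card_ord. Qed.

Lemma bfun_int : forall i : 'I_m, bfun 1 (itg 0 1 : (R -> R) -> R).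
Proof. by move=> _; exact: bfun_itg (lexx 0) ler01 (lexx 1). Qed.

Lemma cube0 : cube (0 : 'rV[R]_m).
Proof. by move=> i; rewrite mxE lexx ler01. Qed.

Lemma tensor_int_ge0 s f : ucont cube f -> (forall x, cube x -> 0 <= f x) ->
  forall x, cube x -> 0 <= tensor (fun=> itg 0 1) s f x.
Proof.
move=> uf f0; elim: s => [//|i s IH] x cx /=.
by apply: itg_ge0 => t It; apply: IH; apply: set_coord_cube => //; rewrite cIE.
Qed.

Lemma int_cube_ge0 f : ucont cube f -> (forall x, cube x -> 0 <= f x) -> 0 <= int_cube f.
Proof. by move=> uf f0; apply: (tensor_int_ge0 _ uf f0 cube0). Qed.

Lemma int_cube_lin (a : R) f g : ucont cube f -> ucont cube g ->
  int_cube (fun x => a * f x + g x) = a * int_cube f + int_cube g.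
Proof. by move=> uf ug; apply: (tensor_lin bfun_int _ a uf ug cube0). Qed.

Lemma int_cube_eq f g : ucont cube f -> (forall x, cube x -> f x = g x) ->
  int_cube f = int_cube g.
Proof. by move=> uf fg; apply: (tensor_eq bfun_int _ uf fg cube0). Qed.

Lemma int_cube_bound K f : ucont cube f -> bounded_by cube K f -> `|int_cube f| <= K.
Proof.
move=> uf fK; have := tensor_bound bfun_int (enum (allI m)) uf fK cube0.
by rewrite expr1n mul1r.
Qed.

Lemma int_cube_CS f g : ucont cube f -> ucont cube g ->
  int_cube (fun x => f x * g x) ^+ 2 <=
  int_cube (fun x => f x * f x) * int_cube (fun x => g x * g x).
Proof.
move=> uf ug.
have ufg : ucont cube (fun x => f x * g x) by exact: ucontM cube_compact _ _.
have uff : ucont cube (fun x => f x * f x) by exact: ucontM cube_compact _ _.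
have ugg : ucont cube (fun x => g x * g x) by exact: ucontM cube_compact _ _.
have P t : 0 <= int_cube (fun x => f x * f x) + 2 * t * int_cube (fun x => f x * g x) +
    t ^+ 2 * int_cube (fun x => g x * g x).
  have -> : int_cube (fun x => f x * f x) + 2 * t * int_cube (fun x => f x * g x) +
      t ^+ 2 * int_cube (fun x => g x * g x) =
      int_cube (fun x => t ^+ 2 * (g x * g x) + (2 * t * (f x * g x) + f x * f x)).
    rewrite int_cube_lin//; last by apply: ucontD => //; exact: ucontZ.
    by rewrite int_cube_lin//; ring.
  apply: int_cube_ge0.
    by apply: ucontD; [exact: ucontZ|apply: ucontD => //; exact: ucontZ].
  move=> x _; have -> : t ^+ 2 * (g x * g x) + (2 * t * (f x * g x) + f x * f x) =
    (f x + t * g x) ^+ 2 by ring.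
  exact: sqr_ge0.
set A := int_cube (fun x => f x * f x) in P *; set B := int_cube (fun x => f x * g x) in P *.
set C := int_cube (fun x => g x * g x) in P *.
have A0 : 0 <= A by have := P 0; rewrite mulr0 mul0r expr0n/= mul0r !addr0.
have C0 : 0 <= C by apply: int_cube_ge0 => // x _; rewrite -expr2 sqr_ge0.
have [C00|C00] := eqVneq C 0.
  have [->|B0] := eqVneq B 0; first by rewrite expr0n/= mulr_ge0.
  have := P (- (A + 1) / (2 * B)); rewrite C00 mulr0 addr0.
  have -> : A + 2 * (- (A + 1) / (2 * B)) * B = -1 by field.
  by lra.
have Cp : 0 < C by rewrite lt_neqAle eq_sym C00.
have := P (- B / C); have -> : A + 2 * (- B / C) * B + (- B / C) ^+ 2 * C = (A * C - B ^+ 2) / C.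
  by field.
by rewrite pmulr_lge0 ?invr_gt0// subr_ge0.
Qed.

(** The mixed derivative d^m f / dx_1 ... dx_m. *)
Definition mixed f : 'rV[R]_m -> R := pdU cube (allI m) f.

Lemma C0m_Ck f : C0m f -> Ck cube (size (enum (allI m))) f.
Proof. by case; rewrite size_allI. Qed.

Lemma ucont_mixed f : C0m f -> ucont cube (mixed f).
Proof.
move=> /C0m_Ck cf; apply: (@Ck_ucont _ _ 0).
by apply: Ck_pdl; rewrite addn0.
Qed.

Lemma C0m_ucont f : C0m f -> ucont cube f.
Proof. by case=> /Ck_ucont. Qed.

Lemma C0m_lin (a : R) f g : C0m f -> C0m g -> C0m (fun x => a * f x + g x).
Proof.
move=> [cf f0] [cg g0]; split; first exact: (Ck_lin a thick_cube cf cg).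
by move=> x cx j xj; rewrite (f0 x cx j xj) (g0 x cx j xj) mulr0 addr0.
Qed.

Lemma C0mB f g : C0m f -> C0m g -> C0m (fun x => f x - g x).
Proof.
move=> cf cg; have := C0m_lin (-1) cg cf.
by congr C0m; apply/funext => x; rewrite mulN1r addrC.
Qed.

Lemma mixed_lin (a : R) f g x : C0m f -> C0m g -> cube x ->
  mixed (fun y => a * f y + g y) x = a * mixed f x + mixed g x.
Proof. by move=> /C0m_Ck cf /C0m_Ck cg cx; exact: (pdl_lin a thick_cube cf cg cx). Qed.

Lemma mixedB f g x : C0m f -> C0m g -> cube x ->
  mixed (fun y => f y - g y) x = mixed f x - mixed g x.
Proof.
move=> cf cg cx; rewrite addrC -mulN1r -mixed_lin//; congr (mixed _ x).
by apply/funext => y; rewrite mulN1r addrC.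
Qed.

Lemma dotCC f g : dotC f g = dotC g f.
Proof. by congr int_cube; apply/funext => x; rewrite mulrC. Qed.

Lemma dotC_lin (a : R) f g h : C0m f -> C0m g -> C0m h ->
  dotC (fun x => a * f x + g x) h = a * dotC f h + dotC g h.
Proof.
move=> cf cg ch; have uf := ucont_mixed cf; have ug := ucont_mixed cg.
have uh := ucont_mixed ch.
rewrite /dotC -int_cube_lin; [|exact: ucontM cube_compact _ _..].
apply: int_cube_eq => [|x cx].
  exact: ucontM cube_compact (ucont_mixed (C0m_lin a cf cg)) uh.
by have := mixed_lin a cf cg cx; rewrite /mixed => ->; ring.
Qed.

Lemma dotCB f g h : C0m f -> C0m g -> C0m h ->
  dotC (fun x => f x - g x) h = dotC f h - dotC g h.
Proof.
move=> cf cg ch; rewrite addrC -mulN1r -dotC_lin//; congr dotC.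
by apply/funext => y; rewrite mulN1r addrC.
Qed.

Lemma normC2_ge0 f : C0m f -> 0 <= normC2 f.
Proof.
move=> /ucont_mixed uf; apply: int_cube_ge0; first exact: ucontM cube_compact _ _.
by move=> x _; rewrite -expr2 sqr_ge0.
Qed.

Lemma dotC_CS f g : C0m f -> C0m g -> dotC f g ^+ 2 <= normC2 f * normC2 g.
Proof. by move=> /ucont_mixed uf /ucont_mixed ug; exact: int_cube_CS. Qed.

Lemma normC2_lin (a : R) f g : C0m f -> C0m g ->
  normC2 (fun x => a * f x + g x) = a ^+ 2 * normC2 f + 2 * a * dotC f g + normC2 g.
Proof.
move=> cf cg; have cfg := C0m_lin a cf cg; rewrite /normC2 dotC_lin//.
set h := fun x => a * f x + g x in cfg *.
rewrite (dotCC f h) (dotCC g h) /h !dotC_lin// (dotCC g f); ring.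
Qed.

Lemma normC2B f g : C0m f -> C0m g ->
  normC2 (fun x => f x - g x) = normC2 f - 2 * dotC f g + normC2 g.
Proof.
move=> cf cg; have -> : (fun x => f x - g x) = (fun x => (-1) * g x + f x).
  by apply/funext => x; rewrite mulN1r addrC.
by rewrite normC2_lin// dotCC; ring.
Qed.

End Energy.

(** * The kernels and their smooth approximations *)

Section Kernel.
Context {R : realType} {m : nat}.
Implicit Types (x xi : 'rV[R]_m) (f g : 'rV[R]_m -> R) (U V W : {set 'I_m}) (j : 'I_m).

Local Notation all := (enum (allI m)).

Lemma mem_all j : j \in all. Proof. by rewrite mem_enum inE. Qed.

Lemma prod_all (F : 'I_m -> R) : \prod_(j <- all) F j = \prod_j F j.
Proof. by rewrite big_enum; apply: eq_bigl => j; rewrite inE. Qed.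

(** The factors of the kernel K_{U^c} k_U with second argument xi. *)
Definition kfac U xi j (t : R) : R :=
  if j \in U then xi 0 j * t else Num.min t (xi 0 j).

Definition kfac_approx (e : R) U xi j : R -> R :=
  if j \in U then fun t => xi 0 j * t else smin e (xi 0 j).

Definition dkfac_approx (e : R) U xi j : R -> R :=
  if j \in U then fun=> xi 0 j else dsmin e (xi 0 j).

Lemma tens_kfac U xi x : tens (kfac U xi) x = Kmin (~: U) x xi * kprod U x xi.
Proof.
rewrite /tens (bigID (mem U))/= mulrC; congr (_ * _).
  by apply: eq_big => [j|j /negPf jU]; rewrite ?inE// /kfac jU.
by apply: eq_bigr => j jU; rewrite /kfac jU mulrC.
Qed.

Lemma ucont_kfac U xi : ucont cube (tens (kfac U xi)).
Proof.
rewrite /tens; apply: ucont_prod cube_compact _ => j _.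
apply: (@ucont_coord _ _ (kfac U xi j)).
by rewrite /kfac; case: (j \in U); [exact: ucontZ ucont_id|exact: ucont_min].
Qed.

Lemma smooth_kfac_approx (e : R) U xi j : smooth (kfac_approx e U xi j).
Proof.
rewrite /kfac_approx; case: (j \in U); last exact: smooth_smin.
by move=> k; apply: Ck1Z; exact: Ck1_id.
Qed.

Lemma derive1_kfac_approx (e : R) U xi j : 0 < e ->
  derive1 (kfac_approx e U xi j) = dkfac_approx e U xi j.
Proof.
move=> e0; rewrite /kfac_approx /dkfac_approx; case: (j \in U); last exact: derive1_smin.
apply/funext => t; apply: (@is_derive_derive1 _ _ (fun=> xi 0 j)).
by have := is_derive_aff (xi 0 j) 0 t; congr is_derive; apply/funext => s; rewrite addr0.
Qed.

Lemma C0m_kfac_approx (e : R) U xi : 0 < e -> cube xi -> C0m (tens (kfac_approx e U xi)).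
Proof.
move=> e0 cxi; split; first by apply: Ck_tens thick_cube _ => j; exact: smooth_kfac_approx.
move=> x cx j xj; rewrite /tens (bigD1 j)//= xj /kfac_approx; case: (j \in U).
  by rewrite mulr0 mul0r.
by rewrite smin0 ?mul0r//; have /andP[] := cxi j.
Qed.

Lemma mixed_kfac_approx (e : R) U xi x : 0 < e -> cube x ->
  mixed (tens (kfac_approx e U xi)) x = \prod_(j <- all) dkfac_approx e U xi j (x 0 j).
Proof.
move=> e0 cx; rewrite /mixed pdUE (pdl_tens thick_cube (enum_uniq _) _ cx); last first.
  by move=> j t; have [] := @smooth_kfac_approx e U xi j 1.
rewrite prod_all /tens; apply: eq_bigr => j _.
by rewrite mem_all derive1_kfac_approx.
Qed.

Lemma cube_le1 xi j : cube xi -> `|xi 0 j| <= 1.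
Proof. by move=> /(_ j) /andP[h h']; rewrite ger0_norm. Qed.

Lemma dkfac_bound : exists2 K : R, 1 <= K & forall e U xi j t, cube xi ->
  `|dkfac_approx e U xi j t| <= K.
Proof.
have [K K1 HK] := @dsmin_bound R; exists K => // e U xi j t cxi.
rewrite /dkfac_approx; case: (j \in U); last exact: HK.
by apply: le_trans K1; exact: cube_le1.
Qed.

Lemma ucont_dkfac (e : R) U xi j : 0 < e -> ucont cI (dkfac_approx e U xi j).
Proof.
move=> e0; rewrite /dkfac_approx; case: (j \in U); first exact: ucont_cst.
exact: ucont_dsmin.
Qed.

Lemma mixed_kfac_bound (K e : R) U xi : 0 < e -> cube xi ->
  (forall j t, `|dkfac_approx e U xi j t| <= K) ->
  bounded_by cube (K ^+ m) (mixed (tens (kfac_approx e U xi))).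
Proof.
move=> e0 cxi HK x cx; rewrite mixed_kfac_approx// prod_all normr_prod.
rewrite -[X in K ^+ X]card_ord -prodr_const; apply: ler_prod => j _.
by rewrite normr_ge0 HK.
Qed.

Definition on_face U xi : 'rV[R]_m := \row_j (if j \in U then 1 else xi 0 j).

(** The functional on H^m which the kernel K_{U^c} k_U(., xi) represents, see [dotH_kfac]. *)
Definition face_eval U xi f : R := \prod_(j in U) xi 0 j * f (on_face U xi).

Lemma on_face_cube U xi : cube xi -> cube (on_face U xi).
Proof.
by move=> cxi j; rewrite mxE; case: ifP => _; [rewrite ler01 lexx|exact: cxi].
Qed.

(** Integration against the derivative of the factor [kfac U xi j]: the constant xi_j, or the
indicator function of [0, xi_j]. *)
Definition rep_fun U xi j (g : R -> R) : R :=
  if j \in U then xi 0 j * itg 0 1 g else itg 0 (xi 0 j) g.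

Lemma bfun_rep U xi : cube xi -> forall j, bfun 1 (rep_fun U xi j).
Proof.
move=> cxi j; rewrite /rep_fun; have /andP[h0 h1] := cxi j; case: (j \in U).
  apply: bfunW (bfunZl (xi 0 j) (bfun_itg (lexx 0) ler01 (lexx 1))).
  by rewrite mulr1 cube_le1.
exact: bfun_itg.
Qed.

(** The fundamental theorem of calculus in each variable; the terms at x_j = 0 vanish. *)
Lemma tensor_rep U xi f : cube xi -> C0m f ->
  tensor (rep_fun U xi) all (mixed f) 0 = face_eval U xi f.
Proof.
move=> cxi cf; have [_ f0] := cf; have uf := C0m_ucont cf.
pose c j := if j \in U then xi 0 j else 1; pose a j := if j \in U then 1 else xi 0 j.
have Ia j : cI (a j) by rewrite /a; case: (j \in U); [exact: cI1|exact: cube_cI].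
have c1 j : `|c j| <= 1 by rewrite /c; case: (j \in U); rewrite ?normr1// cube_le1.
pose L1 j (g : R -> R) := c j * dlt (a j) g + - c j * dlt 0 g.
pose L2 j (g : R -> R) := c j * g (a j).
have b2 j : bfun 1 (L2 j).
  by apply: bfunW (bfunZl (c j) (bfun_dlt (Ia j))); rewrite mulr1.
have b1 j : bfun 2 (L1 j).
  apply: bfunW (bfunDl (bfunZl (c j) (bfun_dlt (Ia j))) (bfunZl (- c j) (bfun_dlt cI0))).
  by rewrite !mulr1 normrN; have := c1 j; lra.
rewrite /mixed pdUE (@tensor_pdl _ _ 1 2 (rep_fun U xi) L1)//.
- rewrite (@tensor_congr _ _ 2 1 [set 0] L1 L2)//.
  + rewrite /L2 tensor_eval ?enum_uniq// prod_all /face_eval; congr (_ * f _).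
      rewrite (bigID (mem U))/= [X in _ * X]big1 ?mulr1.
        by apply: eq_bigr => j jU; rewrite /c jU.
      by move=> j /negPf jU; rewrite /c jU.
    by apply/rowP => j; rewrite !mxE mem_all.
  + by move=> j x _ cx /= xj; exact: f0 xj.
  + move=> j g _ ug g0; have g00 : g 0 = 0 by apply: g0 => //; exact: cI0.
    by rewrite /L1 /L2 /dlt g00 mulr0 addr0.
  + exact: enum_uniq.
  + exact: cube0.
- exact: bfun_rep.
- move=> j _ u v cuv; rewrite /rep_fun /L1 /c /a /dlt; have /andP[h0 h1] := cxi j.
  case: (j \in U); first by rewrite (FTC (lexx 0) ler01 (lexx 1) cuv); ring.
  by rewrite (FTC (lexx 0) h0 h1 cuv); ring.
- exact: enum_uniq.
- exact: C0m_Ck.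
- exact: cube0.
Qed.

(** The derivatives of the smoothed factors differ from the limit densities on an interval of
length e only, whence an error that is uniform in f once its mixed derivative is bounded. *)
Lemma dotC_kfac_approx : exists2 A : R, 0 <= A & forall U xi (e M : R) f, cube xi ->
  0 < e -> C0m f -> bounded_by cube M (mixed f) ->
  `|dotC f (tens (kfac_approx e U xi)) - face_eval U xi f| <= A * e * M.
Proof.
have [K K1 HK] := dkfac_bound; have K0 : 0 <= K by lra.
exists (m%:R * K * K ^+ m); first by rewrite !mulr_ge0// exprn_ge0.
move=> U xi e M f cxi e0 cf fM; have uf := ucont_mixed cf.
rewrite -tensor_rep//.
have -> : dotC f (tens (kfac_approx e U xi)) =
    tensor (fun j => wint (dkfac_approx e U xi j)) all (mixed f) 0.
  rewrite -(tensor_weight bfun_int _ (enum_uniq _) uf cube0); last first.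
    by move=> j; exact: ucont_dkfac.
  apply: int_cube_eq => [|x cx].
    exact: ucontM cube_compact uf (ucont_mixed (C0m_kfac_approx _ e0 cxi)).
  by have := mixed_kfac_approx U xi e0 cx; rewrite /mixed => ->.
have := @tensor_dist _ _ K (K * e) (fun j => wint (dkfac_approx e U xi j)) (rep_fun U xi)
  all (mixed f) M K1 _ _ _ _ uf fM _ cube0.
rewrite size_allI => H; apply: le_trans (H _ _ _ _) _.
- by rewrite mulr_ge0// ltW.
- by move=> j; apply: bfun_wint => // [|t _]; [exact: ucont_dkfac|exact: HK].
- by move=> j; apply: bfunW K1 _; exact: bfun_rep.
- move=> j L g ug gL; have L0 : 0 <= L by apply: le_trans (gL 0 cI0).
  rewrite /rep_fun /wint /dkfac_approx; case: (j \in U).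
    have -> : itg 0 1 (fun t => xi 0 j * g t) = xi 0 j * itg 0 1 g.
      exact: (bfunZ (bfun_itg (lexx 0) ler01 (lexx 1))).
    by rewrite subrr normr0 !mulr_ge0// ltW.
  apply: wint_dsmin => // t; have := HK e finset.set0 xi j t cxi.
  by rewrite /dkfac_approx inE.
- by rewrite (_ : _ * _ * _ * _ = m%:R * K * K ^+ m * e * M)//; ring.
Qed.

Lemma prod_dist (I : Type) (r : seq I) (F G : I -> R) :
  (forall i, `|F i| <= 1) -> (forall i, `|G i| <= 1) ->
  `|\prod_(i <- r) F i - \prod_(i <- r) G i| <= \sum_(i <- r) `|F i - G i|.
Proof.
move=> F1 G1; elim: r => [|i r IH]; first by rewrite !big_nil subrr normr0.
rewrite !big_cons; have P1 : `|\prod_(j <- r) F j| <= 1.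
  by elim: r {IH} => [|j r IH]; rewrite ?big_nil ?normr1// big_cons normrM mulr_ile1.
have -> : F i * \prod_(j <- r) F j - G i * \prod_(j <- r) G j =
  (F i - G i) * \prod_(j <- r) F j + G i * (\prod_(j <- r) F j - \prod_(j <- r) G j) by ring.
rewrite (le_trans (ler_normD _ _))// !normrM lerD//.
  by rewrite ler_piMr.
by apply: le_trans IH; rewrite ler_piMl.
Qed.

Lemma kfac_uniform (e : R) U xi x : 0 < e -> cube xi -> cube x ->
  `|tens (kfac U xi) x - tens (kfac_approx e U xi) x| <= m%:R * e.
Proof.
move=> e0 cxi cx; rewrite /tens.
have b01 (a b : R) : 0 <= a <= 1 -> 0 <= b <= 1 -> `|a * b| <= 1.
  by move=> /andP[? ?] /andP[? ?]; rewrite ger0_norm ?mulr_ge0// mulr_ile1.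
apply: le_trans (prod_dist _ _ _) _ => [j|j|].
- rewrite /kfac; have /andP[a0 a1] := cxi j; have /andP[x0 x1] := cx j.
  case: (j \in U); first exact: b01.
  by rewrite ger0_norm ?le_min ?x0// ge_min x1.
- rewrite /kfac_approx; have /andP[a0 a1] := cxi j; have /andP[x0 x1] := cx j.
  case: (j \in U); first exact: b01.
  have /andP[h1 h2] := smin_bounds (xi 0 j) (x 0 j) e0.
  rewrite ger0_norm; first exact: le_trans x1.
  by apply: le_trans h1; rewrite le_min x0.
have -> : m%:R * e = \sum_(j < m) e by rewrite sumr_const card_ord mulr_natl.
apply: ler_sum => j _; rewrite /kfac /kfac_approx; case: (j \in U).
  by rewrite subrr normr0 ltW.
exact: smin_approx.
Qed.

End Kernel.

(** * Closability of the norm *)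

Section Closability.
Context {R : realType} {m : nat}.
Implicit Types (x : 'rV[R]_m) (f g c : 'rV[R]_m -> R) (j : 'I_m).
Local Notation all := (enum (allI m)).

Lemma common_bound (L : 'I_m -> (R -> R) -> R) : (forall j, exists C, bfun C (L j)) ->
  exists2 C, 1 <= C & forall j, bfun C (L j).
Proof.
move=> /choice[C HC]; exists (1 + \sum_j C j).
  by rewrite lerDl; apply: sumr_ge0 => j _; case: (HC j).
move=> j; apply: bfunW (HC j); rewrite (bigD1 j)//= addrCA lerDl addr_ge0//.
by apply: sumr_ge0 => i _; case: (HC i).
Qed.

Variables (u : nat -> 'rV[R]_m -> R) (B : R) (N0 : nat).
Hypothesis cu : forall n, C0m (u n).
Hypothesis uB : forall n, (N0 <= n)%N -> normC2 (u n) <= B.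
Hypothesis u0 : forall e : R, 0 < e -> exists N : nat, forall n, (N <= n)%N ->
  forall x, cube x -> `|u n x| <= e.

Let B0 : 0 <= B.
Proof. exact: le_trans (normC2_ge0 (cu N0)) (uB (leqnn _)). Qed.

Let weak0 c := forall e : R, 0 < e -> exists N : nat, forall n, (N <= n)%N ->
  `|int_cube (fun x => mixed (u n) x * c x)| <= e.

Let ucont_mu n := ucont_mixed (cu n).

(** By the Cauchy-Schwarz inequality, since the norms are bounded. *)
Let weak0_approx c : ucont cube c -> (forall e : R, 0 < e ->
  exists c', [/\ ucont cube c', weak0 c' & forall x, cube x -> `|c x - c' x| <= e]) -> weak0 c.
Proof.
move=> uc H e e0; pose d := e / (2 * (B + 1)).
have d0 : 0 < d by rewrite divr_gt0// mulr_gt0//; have := B0; lra.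
have [c' [uc' wc' cc']] := H d d0.
have e20 : 0 < e / 2 by rewrite divr_gt0.
have [N HN] := wc' _ e20; exists (maxn N N0) => n; rewrite geq_max => /andP[Nn N0n].
have ucc : ucont cube (fun x => c x - c' x) by exact: ucontB.
have -> : int_cube (fun x => mixed (u n) x * c x) =
    int_cube (fun x => mixed (u n) x * (c x - c' x)) +
    int_cube (fun x => mixed (u n) x * c' x).
  rewrite -[X in X + _]mul1r -int_cube_lin; [|exact: ucontM cube_compact _ _..].
  by congr int_cube; apply/funext => x; ring.
rewrite (le_trans (ler_normD _ _))// [leRHS]splitr lerD ?HN//.
rewrite -(@ler_pXn2r _ 2)// ?nnegrE ?normr_ge0 ?(ltW e20)//.
rewrite -normrX ger0_norm ?sqr_ge0//; apply: le_trans (int_cube_CS (ucont_mu n) ucc) _.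
apply: le_trans (_ : B * d ^+ 2 <= _).
  apply: ler_pM; [exact: normC2_ge0| |exact: uB|].
    apply: int_cube_ge0 => [|x _]; first exact: ucontM cube_compact _ _.
    by rewrite -expr2 sqr_ge0.
  apply: le_trans (ler_norm _) _; apply: int_cube_bound => [|x cx].
    exact: ucontM cube_compact _ _.
  by rewrite normrM expr2 ler_pM// cc'.
have -> : e / 2 = d * (B + 1) by rewrite /d; field; have := B0; lra.
clearbody d; have D := sqr_ge0 d; rewrite exprMn; set D2 := d ^+ 2 in D *.
suff : 0 <= D2 * ((B + 1) ^+ 2 - B) by lra.
by apply: mulr_ge0 => //; have := B0; nra.
Qed.

Let weak0_sum (n : nat) (F : 'I_n -> 'rV[R]_m -> R) : (forall k, ucont cube (F k)) ->
  (forall k, weak0 (F k)) -> weak0 (fun x => \sum_(k < n) F k x).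
Proof.
elim: n F => [|n IH] F uF wF e e0.
  exists 0%N => k _; rewrite (_ : int_cube _ = 0) ?normr0 ?ltW//.
  have -> : (fun x => mixed (u k) x * \sum_(k < 0) F k x) = fun=> 0.
    by apply/funext => x; rewrite big_ord0 mulr0.
  by apply/eqP; rewrite -normr_le0; apply: int_cube_bound => [|x _]; rewrite ?normr0//; exact: ucont_cst.
have e20 : 0 < e / 2 by rewrite divr_gt0.
have [N1 H1] := wF ord0 _ e20.
have [N2 H2] := IH (fun k => F (lift ord0 k)) (fun k => uF _) (fun k => wF _) _ e20.
exists (maxn N1 N2) => k; rewrite geq_max => /andP[/H1 h1 /H2 h2].
have -> : int_cube (fun x => mixed (u k) x * \sum_(i < n.+1) F i x) =
  int_cube (fun x => mixed (u k) x * F ord0 x) +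
  int_cube (fun x => mixed (u k) x * \sum_(i < n) F (lift ord0 i) x).
  rewrite -[X in X + _]mul1r -int_cube_lin; last 2 first.
  - exact: ucontM cube_compact _ _.
  - by apply: ucontM cube_compact _ _ => //; exact: ucont_sum.
  by congr int_cube; apply/funext => x; rewrite big_ord_recl; ring.
by rewrite (le_trans (ler_normD _ _))// [leRHS]splitr lerD.
Qed.

(** Integration by parts moves the mixed derivative to the product of the psi j; the result
only involves values of u n. *)
Let weak0_smooth (psi : 'I_m -> R -> R) : (forall j, smooth (psi j)) ->
  forall a : R, weak0 (fun x => a * \prod_(j <- all) psi j (x 0 j)).
Proof.
move=> spsi a.
have cpsi j := smooth_c1 (spsi j).
have upsi j : ucont cI (psi j) by case: (cpsi j).
pose L1 j := wint (psi j).
pose L2 j (g : R -> R) := (psi j 1 * dlt 1 g + - psi j 0 * dlt 0 g) + -1 * wint (derive1 (psi j)) g.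
have [C1 _ b1] : exists2 C, 1 <= C & forall j, bfun C (L1 j).
  apply: common_bound => j; have [K K0 HK] := ucont_bounded cI_compact (upsi j).
  by exists K; apply: bfun_wint => //; exact: ltW.
have [C2 C21 b2] : exists2 C, 1 <= C & forall j, bfun C (L2 j).
  apply: common_bound => j; have [_ upsi' _] := cpsi j.
  have [K K0 HK] := ucont_bounded cI_compact upsi'.
  eexists; apply: bfunDl (bfunDl (bfunZl _ (bfun_dlt cI1)) (bfunZl _ (bfun_dlt cI0)))
    (bfunZl _ (bfun_wint (ltW K0) upsi' HK)).
have C2m : 0 < C2 ^+ m by rewrite exprn_gt0//; lra.
have a1 : 0 < `|a| + 1 by rewrite ltr_wpDl.
move=> e e0; have [N HN] := u0 (divr_gt0 (divr_gt0 e0 a1) C2m).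
exists N => n /HN un.
have uw : ucont cube (fun x : 'rV[R]_m => \prod_(j <- all) psi j (x 0 j)) by exact: ucont_coord_prod.
have umw : ucont cube (fun x => mixed (u n) x * \prod_(j <- all) psi j (x 0 j)).
  exact: ucontM cube_compact _ _.
have -> : int_cube (fun x => mixed (u n) x * (a * \prod_(j <- all) psi j (x 0 j))) =
    a * tensor L2 all (u n) 0.
  rewrite -(@tensor_pdl _ _ C1 C2 L1 L2 all (u n) 0 b1 b2)//.
  - rewrite -(tensor_weight bfun_int _ (enum_uniq _) (ucont_mu n) cube0)//.
    rewrite -(tensorZ bfun_int _ _ umw cube0).
    by congr (tensor _ _ _ 0); apply/funext => x; ring.
  - move=> j _ p q cpq; rewrite /L1 /L2 /wint /dlt (by_parts (cpsi j) cpq).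
    by ring.
  - exact: enum_uniq.
  - exact: C0m_Ck.
  - exact: cube0.
have := tensor_bound b2 all (C0m_ucont (cu n)) un cube0; rewrite size_allI.
rewrite mulrCA divff ?gt_eqF// mulr1 => h.
rewrite normrM; apply: le_trans (_ : `|a| * (e / (`|a| + 1)) <= _).
  by rewrite ler_wpM2l.
by rewrite mulrCA ger_pMr// ler_pdivrMr// mul1r lerDl.
Qed.

(** Induction on the number of variables on which c depends: interpolating in the variable i
turns c into combinations of functions independent of i times smooth functions of x_i. *)
Let weak0_indep (t s : seq 'I_m) c (psi : 'I_m -> R -> R) : t ++ s = all ->
  ucont cube c -> (forall i, i \in s -> indep i c) -> (forall j, smooth (psi j)) ->
  weak0 (fun x => c x * \prod_(j <- s) psi j (x 0 j)).
Proof.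
elim/last_ind: t s c psi => [|t i IH] s c psi ts uc ci spsi.
  move: ts; rewrite cat0s => E; rewrite {s}E in ci *.
  move=> e e0; have [N HN] := weak0_smooth spsi (c 0) e0.
  exists N => n Nn; rewrite (@int_cube_eq _ _ _
    (fun x => mixed (u n) x * (c 0 * \prod_(j <- all) psi j (x 0 j)))) ?HN//.
    apply: ucontM cube_compact (ucont_mu n) _; apply: ucontM cube_compact uc _.
    by apply: ucont_coord_prod => j; case: (smooth_c1 (spsi j)).
  move=> x cx; congr (_ * (_ * _)); apply: (@indep_eq _ _ all) => //.
  - exact: cube0.
  - by move=> j; rewrite mem_all.
have upsi j : ucont cI (psi j) by case: (smooth_c1 (spsi j)).
have uprod := ucont_coord_prod s upsi.
apply: weak0_approx; first exact: ucontM cube_compact _ _.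
move=> e e0; have [K K0 HK] := ucont_bounded cube_compact uprod.
have [N HN] := separate_approx i uc (divr_gt0 e0 K0).
exists (fun x => separate N i c x * \prod_(j <- s) psi j (x 0 j)); split.
- by apply: ucontM cube_compact (ucont_separate N i uc) _.
- rewrite /separate; have is_ : i \notin s.
    have : uniq (t ++ i :: s) by rewrite -cat_rcons ts enum_uniq.
    by rewrite cat_uniq => /and3P[_ _ /=/andP[]].
  have -> : (fun x => (\sum_(k < N.+1) bump N k (x 0 i) * c (set_coord i (k%:R / N%:R) x)) *
      \prod_(j <- s) psi j (x 0 j)) = (fun x => \sum_(k < N.+1)
      (c (set_coord i (k%:R / N%:R) x) * \prod_(j <- i :: s) upd psi i (bump N k) j (x 0 j))).
    apply/funext => x; rewrite mulr_suml; apply: eq_bigr => k _.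
    rewrite big_cons /upd eqxx mulrA (mulrC (c _)); congr (_ * _).
    apply: eq_big_seq => j js; case: eqP => // ji; by rewrite -ji js in is_.
  have supd k : forall j, smooth (upd psi i (bump N k) j).
    by move=> j; rewrite /upd; case: eqP => _ //; exact: bump_smooth.
  apply: weak0_sum => k.
    apply: ucontM cube_compact (ucont_freeze i uc (grid_cI k)) _.
    by apply: ucont_coord_prod => j; have [] := smooth_c1 (supd k j).
  apply: IH => //.
  + by rewrite -ts cat_rcons.
  + exact: ucont_freeze (grid_cI k).
  + move=> j; rewrite inE => /predU1P[->|js] x v cx Iv; first by rewrite set_coord_set.
    have ij : i != j by apply: contraNneq is_ => ->.
    by rewrite set_coordC// ci//; exact/set_coord_cube/grid_cI.
- move=> x cx; rewrite -mulrBl normrM -[e](divfK (lt0r_neq0 K0)) distrC.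
  by rewrite ler_pM ?HN ?HK.
Qed.

(** Closability: in C_0^m a bounded sequence that tends to 0 uniformly tends to 0 weakly. This
is clear against products of smooth functions, whose combinations are dense. *)
Lemma int_mixed_cvg0 c : ucont cube c -> forall e : R, 0 < e ->
  exists N : nat, forall n, (N <= n)%N -> `|int_cube (fun x => mixed (u n) x * c x)| <= e.
Proof.
move=> uc e e0.
have uc1 : forall i, i \in [::] -> indep i c by [].
have [N HN] := weak0_indep (cats0 all) uc uc1 (fun j => @Ck1_id R) e0.
exists N => n /HN; congr (`|int_cube _| <= _); apply/funext => x.
by rewrite big_nil mulr1.
Qed.

End Closability.

(** * The Hilbert space H^m *)

Section Limits.
Context {R : realType}.
Implicit Types (u v : nat -> R) (l : R).

Lemma half_gt0 (e : R) : 0 < e -> 0 < e / 2.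
Proof. by move=> e0; rewrite divr_gt0. Qed.

Lemma cvgn_epsP u l : u n @[n --> \oo] --> l <-> forall e : R, 0 < e ->
  exists N : nat, forall n, (N <= n)%N -> `|l - u n| <= e.
Proof.
split=> [/cvgrPdist_le H e /H [N _ HN]|H]; first by exists N => n; exact: HN.
by apply/cvgrPdist_le => e /H[N HN]; exists N => // n; exact: HN.
Qed.

Lemma uniform_epsP (T : choiceType) (A : set T) (u : nat -> T -> R) (f : T -> R) :
  {uniform A, u @ \oo --> f} <-> forall e : R, 0 < e ->
  exists N : nat, forall n, (N <= n)%N -> forall x, A x -> `|f x - u n x| <= e.
Proof.
split=> [H e e0|H P].
  have /H : nbhs (f : {uniform` A -> R}) [set h | forall x, A x -> `|f x - h x| <= e].
    apply/uniform_nbhs; exists [set xy : R * R | `|xy.1 - xy.2| < e]; split.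
      by rewrite -entourage_ballE; exists e.
    by move=> h /= Hh x Ax; apply/ltW/Hh.
  by case=> N _ HN; exists N => n /HN.
move=> /uniform_nbhs[E [entE sE]].
move: entE; rewrite -entourage_ballE => -[e /= e0 eE].
have [N HN] := H (e / 2) (half_gt0 e0).
exists N => // n /HN h; apply: sE => x Ax; apply: eE; rewrite /ball/=.
by apply: le_lt_trans (h x Ax) _; rewrite ltr_pdivrMr// ltr_pMr// ltr1n.
Qed.

Lemma cauchy_epsP u : (forall e : R, 0 < e -> exists N : nat, forall p q,
  (N <= p)%N -> (N <= q)%N -> `|u p - u q| <= e) -> exists l, u n @[n --> \oo] --> l.
Proof.
move=> H; apply/cvg_ex/cauchy_cvgP/cauchy_exP => e e0.
have [N HN] := H (e / 2) (half_gt0 e0); exists (u N), N => // n Nn.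
apply: le_lt_trans (HN N n (leqnn _) Nn) _.
by rewrite ltr_pdivrMr// ltr_pMr// ltr1n.
Qed.

Lemma harmonic_small (C e : R) : 0 < e ->
  exists N : nat, forall n, (N <= n)%N -> C * n.+1%:R^-1 <= e.
Proof.
move=> r0; exists (Num.truncn (C / e)) => n Nn.
rewrite ler_pdivrMr ?ltr0n// mulrC -ler_pdivrMr//.
by apply/ltW/(lt_le_trans (truncnS_gt _)); rewrite ler_nat.
Qed.

(** The form in which estimates by the Cauchy-Schwarz inequality are used: one factor stays
bounded and the other one tends to 0. *)
Lemma sqr_small (B e : R) : 0 <= B -> 0 < e ->
  exists2 d : R, 0 < d & forall a b, 0 <= b <= d -> a ^+ 2 <= B * b -> `|a| <= e.
Proof.
move=> B0 e0; have B1 : 0 < B + 1 by lra.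
exists (e ^+ 2 / (B + 1)); first by rewrite divr_gt0// exprn_gt0.
move=> a b /andP[b0 bd] ab; rewrite -(@ler_pXn2r _ 2)// ?nnegrE ?normr_ge0 ?(ltW e0)//.
rewrite -normrX ger0_norm ?sqr_ge0//; apply: le_trans ab _.
move: bd; rewrite ler_pdivlMr// => bd; have := B0; nra.
Qed.

End Limits.

Section HSpace.
Context {R : realType} {m : nat}.
Implicit Types (x xi : 'rV[R]_m) (f g h : 'rV[R]_m -> R) (u v : nat -> 'rV[R]_m -> R).
Implicit Types (U : {set 'I_m}) (a : R).

Lemma normC2_lin_le a f g : C0m f -> C0m g ->
  normC2 (fun x => a * f x + g x) <= 2 * (a ^+ 2 * normC2 f + normC2 g).
Proof.
move=> cf cg; have := normC2_ge0 (C0m_lin (- a) cf cg).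
by rewrite !normC2_lin// sqrrN mulrN mulNr; lra.
Qed.

Lemma normC2_dist f g : C0m f -> C0m g ->
  (normC2 f - normC2 g) ^+ 2 <=
  (4 * (normC2 f + normC2 g)) * normC2 (fun x => f x - g x).
Proof.
move=> cf cg; have cB := C0mB cf cg; have cD := C0m_lin 1 cf cg.
have -> : normC2 f - normC2 g = dotC (fun x => f x - g x) (fun x => 1 * f x + g x).
  rewrite dotCB// (dotCC f) (dotCC g) !dotC_lin// (dotCC g f) /normC2; ring.
apply: le_trans (dotC_CS cB cD) _; rewrite mulrC ler_wpM2r ?normC2_ge0//.
apply: le_trans (normC2_lin_le 1 cf cg) _; rewrite expr1n mul1r.
by have := normC2_ge0 cf; have := normC2_ge0 cg; lra.
Qed.

Lemma approx_C0m u f n : Hm_approx u f -> C0m (u n).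
Proof. by case. Qed.

Lemma approx_bounded u f : Hm_approx u f -> exists (B : R) (N : nat), 0 <= B /\
  forall n, (N <= n)%N -> normC2 (u n) <= B.
Proof.
move=> [cu /(_ 1 ltr01)[N HN] _]; exists (2 * (1 + normC2 (u N))), N.
split; first by have := normC2_ge0 (cu N); lra.
move=> n Nn; have := normC2_lin_le 1 (C0mB (cu n) (cu N)) (cu N).
have -> : (fun x => 1 * (u n x - u N x) + u N x) = u n.
  by apply/funext => x; rewrite mul1r subrK.
rewrite expr1n mul1r; have := HN n N Nn (leqnn _); lra.
Qed.

Lemma approx_lin a u v f g : Hm_approx u f -> Hm_approx v g ->
  Hm_approx (fun n x => a * u n x + v n x) (fun x => a * f x + g x).
Proof.
move=> [cu Cu uf] [cv Cv vg]; split.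
- by move=> n; exact: C0m_lin.
- move=> e e0; pose d := e / (2 * (a ^+ 2 + 2)).
  have a2 := sqr_ge0 a.
  have d0 : 0 < d by rewrite divr_gt0//; lra.
  have [N1 H1] := Cu d d0; have [N2 H2] := Cv d d0.
  exists (maxn N1 N2) => p q; rewrite !geq_max => /andP[p1 p2] /andP[q1 q2].
  have -> : (fun x => a * u p x + v p x - (a * u q x + v q x)) =
      (fun x => a * (u p x - u q x) + (v p x - v q x)) by apply/funext => x; ring.
  apply: le_lt_trans (normC2_lin_le a (C0mB (cu p) (cu q)) (C0mB (cv p) (cv q))) _.
  have := H1 p q p1 q1; have := H2 p q p2 q2.
  have -> : e = d * (2 * (a ^+ 2 + 2)) by rewrite /d divfK//; lra.
  clearbody d; set X := normC2 _; set Y := normC2 _ => hX hY.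
  have Y0 : 0 <= Y by apply: normC2_ge0; exact: C0mB.
  nra.
- apply/uniform_epsP => e e0; have a1 : 0 < `|a| + 1 by rewrite ltr_wpDl.
  have [N1 H1] := (uniform_epsP _ _ _).1 uf _ (divr_gt0 (half_gt0 e0) a1).
  have [N2 H2] := (uniform_epsP _ _ _).1 vg _ (half_gt0 e0).
  exists (maxn N1 N2) => n; rewrite geq_max => /andP[n1 n2] x cx.
  have -> : a * f x + g x - (a * u n x + v n x) = a * (f x - u n x) + (g x - v n x) by ring.
  rewrite (le_trans (ler_normD _ _))// [leRHS]splitr lerD ?H2// normrM.
  apply: le_trans (_ : `|a| * (e / 2 / (`|a| + 1)) <= _); first by rewrite ler_wpM2l// H1.
  by rewrite mulrCA ger_pMr ?divr_gt0// ler_pdivrMr// mul1r lerDl.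
Qed.

Lemma approx_cst f : C0m f -> Hm_approx (fun=> f) f.
Proof.
move=> cf; split=> // [e e0|]; last first.
  by apply/uniform_epsP => e e0; exists 0%N => n _ x _; rewrite subrr normr0 ltW.
exists 0%N => p q _ _; suff -> : normC2 (fun x => f x - f x) = 0 by [].
by rewrite normC2B// /normC2; ring.
Qed.

Lemma approx_norm_cvg u f : Hm_approx u f -> exists l : R, normC2 (u n) @[n --> \oo] --> l.
Proof.
move=> A; have [B [N0 [B0 HB]]] := approx_bounded A; have [cu Cu _] := A.
apply: cauchy_epsP => e e0.
have B80 : 0 <= 8 * B by lra.
have [d d0 Hd] := sqr_small B80 e0.
have [N HN] := Cu d d0; exists (maxn N0 N) => p q; rewrite !geq_max => /andP[p1 p2] /andP[q1 q2].
apply: (Hd _ (normC2 (fun x => u p x - u q x))).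
  by rewrite (normC2_ge0 (C0mB (cu p) (cu q))) ltW// HN.
apply: le_trans (normC2_dist (cu p) (cu q)) _.
rewrite ler_wpM2r ?(normC2_ge0 (C0mB (cu p) (cu q)))//.
have := HB p p1; have := HB q q1; lra.
Qed.

(** A Cauchy sequence that tends weakly to 0 tends to 0 in norm: compare u n with a fixed
term u N. *)
Lemma approx_zero u : Hm_approx u (fun=> 0) -> normC2 (u n) @[n --> \oo] --> (0 : R).
Proof.
move=> A; have [B [N0 [B0 HB]]] := approx_bounded A; have [cu Cu u0] := A.
apply/cvgn_epsP => e e0; have e20 : 0 < e / 2 by rewrite divr_gt0.
have [d d0 Hd] := sqr_small B0 e20.
have [N HN] := Cu d d0.
have u00 : forall e : R, 0 < e -> exists N : nat, forall n, (N <= n)%N ->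
    forall x, cube x -> `|u n x| <= e.
  move=> r r0; have [K HK] := (uniform_epsP _ _ _).1 u0 r r0.
  by exists K => n Kn x cx; have := HK n Kn x cx; rewrite sub0r normrN.
have [N1 H1] := int_mixed_cvg0 cu HB u00 (ucont_mixed (cu N)) e20.
exists (maxn N1 (maxn N N0)) => n; rewrite !geq_max => /and3P[n1 n2 n3].
rewrite sub0r normrN.
have -> : normC2 (u n) = dotC (fun x => u n x - u N x) (u n) + dotC (u n) (u N).
  by rewrite dotCB// (dotCC (u N)) subrK.
rewrite (le_trans (ler_normD _ _))// [leRHS]splitr lerD//; last exact: H1.
apply: (Hd _ (normC2 (fun x => u n x - u N x))).
  by rewrite (normC2_ge0 (C0mB (cu n) (cu N))) ltW// HN.
apply: le_trans (dotC_CS (C0mB (cu n) (cu N)) (cu n)) _.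
by rewrite mulrC ler_wpM2r ?(normC2_ge0 (C0mB (cu n) (cu N)))// HB.
Qed.

(** The limit of the norms depends on f only, not on the approximating sequence; this is what
makes [normH2] meaningful. *)
Lemma approx_norm_uniq u v f (l l' : R) : Hm_approx u f -> Hm_approx v f ->
  normC2 (u n) @[n --> \oo] --> l -> normC2 (v n) @[n --> \oo] --> l' -> l = l'.
Proof.
move=> Au Av ul vl'.
have Aw : Hm_approx (fun n x => -1 * v n x + u n x) (fun=> 0).
  have := approx_lin (-1) Av Au; congr Hm_approx.
  by apply/funext => x; ring.
have w0 := approx_zero Aw.
have [B [N0 [B0 HB]]] := approx_bounded Au; have [B' [N0' [B0' HB']]] := approx_bounded Av.
have [cu _ _] := Au; have [cv _ _] := Av.
suff H : (normC2 (u n) - normC2 (v n)) @[n --> \oo] --> (0 : R).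
  apply/eqP; rewrite -subr_eq0; apply/eqP; apply: cvg_unique (cvgB ul vl') H => //.
apply/cvgn_epsP => e e0.
have BB : 0 <= 4 * (B + B') by lra.
have [d d0 Hd] := sqr_small BB e0.
have [N HN] := (cvgn_epsP _ _).1 w0 d d0.
exists (maxn N (maxn N0 N0')) => n; rewrite !geq_max => /and3P[n1 n2 n3].
rewrite sub0r normrN; apply: (Hd _ (normC2 (fun x => u n x - v n x))).
  rewrite (normC2_ge0 (C0mB (cu n) (cv n)))/=.
  have := HN n n1; rewrite sub0r normrN => /(le_trans (ler_norm _)).
  by congr (normC2 _ <= _); apply/funext => x; ring.
apply: le_trans (normC2_dist (cu n) (cv n)) _.
rewrite ler_wpM2r ?(normC2_ge0 (C0mB (cu n) (cv n)))//.
have := HB n n2; have := HB' n n3; lra.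
Qed.

Lemma approx_normH2 u f : Hm_approx u f -> normC2 (u n) @[n --> \oo] --> normH2 f.
Proof.
move=> Au; have [l ul] := approx_norm_cvg Au.
have [v [Av vl]] : [set r | exists u, Hm_approx u f /\ (normC2 (u n) @[n --> \oo] --> r)] (normH2 f).
  by apply: xgetPex; exists l, u.
by rewrite -(approx_norm_uniq Au Av ul vl).
Qed.

Lemma Hm_lin a f g : Hm f -> Hm g -> Hm (fun x => a * f x + g x).
Proof.
move=> [u Au] [v Av]; exists (fun n x => a * u n x + v n x).
exact: approx_lin.
Qed.

Lemma HmB f g : Hm f -> Hm g -> Hm (fun x => f x - g x).
Proof.
move=> Hf Hg; have := Hm_lin (-1) Hg Hf; congr Hm.
by apply/funext => x; ring.
Qed.

Lemma C0m_Hm f : C0m f -> Hm f.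
Proof. by move=> cf; exists (fun=> f); exact: approx_cst. Qed.

Lemma normH2_C0m f : C0m f -> normH2 f = normC2 f.
Proof.
move=> cf; have := approx_normH2 (approx_cst cf) => /cvg_lim <- //.
exact: lim_cst.
Qed.

(** The scalar product of H^m, by polarisation. *)
Definition dotH f g : R := (normH2 (fun x => 1 * f x + g x) - normH2 f - normH2 g) / 2.

Lemma approx_dotH u v f g : Hm_approx u f -> Hm_approx v g ->
  dotC (u n) (v n) @[n --> \oo] --> dotH f g.
Proof.
move=> Au Av; have [cu _ _] := Au; have [cv _ _] := Av.
have -> : (fun n => dotC (u n) (v n)) = (fun n =>
    (normC2 (fun x => 1 * u n x + v n x) - normC2 (u n) - normC2 (v n)) / 2).
  by apply/funext => n; rewrite normC2_lin//; field.
apply: cvgM; last exact: cvg_cst.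
apply: cvgB; last exact: approx_normH2.
apply: cvgB; last exact: approx_normH2.
exact: approx_normH2 (approx_lin 1 Au Av).
Qed.

Lemma dotH_lin a f g h : Hm f -> Hm g -> Hm h ->
  dotH (fun x => a * f x + g x) h = a * dotH f h + dotH g h.
Proof.
move=> [u Au] [v Av] [w Aw]; have [cu _ _] := Au; have [cv _ _] := Av; have [cw _ _] := Aw.
apply: cvg_unique (approx_dotH (approx_lin a Au Av) Aw) _ => //.
have -> : (fun n => dotC (fun x => a * u n x + v n x) (w n)) =
    (fun n => a * dotC (u n) (w n) + dotC (v n) (w n)).
  by apply/funext => n; rewrite dotC_lin.
by apply: cvgD; [apply: cvgM; [exact: cvg_cst|exact: approx_dotH]|exact: approx_dotH].
Qed.

Lemma dotHC f g : dotH f g = dotH g f.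
Proof.
rewrite /dotH [LHS]mulrC [RHS]mulrC; congr (_ * _); rewrite addrAC; congr (_ - _ - _).
by congr normH2; apply/funext => x; rewrite !mul1r addrC.
Qed.

Lemma normH2_lin a f g : Hm f -> Hm g ->
  normH2 (fun x => a * f x + g x) = a ^+ 2 * normH2 f + 2 * a * dotH f g + normH2 g.
Proof.
move=> [u Au] [v Av]; have [cu _ _] := Au; have [cv _ _] := Av.
apply: cvg_unique (approx_normH2 (approx_lin a Au Av)) _ => //.
have -> : (fun n => normC2 (fun x => a * u n x + v n x)) = (fun n =>
    a ^+ 2 * normC2 (u n) + 2 * a * dotC (u n) (v n) + normC2 (v n)).
  by apply/funext => n; rewrite normC2_lin.
apply: cvgD; last exact: approx_normH2.
apply: cvgD; (apply: cvgM; first exact: cvg_cst); [exact: approx_normH2|exact: approx_dotH].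
Qed.

Lemma dotHH f : Hm f -> dotH f f = normH2 f.
Proof.
move=> [u Au]; apply: cvg_unique (approx_dotH Au Au) _ => //.
exact: approx_normH2 Au.
Qed.

Lemma normH2_ge0 f : Hm f -> 0 <= normH2 f.
Proof.
move=> [u Au]; have [cu _ _] := Au.
have /cvg_lim <- // := approx_normH2 Au; apply: limr_ge.
  by apply/cvg_ex; exists (normH2 f); exact: approx_normH2.
by apply: nearW => n; exact: normC2_ge0.
Qed.

Lemma normH2B f g : Hm f -> Hm g ->
  normH2 (fun x => f x - g x) = normH2 f - 2 * dotH f g + normH2 g.
Proof.
move=> Hf Hg; have -> : (fun x => f x - g x) = (fun x => (-1) * g x + f x).
  by apply/funext => x; ring.
by rewrite normH2_lin// dotHC; ring.
Qed.

Lemma dotH_CS f g : Hm f -> Hm g -> dotH f g ^+ 2 <= normH2 f * normH2 g.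
Proof.
move=> [u Au] [v Av]; have [cu _ _] := Au; have [cv _ _] := Av.
have h1 : dotC (u n) (v n) ^+ 2 @[n --> \oo] --> dotH f g ^+ 2.
  by rewrite expr2; under eq_fun do rewrite expr2; apply: cvgM; exact: approx_dotH.
have h2 : normC2 (u n) * normC2 (v n) @[n --> \oo] --> normH2 f * normH2 g.
  by apply: cvgM; exact: approx_normH2.
rewrite -(cvg_lim _ h1)// -(cvg_lim _ h2)//; apply: ler_lim.
- by apply/cvg_ex; eexists; exact: h1.
- by apply/cvg_ex; eexists; exact: h2.
- by apply: nearW => n; exact: dotC_CS.
Qed.

Lemma approx_normH2_cvg0 u f : Hm_approx u f -> forall e : R, 0 < e ->
  exists N : nat, forall n, (N <= n)%N -> normH2 (fun x => f x - u n x) <= e.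
Proof.
move=> Au e e0; have [cu Cu _] := Au; have [N HN] := Cu e e0.
exists N => n Nn.
have := approx_normH2 (approx_lin (-1) (approx_cst (cu n)) Au).
have -> : (fun x => -1 * u n x + f x) = (fun x => f x - u n x).
  by apply/funext => x; ring.
move=> H; rewrite -(cvg_lim _ H)//; apply: limr_le; first by apply/cvg_ex; eexists; exact: H.
exists N => // k Nk /=; have -> : (fun x => -1 * u n x + u k x) = (fun x => u k x - u n x).
  by apply/funext => x; ring.
by apply/ltW/HN.
Qed.

(** ** The reproducing kernels *)

(** The squared norm of the difference w of two terms is the difference of their pairings with
w, and both are close to the same value [face_eval U xi w]; this gives the Cauchy property. *)
Lemma approx_kfac U xi : cube xi ->
  Hm_approx (fun n => tens (kfac_approx n.+1%:R^-1 U xi)) (tens (kfac U xi)).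
Proof.
move=> cxi; have e0 n : 0 < n.+1%:R^-1 :> R by rewrite invr_gt0 ltr0n.
have cn n := C0m_kfac_approx U (e0 n) cxi.
split=> // [e e_0|].
  have [K K1 HK] := @dkfac_bound R m; have [A A0 HA] := @dotC_kfac_approx R m.
  pose M := 2 * K ^+ m.
  have M0 : 0 <= M by rewrite mulr_ge0// exprn_ge0//; lra.
  have AM : 0 <= A * M by exact: mulr_ge0.
  have e30 : 0 < e / 3 by lra.
  have [N HN] := harmonic_small (A * M) e30.
  exists N => p q Np Nq; set w := fun x => _.
  have cw : C0m w by exact: C0mB.
  have wM : bounded_by cube M (mixed w).
    move=> x cx; rewrite /w mixedB// (le_trans (ler_normB _ _))// /M mulr_natl mulr2n.
    by rewrite lerD// (mixed_kfac_bound _ cxi)//= => j t; exact: HK.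
  have Dp := HA U xi _ M w cxi (e0 p) cw wM; have Dq := HA U xi _ M w cxi (e0 q) cw wM.
  have hp := HN p Np; have hq := HN q Nq.
  have -> : normC2 w = (dotC w (tens (kfac_approx p.+1%:R^-1 U xi)) - face_eval U xi w) -
      (dotC w (tens (kfac_approx q.+1%:R^-1 U xi)) - face_eval U xi w).
    by rewrite /normC2 [in LHS]/w dotCB// !(dotCC _ w); ring.
  apply: le_lt_trans (ler_norm _) _; apply: le_lt_trans (ler_normB _ _) _.
  rewrite mulrAC in hp; rewrite mulrAC in hq.
  have := le_trans Dp hp; have := le_trans Dq hq; lra.
apply/uniform_epsP => e e_0; have [N HN] := harmonic_small m%:R e_0.
by exists N => n /HN h x cx; apply: le_trans h; exact: kfac_uniform.
Qed.

Lemma Hm_kfac U xi : cube xi -> Hm (tens (kfac U xi)).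
Proof. by move=> cxi; eexists; exact: approx_kfac. Qed.

Lemma Hm_uniform_pt u f x : Hm_approx u f -> cube x -> u n x @[n --> \oo] --> f x.
Proof.
move=> [_ _ /uniform_epsP H] cx; apply/cvgn_epsP => e /H[N HN].
by exists N => n /HN; exact.
Qed.

(** The case of smooth f passes to the limit, both sides being continuous in f. *)
Lemma dotH_kfac U xi f : cube xi -> Hm f -> dotH f (tens (kfac U xi)) = face_eval U xi f.
Proof.
move=> cxi; have Ak := approx_kfac U cxi; have Hk := Hm_kfac U cxi.
have smooth_case g : C0m g -> dotH g (tens (kfac U xi)) = face_eval U xi g.
  move=> cg; apply: cvg_unique (approx_dotH (approx_cst cg) Ak) _ => //.
  have [A A0 HA] := @dotC_kfac_approx R m.
  have [M M0 HM] := ucont_bounded cube_compact (ucont_mixed cg).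
  apply/cvgn_epsP => e e0; have [N HN] := harmonic_small (A * M) e0.
  exists N => n Nn; rewrite distrC.
  apply: le_trans (HA U xi _ M g cxi _ cg HM) _; first by rewrite invr_gt0 ltr0n.
  by have := HN n Nn; rewrite mulrAC.
move=> Hf; have [u Au] := Hf; have [cu _ _] := Au.
have h1 : dotH (u n) (tens (kfac U xi)) @[n --> \oo] --> face_eval U xi f.
  under eq_fun do rewrite smooth_case//.
  apply: cvgM; first exact: cvg_cst.
  exact: Hm_uniform_pt Au (on_face_cube U cxi).
apply/esym; apply: cvg_unique h1 _ => //.
apply/cvgn_epsP => e e0.
have [d d0 Hd] := sqr_small (normH2_ge0 Hk) e0.
have [N HN] := approx_normH2_cvg0 Au d0; exists N => n Nn.
have Hu := C0m_Hm (cu n); have HB := HmB Hf Hu.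
have -> : dotH f (tens (kfac U xi)) - dotH (u n) (tens (kfac U xi)) =
    dotH (fun x => f x - u n x) (tens (kfac U xi)).
  have -> : (fun x => f x - u n x) = (fun x => -1 * u n x + f x).
    by apply/funext => x; ring.
  by rewrite dotH_lin//; ring.
apply: (Hd _ (normH2 (fun x => f x - u n x))); first by rewrite normH2_ge0//= HN.
by rewrite mulrC; exact: dotH_CS.
Qed.

Lemma face_eval0 xi f : face_eval finset.set0 xi f = f xi.
Proof.
rewrite /face_eval big_set0 mul1r; congr f.
by apply/rowP => j; rewrite mxE inE.
Qed.

Lemma normH2_kfac_le1 xi : cube xi -> normH2 (tens (kfac finset.set0 xi)) <= 1.
Proof.
move=> cxi; have Hk := Hm_kfac finset.set0 cxi.
rewrite -dotHH// dotH_kfac// face_eval0 /tens; apply: (@le_trans _ _ (\prod_(j < m) (1 : R))); last by rewrite big1_eq.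
by apply: ler_prod => j _; rewrite /kfac inE minxx; exact: cxi.
Qed.

(** Reproduction at x and the Cauchy-Schwarz inequality, the kernel having norm at most 1. *)
Lemma Hm_sup f x : Hm f -> cube x -> f x ^+ 2 <= normH2 f.
Proof.
move=> Hf cx; rewrite -face_eval0 -dotH_kfac//.
apply: le_trans (dotH_CS Hf (Hm_kfac _ cx)) _.
by rewrite ler_piMr// ?normH2_kfac_le1//; exact: normH2_ge0.
Qed.

Lemma Hm_ext f g : (forall x, cube x -> f x = g x) -> Hm f -> Hm g.
Proof.
move=> fg [u [cu Cu uf]]; exists u; split=> //.
apply/uniform_epsP => e e0; have [N HN] := (uniform_epsP _ _ _).1 uf e e0.
by exists N => n /HN h x cx; rewrite -fg//; exact: h.
Qed.

Lemma normH2_ext f g : (forall x, cube x -> f x = g x) -> Hm f -> normH2 f = normH2 g.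
Proof.
move=> fg [u Au]; have Ag : Hm_approx u g.
  have [cu Cu uf] := Au; split=> //; apply/uniform_epsP => e e0.
  have [N HN] := (uniform_epsP _ _ _).1 uf e e0.
  by exists N => n /HN h x cx; rewrite -fg//; exact: h.
by apply: cvg_unique (approx_normH2 Au) (approx_normH2 Ag).
Qed.

Lemma Hm_ucont f : Hm f -> ucont cube f.
Proof.
move=> [u [cu _ /uniform_epsP uf]]; apply: (@ucont_lim _ _ _ u) => [n|e e0].
  exact: C0m_ucont.
have [N HN] := uf _ (half_gt0 e0).
exists N => x cx; apply: le_lt_trans (HN N (leqnn _) x cx) _.
by rewrite ltr_pdivrMr// ltr_pMr// ltr1n.
Qed.

Lemma Hm_zero f x j : Hm f -> cube x -> x 0 j = 0 -> f x = 0.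
Proof.
move=> [u Au] cx xj; have [cu _ _] := Au.
apply: cvg_unique (Hm_uniform_pt Au cx) _ => //.
rewrite (_ : (fun n => _) = fun=> 0); first exact: cvg_cst.
by apply/funext => n; have [_ h] := cu n; exact: h xj.
Qed.

(** Each F n is replaced by a close element of C_0^m. The resulting sequence is Cauchy in norm,
hence uniformly, and its uniform limit is the limit of F. *)
Lemma Hm_complete (F : nat -> 'rV[R]_m -> R) : (forall n, Hm (F n)) ->
  (forall e : R, 0 < e -> exists N : nat, forall p q, (N <= p)%N -> (N <= q)%N ->
    normH2 (fun x => F p x - F q x) <= e) ->
  exists2 f, Hm f & forall e : R, 0 < e -> exists N : nat, forall n, (N <= n)%N ->
    normH2 (fun x => f x - F n x) <= e.
Proof.
move=> HF CF.
have par f g h : Hm f -> Hm g -> Hm h -> normH2 (fun x => f x - h x) <=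
    2 * (normH2 (fun x => f x - g x) + normH2 (fun x => g x - h x)).
  move=> Hf Hg Hh; have H1 := HmB Hf Hg; have H2 := HmB Hg Hh.
  have -> : (fun x => f x - h x) = (fun x => 1 * (f x - g x) + (g x - h x)).
    by apply/funext => x; ring.
  have := normH2_ge0 (Hm_lin (-1) H1 H2); rewrite !normH2_lin//.
  set A := normH2 _; set B := normH2 (fun x => g x - h x); set D := dotH _ _; lra.
have sym f g : Hm f -> Hm g -> normH2 (fun x => f x - g x) = normH2 (fun x => g x - f x).
  by move=> Hf Hg; rewrite !normH2B// (dotHC g f); ring.
have inv0 n : 0 < n.+1%:R^-1 :> R by rewrite invr_gt0 ltr0n.
have /choice[w Hw] : forall n, exists w, C0m w /\ normH2 (fun x => F n x - w x) <= n.+1%:R^-1.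
  move=> n; have [u Au] := HF n; have [N HN] := approx_normH2_cvg0 Au (inv0 n).
  by exists (u N); split; [exact: approx_C0m Au|exact: HN].
have cw n : C0m (w n) by case: (Hw n).
have HwH n := C0m_Hm (cw n).
have Fw n : normH2 (fun x => F n x - w n x) <= n.+1%:R^-1 by case: (Hw n).
have small (e : R) : 0 < e -> exists N : nat, forall n, (N <= n)%N -> n.+1%:R^-1 <= e.
  by move=> /(harmonic_small 1)[N HN]; exists N => n /HN; rewrite mul1r.
have Cw (e : R) : 0 < e -> exists N : nat, forall p q, (N <= p)%N -> (N <= q)%N ->
    normH2 (fun x => w p x - w q x) <= e.
  move=> e0; have e10 : 0 < e / 10 by lra.
  have [N1 H1] := CF _ e10; have [N2 H2] := small _ e10.
  exists (maxn N1 N2) => p q; rewrite !geq_max => /andP[p1 p2] /andP[q1 q2].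
  have := par _ _ _ (HwH p) (HF p) (HwH q); have := par _ _ _ (HF p) (HF q) (HwH q).
  rewrite (sym (w p) (F p)); [|exact: HwH|exact: HF].
  have := H1 p q p1 q1; have := le_trans (Fw p) (H2 p p2); have := le_trans (Fw q) (H2 q q2); lra.
have Cx (e : R) : 0 < e -> exists N : nat, forall p q, (N <= p)%N -> (N <= q)%N ->
    forall x, cube x -> `|w p x - w q x| <= e.
  move=> e0; have [N HN] := Cw _ (exprn_gt0 2 e0).
  exists N => p q Np Nq x cx.
  rewrite -(@ler_pXn2r _ 2)// ?nnegrE ?normr_ge0 ?(ltW e0)//.
  rewrite -normrX ger0_norm ?sqr_ge0//; apply: le_trans (HN p q Np Nq).
  exact: (Hm_sup (HmB (HwH p) (HwH q)) cx).
have /choice[f Hf] : forall x, exists l : R, cube x -> w n x @[n --> \oo] --> l.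
  move=> x; have [cx|ncx] := pselect (cube x); last by exists 0.
  have [l Hl] : exists l : R, w n x @[n --> \oo] --> l.
    apply: cauchy_epsP => e /Cx[N HN]; exists N => p q Np Nq; exact: HN.
  by exists l.
have Aw : Hm_approx w f.
  split=> // [e e0|].
    have [N HN] := Cw _ (half_gt0 e0); exists N => p q Np Nq.
    rewrite -normH2_C0m; last exact: C0mB.
    by apply: le_lt_trans (HN p q Np Nq) _; rewrite ltr_pdivrMr// ltr_pMr// ltr1n.
  apply/uniform_epsP => e e0; have [N HN] := Cx _ (half_gt0 e0); exists N => n Nn x cx.
  have [N' HN'] := (cvgn_epsP _ _).1 (Hf x cx) _ (half_gt0 e0).
  have h1 := HN' _ (leq_maxr N N'); have h2 := HN _ _ (leq_maxl N N') Nn x cx.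
  rewrite -(subrKA (w (maxn N N') x)) (le_trans (ler_normD _ _))//; lra.
exists f; first by exists w.
move=> e e0; have e40 : 0 < e / 4 by lra.
have [N1 H1] := approx_normH2_cvg0 Aw e40; have [N2 H2] := small _ e40.
exists (maxn N1 N2) => n; rewrite geq_max => /andP[n1 n2].
have HfH : Hm f by exists w.
have := par _ _ _ HfH (HwH n) (HF n); rewrite (sym (w n) (F n)); [|exact: HwH|exact: HF].
have := H1 n n1; have := le_trans (Fw n) (H2 n n2); lra.
Qed.

End HSpace.

(** * The kernel of the constrained subspace *)

Section GreenKernel.
Context {R : realType} {m : nat}.
Variables (MM : {set {set 'I_m}}) (a : {set 'I_m} -> R).
Hypothesis hup : upward_closed MM.
Hypothesis ha : green_coefs MM a.
Implicit Types (x xi : 'rV[R]_m) (f g : 'rV[R]_m -> R) (U V W : {set 'I_m}).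
Local Notation G := (green_kernel MM a).

Lemma green_kernelE x xi : G x xi = tens (kfac finset.set0 xi) x -
  \sum_(U in MM) a U * tens (kfac U xi) x.
Proof.
rewrite /green_kernel tens_kfac finset.setC0 /kprod big_set0 mulr1; congr (_ - _).
by apply: eq_bigr => U _; rewrite tens_kfac.
Qed.

Lemma green_kernelC x xi : G x xi = G xi x.
Proof.
have E U : tens (kfac U xi) x = tens (kfac U x) xi.
  apply: eq_bigr => j _; rewrite /kfac; case: ifP => _; first exact: mulrC.
  by rewrite minC.
by rewrite !green_kernelE E; congr (_ - _); apply: eq_bigr => U _; rewrite E.
Qed.

(** On the face x_V = 1 the terms of all U with the same union U :|: V = W coincide. Their
coefficients cancel unless W = V, by induction on W: the relation defining the coefficients
at W is the sum of those identities over the sets between V and W. *)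
Lemma green_coefs_face V W : V \in MM -> V \subset W ->
  \sum_(U in MM | U :|: V == W) a U = (W == V)%:R.
Proof.
move=> VM; have [n] := ubnP #|W|; elim: n W => // n IH W /ltnSE Wn VW.
have WM : W \in MM by exact: hup VW VM.
have E : \sum_(W' : {set 'I_m} | (V \subset W') && (W' \subset W))
    \sum_(U in MM | U :|: V == W') a U = 1.
  rewrite -(ha WM) [RHS](partition_big (fun U => U :|: V)
    (fun W' => (V \subset W') && (W' \subset W)))/=; last first.
    by move=> U /andP[_ UW]; rewrite finset.subsetUr finset.subUset UW VW.
  apply: eq_bigr => W' /andP[_ W'W]; apply: eq_bigl => U.
  case: (U \in MM) => //=; case: eqP => [UW|]; rewrite ?andbF ?andbT//.
  by apply/esym/(fintype.subset_trans _ W'W); rewrite -UW finset.subsetUl.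
rewrite (bigD1 W) ?VW ?fintype.subxx//= in E.
have [WV|WV] := eqVneq W V.
  transitivity (1 : R) => //; rewrite -[RHS]E [X in _ = _ + X]big1 ?addr0//.
  by move=> W' /andP[/andP[h1 h2]]; rewrite WV finset.eqEsubset -{1}WV h1 h2.
move: E; rewrite [X in _ + X = _](bigD1 V)/= ?fintype.subxx ?VW 1?eq_sym//.
have small W' : W' \subset W -> W' != W -> (#|W'| < n)%N.
  move=> h1 h2; apply: leq_trans Wn; apply: proper_card.
  by rewrite finset.properEneq h1 h2.
rewrite (IH V) ?eqxx ?small// 1?eq_sym// [X in _ + (_ + X)]big1 => [|W' /andP[/andP[/andP[h1 h2] h3] h4]].
  by rewrite addr0 => E; apply: (addIr 1); rewrite add0r.
by rewrite IH ?(negPf h4) ?small.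
Qed.

Lemma green_zero_on_face xi V : cube xi -> V \in MM -> zero_on_face (fun x => G x xi) V.
Proof.
move=> cxi VM x cx xV.
have E U : tens (kfac U xi) x = tens (kfac (U :|: V) xi) x.
  apply: eq_bigr => j _; rewrite /kfac inE; case jU : (j \in U) => //=.
  case jV : (j \in V) => //; rewrite xV// mulr1 min_r//.
  by have /andP[] := cxi j.
rewrite green_kernelE E finset.set0U; apply/eqP; rewrite subr_eq0; apply/eqP.
under eq_bigr do rewrite E.
rewrite (partition_big (fun U => U :|: V) (fun W => V \subset W))/=; last first.
  by move=> U _; exact: finset.subsetUr.
rewrite (bigD1 V)//= [X in _ + X]big1 ?addr0.
  rewrite -[LHS]mul1r -(_ : \sum_(U in MM | U :|: V == V) a U = 1); last first.
    by rewrite green_coefs_face ?eqxx.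
  by rewrite mulr_suml; apply: eq_bigr => U /andP[_ /eqP ->].
move=> W /andP[VW WV].
rewrite (eq_bigr (fun U => a U * tens (kfac W xi) x)) => [|U /andP[_ /eqP ->]//].
by rewrite -mulr_suml green_coefs_face// (negPf WV) mul0r.
Qed.

Definition HMM f := Hm f /\ forall U, U \in MM -> zero_on_face f U.

Lemma Hm_sum (I : Type) (r : seq I) (P : pred I) (F : I -> 'rV[R]_m -> R) g :
  Hm g -> (forall i, P i -> Hm (F i)) -> Hm (fun x => \sum_(i <- r | P i) F i x + g x).
Proof.
move=> Hg HF; elim: r => [|i r IH].
  by apply: Hm_ext Hg => x _; rewrite big_nil add0r.
case Pi : (P i).
  apply: Hm_ext (Hm_lin 1 (HF i Pi) IH) => x _.
  by rewrite big_cons Pi mul1r addrA.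
by apply: Hm_ext IH => x _; rewrite big_cons Pi.
Qed.

Lemma dotH_sum (I : Type) (r : seq I) (P : pred I) (F : I -> 'rV[R]_m -> R) g f :
  Hm f -> Hm g -> (forall i, P i -> Hm (F i)) ->
  dotH (fun x => \sum_(i <- r | P i) F i x + g x) f =
  \sum_(i <- r | P i) dotH (F i) f + dotH g f.
Proof.
move=> Hf Hg HF; elim: r => [|i r IH].
  by rewrite big_nil add0r; congr dotH; apply/funext => x; rewrite big_nil add0r.
rewrite big_cons; case Pi : (P i).
  rewrite -addrA -IH -[dotH (F i) f]mul1r -dotH_lin//; [|exact: HF|exact: Hm_sum].
  by congr dotH; apply/funext => x; rewrite big_cons Pi mul1r addrA.
by rewrite -IH; congr dotH; apply/funext => x; rewrite big_cons Pi.
Qed.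

Lemma green_kernelE' xi : (fun x => G x xi) =
  (fun x => \sum_(U in MM) (- a U * tens (kfac U xi) x + 0) + tens (kfac finset.set0 xi) x).
Proof.
apply/funext => x; rewrite green_kernelE addrC -sumrN; congr (_ + _).
by apply: eq_bigr => U _; rewrite mulNr addr0.
Qed.

Lemma Hm_zero_fun : Hm (fun _ : 'rV[R]_m => 0 : R).
Proof.
have H := Hm_kfac finset.set0 (@cube0 R m).
by apply: Hm_ext (HmB H H) => x _; exact: subrr.
Qed.

Lemma Hm_green xi : cube xi -> Hm (fun x => G x xi).
Proof.
move=> cxi; rewrite green_kernelE'; apply: Hm_sum; first exact: Hm_kfac.
by move=> U _; apply: Hm_lin Hm_zero_fun; exact: Hm_kfac.
Qed.

Lemma HMM_green xi : cube xi -> HMM (fun x => G x xi).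
Proof. by move=> cxi; split; [exact: Hm_green|move=> U; exact: green_zero_on_face]. Qed.

(** On the constrained subspace the functionals represented by the correction terms, which are
multiples of values on faces x_U = 1 with U in MM, vanish. *)
Lemma green_reproducing xi f : cube xi -> HMM f -> dotH f (fun x => G x xi) = f xi.
Proof.
move=> cxi [Hf f0]; rewrite dotHC green_kernelE' dotH_sum//.
- rewrite big1 ?add0r; first by rewrite dotHC dotH_kfac// face_eval0.
  move=> U UM; rewrite dotH_lin//; [|exact: Hm_kfac|exact: Hm_zero_fun].
  have z : dotH (fun=> 0) f = 0.
    rewrite (_ : (fun=> 0) = fun x => -1 * f x + f x).
      by rewrite dotH_lin//; ring.
    by apply/funext => x; ring.
  rewrite z addr0 dotHC dotH_kfac// /face_eval (f0 U)// ?mulr0//.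
    exact: on_face_cube.
  by move=> i iU; rewrite mxE iU.
- exact: Hm_kfac.
- by move=> U _; apply: Hm_lin Hm_zero_fun; exact: Hm_kfac.
Qed.

Lemma green_bounded : exists2 K : R, 0 <= K & forall x xi, cube x -> cube xi -> `|G x xi| <= K.
Proof.
exists (1 + \sum_(U in MM) `|a U|); first by rewrite addr_ge0// sumr_ge0.
move=> x xi cx cxi; have k1 U : `|tens (kfac U xi) x| <= 1.
  rewrite /tens normr_prod; apply: (@le_trans _ _ (\prod_(j < m) (1 : R))); last by rewrite big1_eq.
  apply: ler_prod => j _; rewrite normr_ge0/= /kfac.
  have /andP[x0 x1] := cx j; have /andP[h0 h1] := cxi j; case: ifP => _.
    by rewrite ger0_norm ?mulr_ge0// mulr_ile1.
  by rewrite ger0_norm ?le_min ?x0// ge_min x1.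
rewrite green_kernelE (le_trans (ler_normB _ _))// lerD ?k1//.
rewrite (le_trans (ler_norm_sum _ _ _))//; apply: ler_sum => U _.
by rewrite normrM ler_piMr.
Qed.

End GreenKernel.

(** * Integration with respect to the measure *)

Section Measure.
Context {R : realType} {m : nat}.
Variable (mu : {finite_measure set (borelRn R m) -> \bar R}).
Local Notation I := (cube : set (borelRn R m)).
Implicit Types (f g : 'rV[R]_m -> R).

Lemma measurable_open (A : set (borelRn R m)) : open (A : set 'rV[R]_m) -> measurable A.
Proof. by move=> oA; apply: sub_sigma_algebra. Qed.

Lemma measurable_cube : measurable I.
Proof.
rewrite -[X in measurable X]setCK; apply: measurableC; apply: measurable_open.
by apply: closed_openC; apply: compact_closed cube_compact; exact: norm_hausdorff.
Qed.

Lemma ucont_measurable f : ucont cube f -> measurable_fun I (f : borelRn R m -> R).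
Proof.
move=> /(ucontP _ cube_compact)/continuousP cf _.
apply: (measurability _ (RGenOpens.measurableE R)); last exact: measurable_cube.
move=> _ [_ [a [b ->] <-]].
have oI : open [set` `]a, b[] by exact: interval_open.
have [V oV VE] := (@open_subspaceP _ cube _).1 (cf _ oI).
rewrite setIC -VE; apply: measurableI measurable_cube; exact: measurable_open.
Qed.

Lemma finite_cube : (mu I < +oo)%E.
Proof. by rewrite ltey_eq fin_num_measure//; exact: measurable_cube. Qed.

Lemma ucont_mu_integrable f : ucont cube f -> mu.-integrable I (EFin \o f).
Proof.
move=> uf; apply: measurable_bounded_integrable measurable_cube finite_cube _ _.
  exact: ucont_measurable.
have [K K0 HK] := ucont_bounded cube_compact uf.
exists K; split; first exact: num_real.
by move=> M KM x cx; apply: le_trans (HK x cx) _; exact: ltW.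
Qed.

Definition Imu f : R := \int[mu]_(x in I) f x.

Lemma Imu_lin (c : R) f g : ucont cube f -> ucont cube g ->
  Imu (fun x => c * f x + g x) = c * Imu f + Imu g.
Proof.
move=> uf ug; rewrite /Imu RintegralD//.
- by rewrite RintegralZl//; [exact: measurable_cube|exact: ucont_mu_integrable].
- exact: measurable_cube.
- exact: (ucont_mu_integrable (ucontZ c uf)).
- exact: ucont_mu_integrable.
Qed.

Lemma Imu_eq f g : (forall x, cube x -> f x = g x) -> Imu f = Imu g.
Proof. by move=> fg; apply: eq_Rintegral => x; rewrite inE; exact: fg. Qed.

Lemma Imu_bound K f : ucont cube f -> bounded_by cube K f ->
  `|Imu f| <= K * fine (mu I).
Proof.
move=> uf fK.
apply: le_trans (le_normr_Rintegral _ _) _; [exact: measurable_cube|exact: ucont_mu_integrable|].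
rewrite -Rintegral_cst; last exact: measurable_cube.
apply: le_Rintegral; [exact: measurable_cube| | |].
- apply: (ucont_mu_integrable (f := fun x => `|f x|)) => e /uf[d d0 Hd].
  exists d => // x y cx cy xy; apply: le_lt_trans (Hd x y cx cy xy).
  exact: ler_dist_dist.
- exact: (ucont_mu_integrable (f := fun=> K) (@ucont_cst _ _ _ _)).
- by move=> x cx; exact: fK.
Qed.

Lemma measurable_coord j : measurable_fun setT (fun x : borelRn R m => (x : 'rV[R]_m) 0 j).
Proof.
move=> _; apply: (measurability _ (RGenOpens.measurableE R)); last exact: measurableT.
move=> _ [_ [a [b ->] <-]]; rewrite setTI; apply: measurable_open.
have /continuousP : continuous (fun x : 'rV[R]_m => x 0 j) by exact: coord_continuous.
by apply; exact: interval_open.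
Qed.

Section Fubini.
Variables (MM : {set {set 'I_m}}) (a : {set 'I_m} -> R).
Local Notation G := (green_kernel MM a).

Lemma measurable_green :
  measurable_fun setT (fun z : borelRn R m * borelRn R m => G z.1 z.2).
Proof.
have mk U : measurable_fun setT (fun z : borelRn R m * borelRn R m => tens (kfac U z.2) z.1).
  apply: measurable_prod => j _.
  have m1 : measurable_fun setT (fun z : borelRn R m * borelRn R m => (z.1 : 'rV[R]_m) 0 j).
    exact: (measurableT_comp (measurable_coord j) measurable_fst).
  have m2 : measurable_fun setT (fun z : borelRn R m * borelRn R m => (z.2 : 'rV[R]_m) 0 j).
    exact: (measurableT_comp (measurable_coord j) measurable_snd).
  rewrite /kfac; case: (j \in U); first exact: measurable_funM.
  exact: measurable_minr.
rewrite (_ : (fun z => _) = fun z => tens (kfac finset.set0 z.2) z.1 -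
    \sum_(U <- enum MM) a U * tens (kfac U z.2) z.1); last first.
  by apply/funext => z; rewrite green_kernelE big_enum.
apply: measurable_funB => //; apply: measurable_sum => U.
by apply: measurable_funM => //; exact: measurable_cst.
Qed.

Lemma fubini_green : \int[(mu \x mu)%E]_(z in I `*` I) G z.1 z.2 =
  Imu (fun x => Imu (fun xi => G x xi)).
Proof.
have [K K0 HK] := @green_bounded R m MM a.
have mI := measurable_cube; have mII : measurable (I `*` I) by exact: measurableX.
have int2 : (mu \x mu)%E.-integrable (I `*` I) (EFin \o (fun z => G z.1 z.2)).
  apply: measurable_bounded_integrable => //.
  - change ((mu \x mu)%E (I `*` I) < +oo)%E.
    by rewrite product_measure1E// lte_mul_pinfty// ?fin_num_measure// finite_cube.
  - exact: measurable_funS measurable_green.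
  - exists K; split; first exact: num_real.
    by move=> M KM z [c1 c2]; apply: le_trans (HK _ _ c1 c2) _; exact: ltW.
rewrite /Imu /Rintegral integral_mkcond.
rewrite -integral12_prod_meas1; last by rewrite -integrable_mkcond.
congr fine; rewrite [RHS]integral_mkcond; apply: eq_integral => x _.
rewrite [RHS]patchE; case: ifPn => xI.
  rewrite /comp fineK; last first.
    apply: integrable_fin_num => //; apply: ucont_mu_integrable.
    by rewrite inE in xI; have := Hm_ucont (Hm_green MM a xI); apply: eq_ucont => y _; exact: green_kernelC.
  rewrite [RHS]integral_mkcond; apply: eq_integral => y _.
  rewrite !patchE /=; case: (boolP (y \in I)) => yI.
    by rewrite mem_set//; split; [rewrite inE in xI|rewrite inE in yI].
  by rewrite memNset// => -[_ h]; rewrite mem_set in yI.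
rewrite /fubini_F integral0_eq// => y _; rewrite patchE memNset// => -[h _].
by rewrite mem_set in xI.
Qed.

End Fubini.

End Measure.

(** * The extremal problem *)

Section Extremal.
Context {R : realType} {m : nat}.
Variables (MM : {set {set 'I_m}}) (mu : {finite_measure set (borelRn R m) -> \bar R}).
Implicit Types (f g h : 'rV[R]_m -> R) (x : 'rV[R]_m).

Lemma HMM_lin (c : R) f g : HMM MM f -> HMM MM g -> HMM MM (fun x => c * f x + g x).
Proof.
move=> [Hf f0] [Hg g0]; split; first exact: Hm_lin.
by move=> U UM x cx xU; rewrite (f0 U UM x cx xU) (g0 U UM x cx xU) mulr0 addr0.
Qed.

Lemma admissibleE f : admissible MM mu f <-> HMM MM f /\ Imu mu f = 1.
Proof. by split=> [[h1 h2 h3]|[[h1 h3] h2]]; split. Qed.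

Lemma Imu_linH (c : R) f g : Hm f -> Hm g ->
  Imu mu (fun x => c * f x + g x) = c * Imu mu f + Imu mu g.
Proof. by move=> Hf Hg; apply: Imu_lin; exact: Hm_ucont. Qed.

Lemma Imu_small f (e : R) : Hm f -> 0 <= e -> normH2 f <= e ^+ 2 ->
  `|Imu mu f| <= e * fine (mu (cube : set (borelRn R m))).
Proof.
move=> Hf e0 fe; apply: Imu_bound; first exact: Hm_ucont.
move=> x cx; rewrite -(@ler_pXn2r _ 2)// ?nnegrE//.
by rewrite -normrX ger0_norm ?sqr_ge0//; apply: le_trans (Hm_sup Hf cx) fe.
Qed.

Lemma normH2_midpoint f g : Hm f -> Hm g ->
  normH2 (fun x => f x - g x) = 2 * normH2 f + 2 * normH2 g -
  4 * normH2 (fun x => 2^-1 * (f x - g x) + g x).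
Proof.
move=> Hf Hg; have HB := HmB Hf Hg; rewrite (normH2_lin _ HB Hg).
have -> : normH2 f = normH2 (fun x => 1 * (f x - g x) + g x).
  by congr normH2; apply/funext => x; ring.
by rewrite normH2_lin//; field.
Qed.

(** A minimising sequence is a Cauchy sequence, by the parallelogram identity. *)
Lemma extremal_exists : (exists f, admissible MM mu f) ->
  exists f, extremal_solution MM mu f.
Proof.
move=> [f0 adm0]; pose S := [set normH2 f | f in admissible MM mu].
have S0 : S !=set0 by exists (normH2 f0), f0.
have lbS : lbound S 0 by move=> _ [f [Hf _ _] <-]; exact: normH2_ge0.
have hS : has_inf S by split=> //; exists 0.
pose d := inf S.
have dS f : admissible MM mu f -> d <= normH2 f.
  by move=> af; apply: ge_inf; [exists 0|exists f].
have /choice[F HF] : forall n, exists f, admissible MM mu f /\ normH2 f < d + n.+1%:R^-1.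
  move=> n; have n0 : 0 < n.+1%:R^-1 :> R by rewrite invr_gt0 ltr0n.
  by have [_ [f af <-] fn] := inf_adherent n0 hS; exists f.
have aF n : admissible MM mu (F n) by case: (HF n).
have HFn n : Hm (F n) by case: (aF n).
have nF n : normH2 (F n) < d + n.+1%:R^-1 by case: (HF n).
have d0 : 0 <= d by apply: lb_le_inf.
have CF (e : R) : 0 < e -> exists N : nat, forall p q, (N <= p)%N -> (N <= q)%N ->
    normH2 (fun x => F p x - F q x) <= e.
  move=> e0; have e40 : 0 < e / 4 by lra.
  have [N HN] := harmonic_small 1 e40; exists N => p q /HN hp /HN hq.
  rewrite normH2_midpoint//.
  have : d <= normH2 (fun x => 2^-1 * (F p x - F q x) + F q x).
    apply: dS; apply/admissibleE.
    have [/admissibleE[Ap Ip] /admissibleE[Aq Iq]] := (aF p, aF q).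
    have AB : HMM MM (fun x => F p x - F q x).
      have := HMM_lin (-1) Aq Ap; congr HMM; by apply/funext => x; ring.
    split; first exact: HMM_lin.
    rewrite Imu_linH//; last exact: HmB.
    have -> : Imu mu (fun x => F p x - F q x) = -1 * Imu mu (F q) + Imu mu (F p).
      by rewrite -Imu_linH//; congr Imu; apply/funext => x; ring.
    by rewrite Ip Iq; ring.
  rewrite !mul1r in hp hq.
  have := lt_le_trans (nF p) (lerD (lexx d) hp); have := lt_le_trans (nF q) (lerD (lexx d) hq).
  lra.
have [f Hf Ff] := Hm_complete HFn CF.
have HB n := HmB Hf (HFn n).
have point x : cube x -> F n x @[n --> \oo] --> f x.
  move=> cx; apply/cvgn_epsP => e e0; have [N HN] := Ff _ (exprn_gt0 2 e0).
  exists N => n /HN h; rewrite -(@ler_pXn2r _ 2)// ?nnegrE ?(ltW e0)//.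
  by rewrite -normrX ger0_norm ?sqr_ge0//; apply: le_trans (Hm_sup (HB n) cx) h.
have af : admissible MM mu f.
  split=> // [|U UM x cx xU].
    suff : Imu mu f - 1 = 0 by move/eqP; rewrite subr_eq0 => /eqP.
    apply/eqP; rewrite -normr_le0; apply/ler_addgt0Pl => /= e e0; rewrite addr0.
    set M := fine (mu (cube : set (borelRn R m))).
    have M0 : 0 <= M by exact: fine_ge0.
    have M1 : 0 < M + 1 by lra.
    have eM := divr_gt0 e0 M1; have [N HN] := Ff _ (exprn_gt0 2 eM).
    have [_ I1 _] := aF N.
    have -> : Imu mu f - 1 = Imu mu (fun x => f x - F N x).
      rewrite -[1]I1; have -> : (fun x => f x - F N x) = (fun x => -1 * F N x + f x).
        by apply/funext => x; ring.
      by rewrite Imu_linH//; rewrite /Imu; ring.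
    apply: le_trans (Imu_small (HB N) (ltW eM) (HN N (leqnn _))) _.
    by rewrite -/M mulrAC ler_pdivrMr// ler_wpM2l ?(ltW e0)//; lra.
  apply: cvg_unique (point x cx) _ => //.
  rewrite (_ : (fun n => _) = fun=> 0); first exact: cvg_cst.
  by apply/funext => n; have [_ _ z] := aF n; exact: z UM x cx xU.
exists f; split=> // g ag; apply: le_trans (dS g ag).
apply/ler_addgt0Pl => e e0; have e40 : 0 < e / 4 by lra.
have d10 : 0 <= d + 1 by lra.
have [r r0 Hr] := sqr_small d10 e40.
have [N1 H1] := Ff _ r0; have [N2 H2] := Ff _ e40; have [N3 H3] := harmonic_small 1 e40.
pose n := maxn N1 (maxn N2 N3).
have n1 : (N1 <= n)%N by rewrite leq_maxl.
have n2 : (N2 <= n)%N by rewrite leq_max leq_max leqnn orbT.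
have n3 : (N3 <= n)%N by rewrite leq_max [X in _ || X]leq_max leqnn !orbT.
have -> : normH2 f = normH2 (fun x => 1 * (f x - F n x) + F n x).
  by congr normH2; apply/funext => x; ring.
rewrite normH2_lin// expr1n mul1r mulr1.
have h3 := H3 n n3; rewrite mul1r in h3.
have h4 := lt_le_trans (nF n) (lerD (lexx d) h3).
have inv1 : n.+1%:R^-1 <= 1 :> R by rewrite invf_le1 ?ltr0n// ler1n.
have h5 := lt_le_trans (nF n) (lerD (lexx d) inv1).
have h6 : `|dotH (fun x => f x - F n x) (F n)| <= e / 4.
  apply: (Hr _ (normH2 (fun x => f x - F n x))); first by rewrite normH2_ge0//= H1.
  apply: le_trans (dotH_CS (HB n) (HFn n)) _.
  by rewrite mulrC ler_wpM2r ?normH2_ge0// ltW.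
have := H2 n n2; have := ler_norm (dotH (fun x => f x - F n x) (F n)); lra.
Qed.

Lemma extremal_ext f g : (forall x, cube x -> f x = g x) ->
  extremal_solution MM mu f -> extremal_solution MM mu g.
Proof.
move=> fg [[Hf If f0] fmin]; split.
  split; first exact: Hm_ext Hf.
    by rewrite -[RHS]If; apply: Imu_eq => x cx; rewrite fg.
  by move=> U UM x cx xU; rewrite -fg//; exact: f0 UM x cx xU.
by move=> h ah; rewrite -(normH2_ext fg Hf); exact: fmin.
Qed.

(** First variation: the norm of f + t h is minimal at t = 0. *)
Lemma extremal_orthogonal f h : extremal_solution MM mu f -> HMM MM h -> Imu mu h = 0 ->
  dotH h f = 0.
Proof.
move=> [/admissibleE[Af If] fmin] Ah Ih; have [Hf _] := Af; have [Hh _] := Ah.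
have P t : 0 <= t ^+ 2 * normH2 h + 2 * t * dotH h f.
  have /fmin : admissible MM mu (fun x => t * h x + f x).
    by apply/admissibleE; split; [exact: HMM_lin|rewrite Imu_linH// Ih If mulr0 add0r].
  by rewrite normH2_lin//; lra.
have N0 := normH2_ge0 Hh; have N1 : 0 < normH2 h + 1 by lra.
(* Nearly the minimiser of the quadratic; the denominator cannot vanish. *)
have := P (- dotH h f / (normH2 h + 1)).
have -> : (- dotH h f / (normH2 h + 1)) ^+ 2 * normH2 h +
    2 * (- dotH h f / (normH2 h + 1)) * dotH h f =
    - (dotH h f ^+ 2 * (normH2 h + 2)) / (normH2 h + 1) ^+ 2.
  by field; lra.
rewrite pmulr_lge0 ?invr_gt0 ?exprn_gt0// oppr_ge0 pmulr_lle0; last by lra.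
by move=> H; apply/eqP; rewrite -sqrf_eq0 eq_le H sqr_ge0.
Qed.

Section Representation.
Variable (a : {set 'I_m} -> R).
Hypothesis hup : upward_closed MM.
Hypothesis ha : green_coefs MM a.
Local Notation G := (green_kernel MM a).

(** Orthogonality to the direction G(., x) - c f, with c such that it has integral 0. *)
Lemma extremal_rep f x : extremal_solution MM mu f -> cube x ->
  f x = normH2 f * Imu mu (G x).
Proof.
move=> ef cx; have [/admissibleE[Af If] _] := ef; have [Hf _] := Af.
have AG := HMM_green hup ha cx; have [HG _] := AG.
have IG : Imu mu (G x) = Imu mu (fun y => G y x).
  by apply: Imu_eq => y _; rewrite green_kernelC.
have := extremal_orthogonal ef (HMM_lin (- Imu mu (G x)) Af AG).
rewrite Imu_linH// If -IG mulr1 addNr => /(_ erefl).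
rewrite dotH_lin// dotHH// [dotH _ f]dotHC (green_reproducing _ cx Af).
by rewrite mulNr addrC => /eqP; rewrite subr_eq0 mulrC => /eqP.
Qed.

Lemma extremal_lambda f : extremal_solution MM mu f ->
  normH2 f * Imu mu (fun x => Imu mu (G x)) = 1.
Proof.
move=> ef; have [[Hf If _] _] := ef.
have n0 : normH2 f != 0.
  apply/eqP => n0; have := oner_neq0 R; rewrite -[1]If => /eqP; apply.
  transitivity (Imu mu (fun=> 0)).
    by apply: Imu_eq => x cx; rewrite (extremal_rep ef cx) n0 mul0r.
  apply/eqP; rewrite -normr_le0; apply: le_trans (@Imu_bound _ _ mu 0 _ _ _) _.
  - exact: ucont_cst.
  - by move=> x _; rewrite normr0.
  - by rewrite mul0r.
have -> : Imu mu (fun x => Imu mu (G x)) = Imu mu (fun x => (normH2 f)^-1 * f x + 0 * f x).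
  apply: Imu_eq => x cx; rewrite mul0r addr0 [in RHS](extremal_rep ef cx).
  by rewrite mulrA mulVf// mul1r.
have -> : Imu mu (fun x => (normH2 f)^-1 * f x + 0 * f x) = (normH2 f)^-1.
  have -> : (fun x => (normH2 f)^-1 * f x + 0 * f x) =
      (fun x => ((normH2 f)^-1 - 1) * f x + f x) by apply/funext => x; ring.
  by rewrite Imu_linH// [Imu mu f]If; ring.
by rewrite divff.
Qed.

Lemma extremal_problem : (exists f, admissible MM mu f) ->
  let lambda := Imu mu (fun x => Imu mu (G x)) in
  lambda != 0 /\ forall f, extremal_solution MM mu f <->
    (forall x, cube x -> f x = lambda^-1 * Imu mu (G x)).
Proof.
move=> /extremal_exists[f ef] lambda.
have l0 : lambda != 0.
  apply/eqP => l0; have := extremal_lambda ef; rewrite -/lambda l0 mulr0 => /eqP.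
  by rewrite eq_sym oner_eq0.
have rep g : extremal_solution MM mu g -> forall x, cube x -> g x = lambda^-1 * Imu mu (G x).
  move=> eg x cx; rewrite (extremal_rep eg cx); congr (_ * _).
  by apply: (mulIf l0); rewrite mulVf//; exact: extremal_lambda.
split=> // g; split; first exact: rep.
by move=> gE; apply: (extremal_ext _ ef) => x cx; rewrite gE// (rep f ef x cx).
Qed.

End Representation.

End Extremal.

(** * The boundary-value problem: the kernel is a solution *)

Section Local.
Context {R : realType} {m : nat}.
Implicit Types (x xi : 'rV[R]_m) (f g phi : 'rV[R]_m -> R) (U V W : {set 'I_m}).
Implicit Types (D O : set 'rV[R]_m) (s : seq 'I_m).

Definition coord_open O := forall x i, O x ->
  exists2 d : R, 0 < d & forall h, `|h| < d -> O (x + h *: delta_mx 0 i).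

Lemma pdl_local D O s f g x : coord_open O -> D x -> O x ->
  (forall y, D y -> O y -> f y = g y) -> pdl D s f x = pdl D s g x.
Proof.
move=> oO + + fg; elim: s x => [|i s IH] x Dx Ox /=; first exact: fg.
have [d d0 Hd] := oO x i Ox.
rewrite /pd (pd_quotient_local (O := O) (g := pdl D s g) Dx Ox)//.
by exists d => // h hd _; exact: Hd.
Qed.

Lemma pd_cst D i (c : R) x : thick D -> D x ->
  pderivable D i (fun=> c) x /\ pd D i (fun=> c) x = 0.
Proof.
move=> tD Dx; apply: pdcvg_pd => // e e0; exists 1 => // h _ _ _.
by rewrite subrr mulr0 subrr normr0.
Qed.

Lemma Ck_cst D k (c : R) : thick D -> Ck D k (fun=> c).
Proof.
move=> tD; elim: k c => [|k IH] c; split=> //; try exact/continuous_subspaceT/cst_continuous.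
move=> i; split=> [x Dx|]; first exact: (pd_cst i c tD Dx).1.
by apply: Ck_ext (IH 0) => x Dx; rewrite (pd_cst i c tD Dx).2.
Qed.

Lemma pdl_cst D s (c : R) x : thick D -> s != [::] -> D x -> pdl D s (fun=> c) x = 0.
Proof.
move=> tD; have z i (y : 'rV[R]_m) : D y -> pd D i (fun=> c) y = 0 by move=> /(pd_cst i c tD)[].
elim: s x => [//|i [|j s] IH] x _ Dx /=; first exact: z.
rewrite (pd_ext i Dx (g := fun=> 0)) ?(pd_cst i 0 tD Dx).2// => y Dy.
exact: IH.
Qed.

Lemma pdl0 D s x : thick D -> D x -> pdl D s (fun=> 0) x = 0.
Proof. by move=> tD Dx; case: s => [//|i s]; exact: pdl_cst. Qed.

(** ** Pairing with test functions *)

Definition collar W (e : R) : set 'rV[R]_m :=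
  [set x | exists2 i, i \in W & x 0 i < e \/ 1 - e < x 0 i].

Lemma collar_open W e : coord_open (collar W e).
Proof.
move=> x i [j jW xj]; have [d d0 Hd] : exists2 d : R, 0 < d &
    forall h, `|h| < d -> x 0 j + h < e \/ 1 - e < x 0 j + h.
  case: xj => xj.
    exists (e - x 0 j); first by rewrite subr_gt0.
    by move=> h; rewrite ltr_norml => /andP[_ ?]; left; lra.
  exists (x 0 j - (1 - e)); first by rewrite subr_gt0.
  by move=> h; rewrite ltr_norml => /andP[? _]; right; lra.
exists d => // h /Hd H; exists j => //; rewrite shift_coord set_coordE.
by case: eqP => [<-//|_].
Qed.

Lemma pdl_collar W (e : R) s f x : (forall y, cube y -> collar W e y -> f y = 0) ->
  cube x -> collar W e x -> pdl cube s f x = 0.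
Proof.
move=> f0 cx ex; rewrite (@pdl_local cube (collar W e) s f (fun=> 0) x (@collar_open W e) cx ex f0).
exact: pdl0 (@thick_cube _ _) cx.
Qed.

Lemma int_ext s f g x : (forall y, cube y -> f y = g y) -> cube x ->
  tensor (fun=> itg 0 1) s f x = tensor (fun=> itg 0 1) s g x.
Proof.
move=> fg; elim: s x => [|i s IH] x cx /=; first exact: fg.
by apply: eq_itg => t It; apply: IH; apply: set_coord_cube; rewrite ?cIE.
Qed.

Definition dd W phi := pdU cube W (pdU cube W phi).

Lemma dist_pd2E W f phi : dist_pd2 W f phi =
  tensor (fun=> itg 0 1) (enum W) (fun y => f y * dd W phi y).
Proof. by []. Qed.

Lemma dist_pd2_ext W f g phi x : (forall y, cube y -> f y = g y) -> cube x ->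
  dist_pd2 W f phi x = dist_pd2 W g phi x.
Proof. by move=> fg; apply: int_ext => y cy; rewrite fg. Qed.

Lemma test_Ck W phi s k : test_fun W phi -> Ck cube k (pdl cube s phi).
Proof. by move=> [cphi _ _]; apply: Ck_pdl. Qed.

Lemma ucont_dd W phi : test_fun W phi -> ucont cube (dd W phi).
Proof.
move=> tp; apply: (@Ck_ucont _ _ 0); apply: Ck_pdl; rewrite addn0.
exact: test_Ck tp.
Qed.

Lemma dist_pd2_lin W (c : R) f g phi x : test_fun W phi -> ucont cube f -> ucont cube g ->
  cube x -> dist_pd2 W (fun y => c * f y + g y) phi x =
  c * dist_pd2 W f phi x + dist_pd2 W g phi x.
Proof.
move=> /ucont_dd ud uf ug cx; rewrite !dist_pd2E.
rewrite -(tensor_lin bfun_int _ c _ _ cx); [|exact: ucontM cube_compact _ _..].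
by congr (tensor _ _ _ x); apply/funext => y; ring.
Qed.

(** In each variable of W, the second derivative of min(t, xi_j) is minus the Dirac mass at
xi_j, and the linear factors are annihilated. Two integrations by parts, from the kernel to
the test function, give this without differentiating the kernel. *)
Lemma dist_pd2_kfac W U xi phi x : cube xi -> test_fun W phi -> cube x ->
  dist_pd2 W (tens (kfac U xi)) phi x =
  \prod_(j in ~: W) kfac U xi j (x 0 j) *
  ((\prod_(j in W) (if j \in U then 0 else -1)) * phi xi).
Proof.
move=> cxi tp cx; have [cphi phiW [e e0 phi0]] := tp.
have uk j : ucont cI (kfac U xi j).
  by rewrite /kfac; case: (j \in U); [exact: ucontZ ucont_id|exact: ucont_min].
have udd := ucont_dd tp; set s := enum W.
have us : uniq s by exact: enum_uniq.
pose c (y : 'rV[R]_m) : R := \prod_(j <- enum (~: W)) kfac U xi j (y 0 j).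
have ui : forall i, i \in s -> indep i c.
  by move=> i; rewrite mem_enum => iW; apply: indep_prod; rewrite mem_enum inE negbK.
have uc : ucont cube c by exact: ucont_coord_prod.
have upr : ucont cube (fun y => dd W phi y * \prod_(j <- s) kfac U xi j (y 0 j)).
  by apply: ucontM cube_compact udd _; exact: ucont_coord_prod.
have -> : dist_pd2 W (tens (kfac U xi)) phi x =
    tensor (fun=> itg 0 1) s
      (fun y => c y * (dd W phi y * \prod_(j <- s) kfac U xi j (y 0 j))) x.
  rewrite dist_pd2E; congr (tensor _ _ _ x); apply/funext => y.
  rewrite /tens (bigID (mem W))/= /c /s !big_enum/= mulrAC mulrC.
  rewrite [in RHS](eq_bigl (fun j => j \notin W)) => [|j]; last by rewrite inE.
  by ring.
rewrite (tensor_pull bfun_int ui uc upr cx) /c big_enum/=.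
congr (_ * _).
rewrite (tensor_weight bfun_int uk us udd cx).
have xi1 j : `|xi 0 j| <= 1 by exact: cube_le1.
have Ixi j : cI (xi 0 j) by exact: cube_cI.
have bK j : bfun 1 (wint (kfac U xi j)).
  apply: bfun_wint => // t; rewrite cIE => /andP[t0 t1]; rewrite /kfac.
  have /andP[h0 h1] := cxi j; case: (j \in U).
    by rewrite normrM mulr_ile1// ger0_norm.
  by rewrite ger0_norm ?le_min ?t0// ge_min t1.
have brep := bfun_rep U cxi.
(* First integration by parts: from the kernel to L1, then to L2 as phi vanishes near 1. *)
pose L1 j (g : R -> R) := xi 0 j * dlt 1 g + -1 * rep_fun U xi j g.
have bL1 j : bfun 2 (L1 j).
  apply: bfunW (bfunDl (bfunZl (xi 0 j) (bfun_dlt cI1)) (bfunZl (-1) (brep j))).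
  by rewrite normrN normr1 !mulr1; have := xi1 j; lra.
pose L2 j (g : R -> R) := -1 * rep_fun U xi j g.
have bL2 j : bfun 1 (L2 j).
  by apply: bfunW (bfunZl (-1) (brep j)); rewrite normrN normr1 mulr1.
(* Second one: from L2 to L3, then to L4 as phi vanishes near 0 and 1. *)
pose L3 j (g : R -> R) := (if j \in U then - xi 0 j else 0) * dlt 1 g +
  ((if j \in U then 0 else -1) * dlt (xi 0 j) g +
   (if j \in U then xi 0 j else 1) * dlt 0 g).
have bL3 j : bfun 3 (L3 j).
  apply: bfunW (bfunDl (bfunZl _ (bfun_dlt cI1))
    (bfunDl (bfunZl _ (bfun_dlt (Ixi j))) (bfunZl _ (bfun_dlt cI0)))).
  by rewrite !mulr1; have := xi1 j; case: (j \in U); rewrite ?normrN ?normr0 ?normr1; lra.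
pose L4 j (g : R -> R) := (if j \in U then 0 else -1) * g (xi 0 j).
have bL4 j : bfun 1 (L4 j).
  apply: bfunW (bfunZl _ (bfun_dlt (Ixi j))).
  by case: (j \in U); rewrite ?normr0 ?normrN ?normr1; lra.
have u1 : ucont cube (pdl cube s phi) by exact: (@Ck_ucont _ _ 0) (test_Ck _ _ tp).
rewrite /dd !pdUE (@tensor_pdl _ _ 1 2 _ L1)//; last 2 first.
- move=> j _ p q cpq; rewrite /L1 /rep_fun /dlt /kfac; have /andP[h0 h1] := cxi j.
  case: (j \in U); last by rewrite (by_parts_min (cxi j) cpq); ring.
  have -> : itg 0 1 (fun t => xi 0 j * t * q t) = xi 0 j * itg 0 1 (fun t => t * q t).
    rewrite -(bfunZ (bfun_itg (lexx 0) ler01 (lexx 1))); last first.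
      by case: cpq => _ uq _; exact: ucontM cI_compact ucont_id uq.
    by congr itg; apply/funext => t; ring.
  by rewrite (by_parts_id cpq); ring.
- exact: test_Ck tp.
have van (t : R) i y : i \in s -> cube y -> t = 0 \/ t = 1 -> y 0 i = t -> collar W e y.
  rewrite mem_enum => iW cy tE yt; exists i => //; rewrite yt.
  by case: tE => ->; [left|right]; lra.
rewrite (@tensor_congr _ _ 2 1 [set 1] L1 L2 s _ bL1 bL2 u1 _ _ us x cx); first last.
- by move=> j g _ ug g1; rewrite /L1 /L2 /dlt g1 ?mulr0 ?add0r//; exact: cI1.
- move=> i y is_ cy /= y1; apply: (@pdl_collar W e) => //.
  by apply: (van 1 i) => //; right.
rewrite (@tensor_pdl _ _ 1 3 L2 L3)//; last first.
  move=> j _ p q cpq; rewrite /L2 /L3 /rep_fun /dlt; have /andP[h0 h1] := cxi j.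
  case: (j \in U); first by rewrite (FTC (lexx 0) ler01 (lexx 1) cpq); ring.
  by rewrite (FTC (lexx 0) h0 h1 cpq); ring.
rewrite (@tensor_congr _ _ 3 1 [set t | t = 0 \/ t = 1] L3 L4 s phi bL3 bL4 _ _ _ us x cx);
  first last.
- move=> j g _ ug g01; rewrite /L3 /L4 /dlt.
  have -> : g 1 = 0 by apply: g01; [exact: cI1|right].
  have -> : g 0 = 0 by apply: g01; [exact: cI0|left].
  by ring.
- move=> i y is_ cy /= y1; apply: phi0 => //.
  exact: (van (y 0 i) i).
- exact: Ck_ucont (cphi 0%N).
rewrite /L4 tensor_eval// /s big_enum/=; congr (_ * _).
apply: phiW => //; first exact: set_coords_cube.
by move=> i iW; rewrite mxE mem_enum iW.
Qed.

End Local.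

Section Existence.
Context {R : realType} {m : nat}.
Variables (MM : {set {set 'I_m}}) (a : {set 'I_m} -> R).
Hypothesis hne : forall U, U \in MM -> U != finset.set0.
Hypothesis hup : upward_closed MM.
Hypothesis ha : green_coefs MM a.
Implicit Types (x xi : 'rV[R]_m) (f g phi : 'rV[R]_m -> R) (U V W : {set 'I_m}).
Local Notation G := (green_kernel MM a).

(** Away from MM only the main term of the kernel contributes: a set of MM is never
contained in V, so its correction term has a linear factor outside V. *)
Lemma dist_pd2_green V xi phi x : V \notin MM -> cube xi -> test_fun (~: V) phi -> cube x ->
  dist_pd2 (~: V) (fun y => G y xi) phi x =
  \prod_(j in V) Num.min (x 0 j) (xi 0 j) * ((-1) ^+ #|~: V| * phi xi).
Proof.
move=> VM cxi tp cx; have udd := ucont_dd tp.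
have uk U := ucont_kfac U xi.
have usum : ucont cube (fun y => \sum_(U in MM) a U * tens (kfac U xi) y).
  by apply: ucont_sum => U _; exact: ucontZ.
have -> : (fun y => G y xi) = (fun y => -1 * (\sum_(U in MM) a U * tens (kfac U xi) y) +
    tens (kfac finset.set0 xi) y).
  by apply/funext => y; rewrite green_kernelE; ring.
rewrite dist_pd2_lin//.
have -> : dist_pd2 (~: V) (fun y => \sum_(U in MM) a U * tens (kfac U xi) y) phi x =
    \sum_(U in MM) a U * dist_pd2 (~: V) (tens (kfac U xi)) phi x.
  rewrite dist_pd2E (_ : (fun y => _ * dd _ _ y) =
    fun y => \sum_(U in MM) (a U * tens (kfac U xi) y) * dd (~: V) phi y); last first.
    by apply/funext => y; rewrite mulr_suml.
  rewrite (tensor_sum bfun_int)//; last first.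
    by move=> U; apply: ucontM cube_compact _ _ => //; exact: ucontZ.
  apply: eq_bigr => U _; rewrite dist_pd2E -(tensorZ bfun_int)//; last first.
    exact: ucontM cube_compact _ _.
  by congr (tensor _ _ _ x); apply/funext => y; rewrite mulrA.
rewrite big1 ?mulr0 ?add0r => [|U UM]; last first.
  rewrite dist_pd2_kfac//; have /subsetPn[j jU jV] : ~~ (U \subset V).
    by apply: contra VM => UV; exact: hup UV UM.
  have jW : j \in ~: V by rewrite inE.
  by rewrite (bigD1 j jW)/= jU !mul0r !mulr0.
rewrite dist_pd2_kfac// finset.setCK; congr (_ * (_ * _)).
  by apply: eq_bigr => j _; rewrite /kfac inE.
by rewrite -prodr_const; apply: eq_bigr => j _; rewrite inE.
Qed.

Lemma open_cube_cube xi : open_cube xi -> cube xi.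
Proof. by move=> oxi i; have /andP[/ltW -> /ltW ->] := oxi i. Qed.

(** Close to the face x_V = 1 one has min(x_j, xi_j) = xi_j for j in V, so the pairing with a
test function is constant there. *)
Lemma natural_bc_green V xi : open_cube xi -> V \notin MM -> V != finset.set0 ->
  natural_bc V (fun x => G x xi).
Proof.
move=> oxi VM V0; have cxi := open_cube_cube oxi.
have [e e0 He] : exists2 e : R, 0 < e & forall i, xi 0 i <= 1 - e.
  have P : (forall i, i \in enum 'I_m -> xi 0 i < 1) by move=> i _; have /andP[] := oxi i.
  suff [e e0 He] : exists2 e : R, 0 < e & forall i, i \in enum 'I_m -> xi 0 i <= 1 - e.
    by exists e => // i; apply: He; rewrite mem_enum.
  elim: (enum _) P => [|i s IH] P; first by exists 1.
  have [|e e0 He] := IH; first by move=> j js; apply: P; rewrite inE js orbT.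
  have xi1 := P i (mem_head _ _).
  exists (Num.min e (1 - xi 0 i)); first by rewrite lt_min e0 subr_gt0.
  move=> j; rewrite inE => /predU1P[->|/He h].
    have : Num.min e (1 - xi 0 i) <= 1 - xi 0 i by rewrite ge_min lexx orbT.
    lra.
  have : Num.min e (1 - xi 0 i) <= e by rewrite ge_min lexx.
  lra.
exists e => // phi tp; have tD := @thick_near_face R m V e e0.
pose c := \prod_(j in V) xi 0 j * ((-1) ^+ #|~: V| * phi xi).
have E y : near_face V e y -> c = dist_pd2 (~: V) (fun x => G x xi) phi y.
  move=> [cy yV]; rewrite dist_pd2_green// /c; congr (_ * _).
  by apply: eq_bigr => j jV; rewrite min_r//; apply: le_trans (He j) (yV j jV).
split; first by apply: Ck_ext E _; exact: Ck_cst.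
move=> x cx xV; have Dx : near_face V e x.
  by split=> // i /xV ->; rewrite gerBl ltW.
rewrite pdUE -(pdl_ext _ Dx E) pdl_cst// -size_eq0 -cardE.
by rewrite cards_eq0.
Qed.

Lemma bvp_green xi : open_cube xi -> bvp_solution MM (fun phi => phi xi) (fun x => G x xi).
Proof.
move=> oxi; have cxi := open_cube_cube oxi; split.
- exact: Hm_green.
- by move=> U UM; exact: green_zero_on_face.
- by move=> V VM V0; exact: natural_bc_green.
- move=> phi tp.
  have VM : finset.set0 \notin MM by apply/negP => /hne; rewrite eqxx.
  have := @dist_pd2_green finset.set0 xi phi 0 VM cxi; rewrite finset.setC0 => -> //.
    by rewrite big_set0 mul1r cardsT card_ord mulrA -expr2 -exprM muln2 -signr_odd odd_double mul1r.
  exact: cube0.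
Qed.

Lemma natural_bc_ext V f g : (forall x, cube x -> f x = g x) -> natural_bc V f -> natural_bc V g.
Proof.
move=> fg [e e0 H]; exists e => // phi tp; have [H1 H2] := H phi tp.
have E y : near_face V e y -> dist_pd2 (~: V) f phi y = dist_pd2 (~: V) g phi y.
  by move=> [cy _]; exact: dist_pd2_ext.
split; first exact: Ck_ext E H1.
move=> x cx xV; rewrite -[RHS](H2 x cx xV) !pdUE; apply/esym/pdl_ext => //.
by split=> // i /xV ->; rewrite gerBl ltW.
Qed.

Lemma bvp_ext T f g : (forall x, cube x -> f x = g x) -> bvp_solution MM T f ->
  bvp_solution MM T g.
Proof.
move=> fg [h1 h2 h3 h4]; split.
- exact: Hm_ext h1.
- by move=> U UM x cx xU; rewrite -fg//; exact: h2 UM x cx xU.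
- by move=> V VM V0; apply: natural_bc_ext fg (h3 V VM V0).
- by move=> phi tp; rewrite -h4// (dist_pd2_ext _ _ fg)//; exact: cube0.
Qed.

Lemma continuous_green : continuous (fun z : 'rV[R]_m * 'rV[R]_m => G z.1 z.2).
Proof.
have ck U : continuous (fun z : 'rV[R]_m * 'rV[R]_m => tens (kfac U z.2) z.1).
  apply: (continuous_big (@mul_continuous R)) => j _ z.
  have c1 : {for z, continuous (fun z : 'rV[R]_m * 'rV[R]_m => z.1 0 j)}.
    exact: (continuous_comp (@cvg_fst _ _ _ _ _) (@coord_continuous _ _ _ 0 j z.1)).
  have c2 : {for z, continuous (fun z : 'rV[R]_m * 'rV[R]_m => z.2 0 j)}.
    exact: (continuous_comp (@cvg_snd _ _ _ _ _) (@coord_continuous _ _ _ 0 j z.2)).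
  by rewrite /kfac; case: (j \in U); [exact: (cvgM c2 c1)|exact: (continuous_min c1 c2)].
rewrite (_ : (fun z => _) = fun z : 'rV[R]_m * 'rV[R]_m => tens (kfac finset.set0 z.2) z.1 -
    \sum_(U in MM) a U * tens (kfac U z.2) z.1); last first.
  by apply/funext => z; rewrite green_kernelE.
move=> z; apply: cvgB; first exact: ck.
apply: (cvg_big (@add_continuous R)) => U _.
by apply: cvgM; [exact: cvg_cst|exact: ck].
Qed.

Lemma is_green_green G' : (forall x xi, cube x -> cube xi -> G' x xi = G x xi) ->
  is_green MM G'.
Proof.
move=> E; split.
  apply: subspace_eq_continuous (continuous_subspaceT continuous_green) => z.
  by rewrite inE => -[c1 c2] /=; exact/esym/E.
move=> xi oxi; apply: bvp_ext (bvp_green oxi) => x cx.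
by rewrite E//; exact: open_cube_cube.
Qed.

End Existence.

(** * The boundary-value problem: uniqueness *)

Section OneVariableTests.
Context {R : realType}.
Implicit Types (g phi : R -> R) (a e t : R).

Definition test1 phi := smooth phi /\
  exists2 e, 0 < e & forall t, t < e \/ 1 - e < t -> phi t = 0.

Lemma smin_le e a t : 0 < e -> t <= a -> smin e a t = t.
Proof. by move=> e0 ta; rewrite /smin ramp_le0 ?mulr0 ?subr0// scale_le0. Qed.

Lemma smin_ge e a t : 0 < e -> a + e <= t -> smin e a t = a.
Proof.
move=> e0 ta; rewrite /smin ramp_ge1 ?scale_ge1// -mulrBr mulrA divff ?gt_eqF//.
by rewrite mul1r; ring.
Qed.

Lemma smooth_dsmin e a : 0 < e -> smooth (dsmin e a).
Proof. by move=> e0; rewrite -derive1_smin//; apply: smooth_deriv; exact: smooth_smin. Qed.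

Definition ddsmin e a : R -> R := derive1 (dsmin e a).

Lemma ddsminE e a t : ddsmin e a t = - (e^-1 * derive1 (derive1 ramp) (e^-1 * t - e^-1 * a)).
Proof.
apply: (@is_derive_derive1 _ _ (fun t => - (e^-1 * derive1 (derive1 ramp) (e^-1 * t - e^-1 * a)))).
have H1 := smooth_is_derive (e^-1 * t + - (e^-1 * a)) (smooth_deriv (@ramp_smooth R)).
have H2 := is_derive_aff e^-1 (- (e^-1 * a)) t.
have H3 := @is_derive1_comp _ (derive1 ramp) (fun t => e^-1 * t - e^-1 * a) _ _ _ H1 H2.
have H4 := is_deriveB (is_derive_cst (1 : R) t 1) H3.
by apply: is_derive_eq H4 _; rewrite sub0r mulrC.
Qed.

Lemma itg_ddsmin e a : 0 < e -> 0 <= a -> a + e <= 1 -> itg 0 1 (ddsmin e a) = -1.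
Proof.
move=> e0 a0 ae; rewrite (FTC (lexx 0) ler01 (lexx 1) (smooth_c1 (smooth_dsmin a e0))).
by rewrite dsmin_ge// dsmin_le// sub0r.
Qed.

(** The functions - [ddsmin e a] form a Dirac sequence at a: they live on [a, a + e], are of
order 1 / e and have integral 1. *)
Lemma ddsmin_dirac : exists2 K : R, 0 <= K & forall g (e a eta : R), ucont cI g -> 0 < e ->
  0 <= a -> a + e <= 1 -> 0 <= eta ->
  (forall t, a <= t <= a + e -> `|g t - g a| <= eta) ->
  `|wint (ddsmin e a) g + g a| <= K * eta.
Proof.
have [K K1 HK] := @ramp_bounds R; exists K; first lra.
move=> g e a eta ug e0 a0 ae eta0 geta.
have ud : ucont cI (ddsmin e a) by have [] := smooth_c1 (smooth_dsmin a e0).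
have -> : wint (ddsmin e a) g + g a = itg 0 1 (fun t => ddsmin e a t * (g t - g a)).
  have -> : wint (ddsmin e a) g = itg 0 1 (fun t => g a * ddsmin e a t +
      ddsmin e a t * (g t - g a)).
    by congr itg; apply/funext => t; ring.
  rewrite itg_lin//; last by apply: ucontM cI_compact ud _; apply: ucontB ug (@ucont_cst _ _ _ _).
  by rewrite itg_ddsmin//; ring.
have -> : K * eta = K / e * eta * (a + e - a).
  by rewrite [a + e]addrC addrK mulrAC divfK ?gt_eqF.
apply: itg_supp => //; try lra.
- by rewrite !mulr_ge0// ?invr_ge0; lra.
- by apply: ucontM cI_compact ud _; apply: ucontB ug (@ucont_cst _ _ _ _).
- move=> t _; rewrite normrM ddsminE; have [|ta] := leP t a => [ta|].
    by rewrite ddramp_le0 ?scale_le0// mulr0 oppr0 normr0 mul0r !mulr_ge0 ?invr_ge0//; lra.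
  have [|te] := leP (a + e) t => [te|].
    by rewrite ddramp_ge1 ?scale_ge1// mulr0 oppr0 normr0 mul0r !mulr_ge0 ?invr_ge0//; lra.
  apply: ler_pM => //; last by apply: geta; lra.
  rewrite normrN normrM gtr0_norm ?invr_gt0// mulrC.
  apply: ler_wpM2r; first by rewrite invr_ge0 ltW.
  by have [] := HK (e^-1 * t - e^-1 * a).
- move=> t _ /orP[ta|ta]; rewrite ddsminE.
    by rewrite ddramp_le0 ?scale_le0// mulr0 oppr0 mul0r.
  by rewrite ddramp_ge1 ?scale_ge1// mulr0 oppr0 mul0r.
Qed.

(** The combination of smoothed positive parts with vertices e, a and q whose weights are
chosen so that it vanishes for large arguments; as its vertices are inside (0, 1), it is a test
function, and its second derivative approximates a combination of three Dirac masses. *)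
Lemma three_point_test e q a : 0 < e -> e < q -> e <= a -> a <= q -> q + 2 * e = 1 ->
  exists phi (u : R), [/\ test1 phi, 0 <= u <= 1 &
    forall g, ucont cI g -> let D s := wint (ddsmin e s) g in
      wint (derive1 (derive1 phi)) g = (1 - u) * D e + u * D q - D a].
Proof.
move=> e0 eq ea aq qe; have q0 : 0 < q - e by lra.
pose u := (a - e) / (q - e).
have ua : (1 - u) * e + u * q = a.
  have -> : (1 - u) * e + u * q = e + u * (q - e) by ring.
  by rewrite divfK ?gt_eqF//; ring.
have u01 : 0 <= u <= 1.
  by apply/andP; split; [rewrite divr_ge0//; lra|rewrite ler_pdivrMr// mul1r; lra].
clearbody u.
pose comb (F : R -> R -> R) t := (1 - u) * F e t + u * F q t - F a t.
have dcomb (F : R -> R -> R) : (forall s, smooth (F s)) ->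
    derive1 (comb F) = comb (fun s => derive1 (F s)).
  move=> sF; apply/funext => t; apply: (@is_derive_derive1 _ _ (comb (fun s => derive1 (F s)))).
  have D s := smooth_is_derive t (sF s).
  apply: is_deriveB; apply: is_deriveD; exact: is_deriveZ.
exists (comb (smin e)), u; split=> //.
- split; first by move=> k; apply: Ck1B; [apply: Ck1D; apply: Ck1Z|]; exact: smooth_smin.
  exists e => // t [te|te]; rewrite /comb.
    by rewrite !smin_le//; try lra; ring.
  rewrite !smin_ge//; try lra.
- move=> g ug D; rewrite dcomb; last by move=> s; exact: smooth_smin.
  have -> : comb (fun s => derive1 (smin e s)) = comb (dsmin e).
    by rewrite /comb; apply/funext => t; rewrite !derive1_smin.
  rewrite dcomb; last by move=> s; exact: smooth_dsmin.
  have ud s : ucont cI (fun t => ddsmin e s t * g t).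
    by apply: ucontM cI_compact _ ug; have [] := smooth_c1 (smooth_dsmin s e0).
  rewrite -[comb _]/(comb (ddsmin e)) /D; move: (ddsmin e) ud {D dcomb} => D ud.
  transitivity (itg 0 1 (fun t => -1 * (D a t * g t) + ((1 - u) * (D e t * g t) +
      u * (D q t * g t)))).
    by congr itg; apply/funext => t; rewrite /comb; ring.
  rewrite itg_lin//; last by apply: ucontD; exact: ucontZ.
  rewrite itg_lin//; last exact: ucontZ.
  by rewrite (bfunZ (bfun_itg (lexx 0) ler01 (lexx 1)))// /wint; ring.
Qed.

(** A continuous function vanishing at 0 and 1 is determined by its second derivative in the
sense of distributions: the outer masses of a three-point test function sit where the function
is small. *)
Lemma zero1 g : ucont cI g -> g 0 = 0 -> g 1 = 0 ->
  (forall phi, test1 phi -> wint (derive1 (derive1 phi)) g = 0) ->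
  forall a, cI a -> g a = 0.
Proof.
move=> ug g0 g1 gphi a; rewrite cIE => /andP[a0 a1].
move: a0 a1; rewrite le_eqVlt => /predU1P[<-//|a0].
rewrite le_eqVlt => /predU1P[->//|a1].
have [K K0 HK] := ddsmin_dirac.
apply/eqP; rewrite -normr_le0; apply/ler_addgt0Pl => /= eps eps0; rewrite addr0.
pose eta := eps / (3 * K + 2).
have K2 : 0 < 3 * K + 2 by lra.
have eta0 : 0 < eta by rewrite divr_gt0.
have epsE : eps = (3 * K + 2) * eta by rewrite mulrC divfK ?gt_eqF.
clearbody eta.
have [d d0 Hd] := ug _ eta0.
have [e [e0 e3 ea ae ed]] : exists e, [/\ 0 < e, e < 3^-1, e <= a, a <= 1 - 2 * e & 2 * e < d].
  exists (Num.min (1 / 4) (Num.min a (Num.min ((1 - a) / 2) (d / 4)))).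
  rewrite !lt_min; set mn := Num.min _ _.
  have h1 : mn <= 1 / 4 by rewrite ge_min lexx.
  have h2 : mn <= a by rewrite !ge_min lexx orbT.
  have h3 : mn <= (1 - a) / 2 by rewrite !ge_min lexx !orbT.
  have h4 : mn <= d / 4 by rewrite !ge_min lexx !orbT.
  by split; rewrite ?a0/=; lra.
have gd s t : 0 <= s <= 1 -> 0 <= t <= 1 -> `|s - t| < d -> `|g s - g t| < eta.
  by move=> h1 h2 h3; apply: Hd => //; rewrite cIE.
have near s : 0 <= s -> s + e <= 1 -> `|wint (ddsmin e s) g + g s| <= K * eta.
  move=> s0 s1; apply: HK => //; first exact: ltW.
  by move=> t /andP[t1 t2]; apply/ltW/gd; rewrite ?ger0_norm; try apply/andP; lra.
have [q qe] : exists q, q + 2 * e = 1 by exists (1 - 2 * e); ring.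
have [q0 q1 e1 a1'] : [/\ 0 <= q, q + e <= 1, e + e <= 1 & a + e <= 1].
  by clear - e0 e3 ea ae qe; split; lra.
have [phi [u [tphi /andP[u0 u1] Hphi]]] : exists phi (u : R), [/\ test1 phi, 0 <= u <= 1 &
    forall g, ucont cI g -> let D s := wint (ddsmin e s) g in
      wint (derive1 (derive1 phi)) g = (1 - u) * D e + u * D q - D a].
  by apply: three_point_test => //; lra.
have [D [nearD ED]] : exists D : R -> R, (forall s, 0 <= s -> s + e <= 1 ->
    `|D s + g s| <= K * eta) /\ (1 - u) * D e + u * D q - D a = 0.
  by exists (fun s => wint (ddsmin e s) g); split; [exact: near|rewrite -Hphi//; exact: gphi].
move: ED; have := nearD a; have := nearD e; have := nearD q.
have : `|g e - g 0| < eta by apply: gd; rewrite ?ger0_norm; try apply/andP; lra.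
have : `|g q - g 1| < eta.
  by apply: gd; rewrite ?ler0_norm; try apply/andP; lra.
rewrite g0 g1 !subr0.
move: (D e) (D q) (D a) => A B C.
move=> hq hp /(_ q0 q1) HB /(_ (ltW e0) e1) HA /(_ (ltW a0) a1') HC E.
have Ab : `|A| <= K * eta + eta.
  have -> : A = (A + g e) - g e by ring.
  by apply: le_trans (ler_normB _ _) _; apply: lerD HA (ltW hp).
have Bb : `|B| <= K * eta + eta.
  have -> : B = (B + g q) - g q by ring.
  by apply: le_trans (ler_normB _ _) _; apply: lerD HB (ltW hq).
have -> : g a = (C + g a) - ((1 - u) * A + u * B) by lra.
apply: le_trans (ler_normB _ _) _.
apply: (@le_trans _ _ (K * eta + ((K * eta + eta) + (K * eta + eta)))); last by rewrite epsE; lra.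
apply: lerD HC _; apply: le_trans (ler_normD _ _) _; rewrite !normrM.
apply: lerD; [apply: le_trans Ab|apply: le_trans Bb]; rewrite ger0_norm ?subr_ge0// ler_piMl//.
by rewrite gerBl.
Qed.

Lemma wint_dd_id phi : test1 phi -> wint (derive1 (derive1 phi)) (fun t => t) = 0.
Proof.
move=> [sphi [e e0 phi0]]; rewrite /wint; have s1 := smooth_deriv sphi.
have -> : itg 0 1 (fun t => derive1 (derive1 phi) t * t) =
    itg 0 1 (fun t => t * derive1 (derive1 phi) t).
  by congr itg; apply/funext => t; rewrite mulrC.
rewrite (by_parts_id (smooth_c1 s1)) (FTC (lexx 0) ler01 (lexx 1) (smooth_c1 sphi)).
rewrite !phi0; [|by left|by right; lra].
have -> : derive1 phi 1 = 0; last by ring.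
apply: (@is_derive_derive1 _ _ (fun=> 0)); apply: (@near_eq_is_derive _ _ _ (fun=> 0)) => //.
  near=> t; apply/esym/phi0; right; near: t.
  by apply: lt_nbhsr; lra.
Unshelve. all: by end_near.
Qed.

Lemma test1_0 : test1 (fun=> 0).
Proof. by split; [move=> k; exact: Ck1_cst|exists 1]. Qed.

Lemma bfun_wint_dd phi : test1 phi -> exists C, bfun C (wint (derive1 (derive1 phi))).
Proof.
move=> [/smooth_deriv/smooth_deriv/smooth_c1[ud _ _] _].
have [K K0 HK] := ucont_bounded cI_compact ud; exists K.
by apply: bfun_wint => //; exact: ltW.
Qed.

End OneVariableTests.

Section TensorTests.
Context {R : realType} {m : nat}.
Implicit Types (x y : 'rV[R]_m) (f w : 'rV[R]_m -> R) (U V : {set 'I_m}) (s : seq 'I_m).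
Implicit Types (Phi : 'I_m -> R -> R) (L : 'I_m -> (R -> R) -> R).
Local Notation all := (enum (allI m)).

Lemma tensor_fam L L' s f : (forall j, j \in s -> L j = L' j) -> tensor L s f = tensor L' s f.
Proof.
elim: s => [//|i s IH] LL'; rewrite /= LL' ?mem_head// IH// => j js.
by apply: LL'; rewrite inE js orbT.
Qed.

Lemma tensor_cat_fam L L' s s' f x : (forall j, j \in s -> L j = L' j) ->
  tensor L s (tensor L' s' f) x = tensor L' (s ++ s') f x.
Proof. by move=> LL'; rewrite tensor_cat (tensor_fam _ LL'). Qed.

(** The value at x only involves the points that agree with x outside s. *)
Lemma tensor_zero_on C L s f x : (forall j, bfun C (L j)) -> ucont cube f -> cube x ->
  (forall y, cube y -> (forall j, j \notin s -> y 0 j = x 0 j) -> f y = 0) ->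
  tensor L s f x = 0.
Proof.
move=> bL uf; elim: s x => [|i s IH] x cx f0 /=; first exact: f0.
rewrite -(bfun0 (bL i)); apply: (bfun_eq (bL i)).
- exact: (ucont_slice i (ucont_tensor bL s uf) cx).
- exact: ucont_cst.
move=> t It; apply: IH => [|y cy yx]; first exact: set_coord_cube.
apply: f0 => // j; rewrite inE negb_or => /andP[ji js].
by rewrite yx// set_coordE (negPf ji).
Qed.

Lemma tensor_prod C L s (c : 'I_m -> R -> R) x : (forall j, bfun C (L j)) ->
  (forall j, ucont cI (c j)) -> uniq s -> cube x ->
  tensor L s (fun y => \prod_(j <- s) c j (y 0 j)) x = \prod_(j <- s) L j (c j).
Proof.
move=> bL uc; elim: s x => [|i s IH] x; first by rewrite /= !big_nil.
rewrite [uniq _]/= => /andP[is_ us] cx; rewrite [LHS]/=.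
have up s' := ucont_coord_prod s' uc.
transitivity (L i (fun t => \prod_(j <- s) L j (c j) * c i t)); last first.
  by rewrite (bfunZ (bL i))// big_cons mulrC.
apply: (bfun_eq (bL i)).
- exact: (ucont_slice i (ucont_tensor bL s (up (i :: s))) cx).
- exact: ucontZ.
move=> t It; have cxt := set_coord_cube i cx It.
transitivity (tensor L s (fun y => c i (y 0 i) * \prod_(j <- s) c j (y 0 j)) (set_coord i t x)).
  by congr (tensor _ _ _ _); apply/funext => y; rewrite big_cons.
rewrite (tensor_pull bL)//.
- by rewrite IH// set_coordE eqxx mulrC.
- by move=> j js; apply: indep_coord; apply: contraNneq is_ => <-.
- exact: ucont_coord.
Qed.

(** A function of one variable that vanishes at 0 is determined by its value at 1 and its
second derivative in the sense of distributions; these are the functionals used here. *)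
Definition probe U Phi j : (R -> R) -> R :=
  if j \in U then dlt 1 else wint (derive1 (derive1 (Phi j))).

Definition tests Phi := forall j, test1 (Phi j).

Lemma bfun_probe U Phi : tests Phi -> exists2 C, 1 <= C & forall j, bfun C (probe U Phi j).
Proof.
move=> tP; apply: common_bound => j; rewrite /probe; case: ifP => _.
  by exists 1; exact/bfun_dlt/cI1.
exact: bfun_wint_dd.
Qed.

Lemma ucont_probe U Phi s f : tests Phi -> ucont cube f -> ucont cube (tensor (probe U Phi) s f).
Proof. by move=> /(bfun_probe U)[C _ bL] uf; exact: (ucont_tensor bL s uf). Qed.

(** A multidimensional form of [zero1], by induction on the number of variables. *)
Lemma zero_test s f : uniq s -> ucont cube f ->
  (forall i x, i \in s -> cube x -> x 0 i = 0 -> f x = 0) ->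
  (forall U Phi x, tests Phi -> cube x -> tensor (probe U Phi) s f x = 0) ->
  forall x, cube x -> f x = 0.
Proof.
elim: s f => [|i s IH] f.
  by move=> _ _ _ H x cx; exact: (H finset.set0 (fun _ _ => 0) x (fun=> test1_0) cx).
rewrite [uniq _]/= => /andP[is_ us] uf f0 H.
have key C (l : (R -> R) -> R) : bfun C l ->
    (forall U Phi x, tests Phi -> cube x -> opi i l (tensor (probe U Phi) s f) x = 0) ->
    forall x, cube x -> opi i l f x = 0.
  move=> bl Hl; apply: IH => //; first exact: (ucont_opi i bl uf).
    move=> j y js cy yj; rewrite /opi -(bfun0 bl); apply: (bfun_eq bl).
    - exact: ucont_slice.
    - exact: ucont_cst.
    move=> t It; apply: (f0 j); [by rewrite inE js orbT|exact: set_coord_cube|].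
    by rewrite set_coordE; case: eqP js is_ => [->|//] ->.
  move=> U Phi x tP cx; have [D _ bL] := bfun_probe U tP.
  by rewrite -(opi_tensor bL bl)//; exact: Hl.
have off U U' Phi Phi' : (forall j, j != i -> (j \in U) = (j \in U') /\ Phi j = Phi' j) ->
    tensor (probe U Phi) s f = tensor (probe U' Phi') s f.
  move=> E; apply: tensor_fam => j js; rewrite /probe.
  by have [|-> ->//] := E j; apply: contraNneq is_ => <-.
move=> x cx; rewrite -(set_coord_id i x).
apply: (@zero1 R (fun t => f (set_coord i t x))) (cube_cI i cx).
- exact: ucont_slice.
- apply: (f0 i); [exact: mem_head|exact: set_coord_cube cx cI0|].
  by rewrite set_coordE eqxx.
- apply: (key 1 (dlt 1)) cx; first exact/bfun_dlt/cI1.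
  move=> U Phi y tP cy; have := H (i |: U) Phi y tP cy.
  rewrite /= {1}/probe finset.setU11 => <-; congr (opi _ _ _ _); apply: off => j ji.
  by rewrite !inE (negPf ji).
- move=> phi tphi; have [C bl] := bfun_wint_dd tphi.
  apply: (key C (wint (derive1 (derive1 phi)))) cx => //.
  move=> U Phi y tP cy.
  have [Phi' [P'i P'off]] : exists Phi', Phi' i = phi /\ forall j, j != i -> Phi' j = Phi j.
    by exists (fun j => if j == i then phi else Phi j); rewrite eqxx; split=> // j /negPf ->.
  have tP' : tests Phi'.
    by move=> j; have [->|/P'off -> //] := eqVneq j i; rewrite P'i.
  have E : tensor (probe U Phi) s f = tensor (probe (U :\ i) Phi') s f.
    by apply: off => j ji; rewrite !inE ji P'off.
  have Ei : probe (U :\ i) Phi' i = wint (derive1 (derive1 phi)).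
    by rewrite /probe finset.setD11 P'i.
  by rewrite E -Ei; exact: (H _ _ y tP' cy).
Qed.

(** Probing the variables in U by evaluation at 1 amounts to restricting to a face. *)
Lemma probe_face U Phi w x : tests Phi -> ucont cube w -> cube x ->
  tensor (probe U Phi) all w x =
  tensor (probe finset.set0 Phi) (enum (~: U)) w (on_face U x).
Proof.
move=> tP uw cx; have [C _ bL] := bfun_probe U tP.
rewrite (@tensor_perm _ _ C _ bL _ (enum U ++ enum (~: U)))//; last 2 first.
- exact: enum_uniq.
- apply: uniq_perm; rewrite ?enum_uniq// ?cat_uniq ?enum_uniq//=.
    by rewrite andbT; apply/hasPn => j; rewrite !mem_enum !inE.
  by move=> j; rewrite mem_cat !mem_enum !inE orbN.
rewrite tensor_cat (@tensor_fam _ (fun j g => 1 * g 1) (enum U)).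
  rewrite tensor_eval ?enum_uniq// big1 ?mul1r// (@tensor_fam _ (probe finset.set0 Phi) (enum (~: U))).
    congr (tensor _ _ _ _); apply/rowP => j; rewrite !mxE mem_enum//.
  by move=> j; rewrite mem_enum inE /probe inE => /negPf ->.
move=> j; rewrite mem_enum /probe => ->.
by apply/funext => g; rewrite mul1r.
Qed.

End TensorTests.

Section Uniqueness.
Context {R : realType} {m : nat}.
Implicit Types (x y xi : 'rV[R]_m) (f w : 'rV[R]_m -> R) (U V W : {set 'I_m}).
Implicit Types (Phi : 'I_m -> R -> R).
Local Notation all := (enum (allI m)).

Definition tensor_test W Phi : 'rV[R]_m -> R :=
  tens (fun j => if j \in W then Phi j else fun=> 1).

Lemma smooth_tensor_test W Phi j : tests Phi -> smooth (if j \in W then Phi j else fun=> 1).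
Proof. by move=> tP; case: ifP => _; [have [] := tP j|move=> k; exact: Ck1_cst]. Qed.

Lemma test_fun_tensor W Phi : tests Phi -> test_fun W (tensor_test W Phi).
Proof.
move=> tP; split.
- by move=> k; apply: Ck_tens thick_cube _ => j; exact: smooth_tensor_test.
- by move=> x y _ _ xy; apply: eq_bigr => j _; case: ifP => // /xy ->.
- have [e e0 He] : exists2 e : R, 0 < e &
      forall j, j \in enum 'I_m -> forall t, t < e \/ 1 - e < t -> Phi j t = 0.
    elim: (enum _) => [|j s [e e0 He]]; first by exists 1.
    have [_ [d d0 Hd]] := tP j.
    exists (Num.min e d); first by rewrite lt_min e0.
    have h1 : Num.min e d <= e by rewrite ge_min lexx.
    have h2 : Num.min e d <= d by rewrite ge_min lexx orbT.
    move=> i; rewrite inE => /predU1P[->|/He H] t [te|te].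
    + by apply: Hd; left; apply: lt_le_trans h2.
    + by apply: Hd; right; lra.
    + by apply: H; left; apply: lt_le_trans h1.
    + by apply: H; right; lra.
  exists e => // x cx [i iW xi]; rewrite /tensor_test /tens (bigD1 i)//= iW.
  by rewrite (He i) ?mul0r ?mem_enum.
Qed.

Lemma dist_pd2_tensor W Phi w x : tests Phi -> ucont cube w -> cube x ->
  dist_pd2 W w (tensor_test W Phi) x = tensor (probe finset.set0 Phi) (enum W) w x.
Proof.
move=> tP uw cx; rewrite dist_pd2E.
pose q j := if j \in W then Phi j else fun=> 1 : R.
pose q2 j := if j \in W then derive1 (derive1 (Phi j)) else fun=> 1 : R.
have sq j : smooth (q j) by exact: smooth_tensor_test.
have sq2 j : smooth (q2 j).
  rewrite /q2; case: ifP => _; last by move=> k; exact: Ck1_cst.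
  by apply: smooth_deriv; apply: smooth_deriv; have [] := tP j.
have ddE y : cube y -> dd W (tensor_test W Phi) y = \prod_(j <- enum W) q2 j (y 0 j).
  move=> cy; rewrite /dd !pdUE.
  have E z : cube z -> pdl cube (enum W) (tensor_test W Phi) z =
      tens (fun j => if j \in enum W then derive1 (q j) else q j) z.
    by apply: pdl_tens thick_cube (enum_uniq _) _ => j t; have [] := smooth_is_derive t (sq j).
  rewrite (pdl_ext _ cy E) (pdl_tens thick_cube (enum_uniq _) _ cy).
    rewrite /tens big_enum/= [RHS]big_mkcond/=; apply: eq_bigr => j _.
    by rewrite mem_enum /q2 /q; case: (j \in W).
  move=> j t; case: ifP => _; last by have [] := smooth_is_derive t (sq j).
  by have [] := smooth_is_derive t (smooth_deriv (sq j)).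
transitivity (tensor (fun=> itg 0 1) (enum W)
    (fun y => w y * \prod_(j <- enum W) q2 j (y 0 j)) x).
  by apply: int_ext => // y cy; rewrite ddE.
rewrite (tensor_weight bfun_int _ (enum_uniq _))//; last first.
  by move=> j; have [] := smooth_c1 (sq2 j).
apply: (congr1 (fun f => f x)); apply: tensor_fam => j.
by rewrite mem_enum /probe inE /q2 => ->.
Qed.

Section Core.
Variables (w : 'rV[R]_m -> R).
Hypothesis uw : ucont cube w.
Hypothesis w0 : forall i x, cube x -> x 0 i = 0 -> w x = 0.

(** The second derivative in all the variables outside V of the restriction of w to the face
x_V = 1 is the zero distribution. *)
Definition face_null V := forall Phi x, tests Phi -> cube x ->
  tensor (probe finset.set0 Phi) (enum (~: V)) w (on_face V x) = 0.

Lemma face_null_zero : (forall V, face_null V) -> forall x, cube x -> w x = 0.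
Proof.
move=> H; apply: (@zero_test _ _ all) => //; first exact: enum_uniq.
- by move=> i x _; exact: w0.
- by move=> U Phi x tP cx; rewrite probe_face//; exact: H.
Qed.

(** As a function of x_V, a pairing of w in the other variables has second derivative 0 in each
variable once the smaller sets are dealt with, and it vanishes at x_i = 0; so it is a multiple
of the product of the x_i. The zero test applied to the difference makes this precise. *)
Lemma face_multilinear V Phi : (forall U, U \proper V -> face_null U) -> tests Phi ->
  forall x, cube x ->
  tensor (probe finset.set0 Phi) (enum (~: V)) w x =
  \prod_(j in V) x 0 j * tensor (probe finset.set0 Phi) (enum (~: V)) w (on_face V x).
Proof.
move=> IH tP; set F := tensor _ _ _.
have uF : ucont cube F by exact: ucont_probe.
pose s := enum V; have us : uniq s by exact: enum_uniq.
pose p (x : 'rV[R]_m) := \prod_(j <- s) x 0 j.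
have up : ucont cube p := ucont_coord_prod s (fun=> @ucont_id R).
have uFf : ucont cube (fun x => F (on_face V x)).
  move=> e /uF[d d0 Hd]; exists d => // x y cx cy /(rv_ballP _ _ d0) xy.
  apply: Hd; try exact: on_face_cube; apply/(rv_ballP _ _ d0) => j.
  by rewrite !mxE; case: ifP => _; [rewrite subrr normr0|exact: xy].
have iFf i : i \in s -> indep i (fun x => F (on_face V x)).
  rewrite mem_enum => iV x t cx It; congr F; apply/rowP => j; rewrite !mxE.
  by case: ifP => // jV; case: eqP jV => // ->; rewrite iV.
suff H : forall x, cube x -> F x - F (on_face V x) * p x = 0.
  by move=> x cx; have /eqP := H x cx; rewrite subr_eq0 => /eqP ->; rewrite /p big_enum mulrC.
apply: (zero_test us).
- by apply: ucontB uF _; exact: ucontM cube_compact _ _.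
- move=> i x is_ cx xi0; have -> : p x = 0 by rewrite /p (big_rem i)//= xi0 mul0r.
  rewrite mulr0 subr0.
  have [C _ bL] := bfun_probe finset.set0 tP.
  apply: (tensor_zero_on bL uw cx) => y cy yx; apply: (w0 (i := i)) => //.
  by rewrite yx// mem_enum inE -mem_enum is_.
move=> U Phi' x tP' cx; have [C _ bL] := bfun_probe U tP'.
rewrite (tensorB bL)//; last exact: ucontM cube_compact _ _.
rewrite (tensor_pull bL iFf uFf up cx).
have tensor_on_face f : V \subset U -> tensor (probe U Phi') s f x = f (on_face V x).
  move=> VU; rewrite (@tensor_fam _ _ _ (fun j g => 1 * g 1)).
    rewrite tensor_eval// big1// mul1r; congr f; apply/rowP => j.
    by rewrite !mxE mem_enum.
  move=> j; rewrite mem_enum => jV; rewrite /probe (fintype.subsetP VU _ jV).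
  by apply/funext => g; rewrite mul1r.
have [VU|/subsetPn[i iV iU]] := boolP (V \subset U).
  rewrite !tensor_on_face// /p big_enum/= big1 ?mulr1 ?subrr// => j jV.
  by rewrite mxE jV.
have -> : tensor (probe U Phi') s p x = 0.
  rewrite (tensor_prod bL (fun=> @ucont_id R) us cx) (bigD1_seq i) ?mem_enum//=.
  by rewrite /probe (negPf iU) wint_dd_id ?mul0r.
rewrite mulr0 subr0.
(* The two families of functionals, on V and on its complement, combine into one. *)
pose U' := U :&: V; pose Psi j := if j \in V then Phi' j else Phi j.
have tPsi : tests Psi by move=> j; rewrite /Psi; case: ifP.
have -> : tensor (probe U Phi') s F x = tensor (probe U' Psi) (s ++ enum (~: V)) w x.
  have -> : F = tensor (probe U' Psi) (enum (~: V)) w.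
    apply: tensor_fam => j; rewrite mem_enum inE => jV.
    by rewrite /probe !inE /Psi (negPf jV) andbF.
  have E j : j \in s -> probe U Phi' j = probe U' Psi j.
    by rewrite mem_enum => jV; rewrite /probe inE /Psi jV andbT.
  exact: (@tensor_cat_fam _ _ (probe U Phi') (probe U' Psi) s (enum (~: V)) w x E).
have [D _ bD] := bfun_probe U' tPsi.
rewrite (@tensor_perm _ _ D _ bD _ all)//.
- rewrite probe_face//; apply: IH => //; rewrite properE subsetIr/=.
  by apply/subsetPn; exists i => //; rewrite inE (negPf iU).
- rewrite cat_uniq us enum_uniq andbT /=.
  by apply/hasPn => j; rewrite !mem_enum !inE.
- apply: uniq_perm; rewrite ?enum_uniq// ?cat_uniq ?us ?enum_uniq//=.
    by rewrite andbT; apply/hasPn => j; rewrite !mem_enum !inE.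
  by move=> j; rewrite mem_cat !mem_enum !inE orbN.
Qed.

Lemma face_null_face V : zero_on_face w V -> face_null V.
Proof.
move=> wV Phi x tP cx; have [C _ bL] := bfun_probe finset.set0 tP.
apply: (tensor_zero_on bL uw (on_face_cube _ cx)) => y cy yx; apply: wV => // i iV.
by rewrite yx ?mxE ?iV// mem_enum inE negbK.
Qed.

End Core.

Section BVP.
Variables (MM : {set {set 'I_m}}) (a : {set 'I_m} -> R).
Hypothesis hne : forall U, U \in MM -> U != finset.set0.
Hypothesis hup : upward_closed MM.
Hypothesis ha : green_coefs MM a.
Local Notation G := (green_kernel MM a).

Lemma dist_pd2B W f w phi x : test_fun W phi -> ucont cube f -> ucont cube w -> cube x ->
  dist_pd2 W (fun y => f y - w y) phi x = dist_pd2 W f phi x - dist_pd2 W w phi x.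
Proof.
move=> tp uf uw cx; rewrite addrC -mulN1r -dist_pd2_lin//.
by congr (dist_pd2 _ _ _ _); apply/funext => y; ring.
Qed.

(** Let w be the difference of the two solutions. By induction on V, w satisfies [face_null]:
if V is in MM, then w vanishes on the face x_V = 1; otherwise a pairing of w in the other
variables is a constant times the product of the x_i for i in V, by [face_multilinear], and
this constant is 0 by the differential equation if V is empty, and by the natural boundary
condition if not. *)
Lemma bvp_unique xi f : open_cube xi -> bvp_solution MM (fun phi => phi xi) f ->
  forall x, cube x -> f x = G x xi.
Proof.
move=> oxi [Hf fM fbc feq]; have cxi := open_cube_cube oxi.
have [HG GM _ Geq] := bvp_green hne hup ha oxi.
pose w x := f x - G x xi; have Hw : Hm w by exact: HmB.
have uw := Hm_ucont Hw; have uf := Hm_ucont Hf; have uG := Hm_ucont HG.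
have w0 i x : cube x -> x 0 i = 0 -> w x = 0 by exact: Hm_zero.
suff H V : face_null w V.
  move=> x cx; apply/eqP; rewrite -subr_eq0; apply/eqP.
  by apply: (face_null_zero uw w0 H).
have [n] := ubnP #|V|; elim: n V => // n IHn V /ltnSE Vn.
have IH U : U \proper V -> face_null w U.
  by move=> /proper_card UV; apply: IHn; exact: leq_trans UV Vn.
have [VM|VM] := boolP (V \in MM).
  apply: face_null_face => // x cx xV.
  by rewrite /w (fM V VM)// (GM V VM)// subrr.
move=> Phi x tP cx; have tt := test_fun_tensor (~: V) tP.
have [C _ bL] := bfun_probe finset.set0 tP.
set F := tensor (probe finset.set0 Phi) (enum (~: V)) w.
have FE y : cube y -> F y = dist_pd2 (~: V) f (tensor_test (~: V) Phi) y -
    dist_pd2 (~: V) (fun x => G x xi) (tensor_test (~: V) Phi) y.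
  by move=> cy; rewrite -dist_pd2B// dist_pd2_tensor.
pose one : 'rV[R]_m := const_mx 1.
have cone : cube one by move=> j; rewrite mxE ler01 lexx.
have Fone y : cube y -> F (on_face V y) = F one.
  move=> cy; apply: (@indep_eq _ _ (enum (~: V))).
  - by move=> i is_; apply: (indep_tensor bL uw); left.
  - exact: on_face_cube.
  - exact: cone.
  - by move=> i; rewrite mem_enum inE negbK => iV; rewrite !mxE iV.
rewrite Fone//.
have [V0|V0] := eqVneq V finset.set0.
  rewrite (@indep_eq _ _ (enum (~: V)) F one 0)//.
  - rewrite FE; last exact: cube0.
    have := feq _ (test_fun_tensor (allI m) tP); rewrite -(Geq _ (test_fun_tensor (allI m) tP)).
    rewrite V0 finset.setC0 => /(mulfI _) ->; first exact: subrr.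
    by rewrite signr_eq0.
  - by move=> i is_; apply: (indep_tensor bL uw); left.
  - exact: cube0.
  - by move=> i; rewrite mem_enum V0 !inE.
have [e e0 /(_ _ tt)[_ bc]] := fbc V VM V0.
set g := dist_pd2 _ f _ in bc.
pose c : R := \prod_(j in V) xi 0 j * ((-1) ^+ #|~: V| * tensor_test (~: V) Phi xi).
pose q j : R -> R := if j \in V then fun t => t else fun=> 1.
have sq j : smooth (q j).
  by rewrite /q; case: ifP => _ k; [exact: Ck1_id|exact: Ck1_cst].
(* There the contribution c of the kernel to the pairing of f is constant. *)
pose O : set 'rV[R]_m := [set y | forall i, i \in V -> xi 0 i < y 0 i].
have gE y : near_face V e y -> O y -> g y = F one * tens q y + c.
  move=> [cy _] Oy; have := FE y cy.
  rewrite /F (face_multilinear uw w0 IH tP cy) -/F Fone// dist_pd2_green// -/g => gE.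
  have -> : tens q y = \prod_(j in V) y 0 j.
    by rewrite [RHS]big_mkcond; apply: eq_bigr => j _; rewrite /q; case: ifP.
  move/eqP: gE; rewrite eq_sym subr_eq => /eqP ->; rewrite mulrC; congr (_ + _ * _).
  by apply: eq_bigr => j jV; rewrite min_r// ltW// Oy.
have oO : coord_open O.
  move=> y i Oy; have [iV|iV] := boolP (i \in V); last first.
    exists 1 => // h _ j jV; rewrite shift_coord set_coordE.
    by case: eqP jV iV => [->->//|_ jV _]; exact: Oy.
  exists (y 0 i - xi 0 i); first by rewrite subr_gt0 Oy.
  move=> h; rewrite ltr_norml => /andP[h1 _] j jV; rewrite shift_coord set_coordE.
  by case: eqP => [->|_]; [lra|exact: Oy].
have D1 : near_face V e one by split=> // i _; rewrite mxE gerBl ltW.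
have O1 : O one by move=> i _; rewrite mxE; have /andP[] := oxi i.
have tD := @thick_near_face R m V e e0.
have := bc one cone (fun i _ => mxE _ _ _ _).
rewrite pdUE (pdl_local _ oO D1 O1 gE) pdl_lin//; last 2 first.
- by apply: Ck_tens => // j; exact: sq.
- exact: Ck_cst.
rewrite pdl_cst//; last by rewrite -size_eq0 -cardE cards_eq0.
rewrite addr0 (pdl_tens tD (enum_uniq _) _ D1); last first.
  by move=> j t; have [] := smooth_is_derive t (sq j).
rewrite /tens big1 ?mulr1// => j _; rewrite mem_enum /q; case: (j \in V) => //.
by apply: (@is_derive_derive1 _ _ (fun=> 1)); exact: is_derive_id.
Qed.

(** Points xi on the boundary are approximated by (1 - r) xi + r / 2 in the open cube. *)
Lemma green_unique G' : is_green MM G' ->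
  forall x xi, cube x -> cube xi -> G' x xi = G x xi.
Proof.
move=> [cG' G'bvp] x xi cx cxi.
have cc : compact (@cube R m `*` @cube R m) by apply: compact_setX; exact: cube_compact.
have uG' := (ucontP _ cc).1 cG'.
have uG := (ucontP _ cc).1 (continuous_subspaceT (@continuous_green R m MM a)).
have uD := ucontB uG' uG.
apply/eqP; rewrite -subr_eq0 -normr_le0; apply/ler_addgt0Pl => /= eta eta0; rewrite addr0.
have [d d0 Hd] := uD _ eta0.
pose r := Num.min (d / 2) (1 / 2).
have r0 : 0 < r by rewrite lt_min !divr_gt0.
have rd : r < d by apply: (@le_lt_trans _ _ (d / 2)); [rewrite ge_min lexx|lra].
have r1 : r <= 1 / 2 by rewrite ge_min lexx orbT.
pose xi' : 'rV[R]_m := \row_j ((1 - r) * xi 0 j + r / 2).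
have oxi' : open_cube xi'.
  move=> j; rewrite mxE; have /andP[h0 h1] := cxi j.
  have := mulr_ge0 (_ : 0 <= 1 - r) h0; have := mulr_ge0 (_ : 0 <= 1 - r) (_ : 0 <= 1 - xi 0 j).
  move=> /(_ ltac:(lra) ltac:(lra)) k1 /(_ ltac:(lra)) k2; apply/andP; split; lra.
have := Hd (x, xi) (x, xi') (conj cx cxi) (conj cx (open_cube_cube oxi')) _.
rewrite /= (bvp_unique oxi' (G'bvp _ oxi') cx) subrr subr0 => /(_ _)/ltW; apply.
split=> /=; first exact: ballxx.
apply/(rv_ballP _ _ d0) => j; rewrite mxE; have /andP[h0 h1] := cxi j.
have -> : xi 0 j - ((1 - r) * xi 0 j + r / 2) = r * (xi 0 j - 1 / 2) by field.
rewrite normrM gtr0_norm//; apply: le_lt_trans rd; apply: ler_piMr; first exact: ltW.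
by rewrite ler_norml; apply/andP; split; lra.
Qed.

End BVP.

End Uniqueness.

(** * Solution of the extremal problem by the Green function *)

Theorem lemma3 (R : realType) (m : nat) (hm : (0 < m)%N)
    (MM : {set {set 'I_m}})
    (hne : forall U, U \in MM -> U != finset.set0)
    (hup : upward_closed MM)
    (mu : {finite_measure set (borelRn R m) -> \bar R})
    (hadm : exists Omega, admissible MM mu Omega)
    (a : {set 'I_m} -> R) (ha : green_coefs MM a) :
  let I : set (borelRn R m) := cube in
  let G := green_kernel MM a in
  let lambda := \int[(mu \x mu)%E]_(z in I `*` I) G z.1 z.2 in
  [/\ forall G' : 'rV[R]_m -> 'rV[R]_m -> R,
        is_green MM G' <->
        (forall x xi, cube x -> cube xi -> G' x xi = G x xi),
      lambda != 0
    & forall Omega : 'rV[R]_m -> R,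
        extremal_solution MM mu Omega <->
        (forall x, cube x ->
           Omega x = lambda^-1 * \int[mu]_(xi in I) G x xi)].
Proof.
move=> I G lambda; have [l0 sol] := extremal_problem hup ha hadm.
have lE : lambda = Imu mu (fun x => Imu mu (G x)) by exact: fubini_green.
rewrite lE; split=> // G'; split; first exact: green_unique.
exact: is_green_green.
Qed.
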